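(* Let $\omega$ and $\eta$ be in $H^0(C,\mathcal{I}(D))$, and assume that $|D|\cap\mathrm{Spec}(A)=\emptyset$. Let $h=\max\{0,h'\}$, where $h'=ej-p^j$ for $j=\lceil\log_p(e/(p-1))\rceil$ and $e$ is the ramification index of $K/\mathbb{Q}_p$. Then the contribution from each end to $\pi^h\langle\omega,\phi(\eta)\rangle$ has non-negative valuation. In particular, if $\omega_1,\dots,\omega_{2g}$ are such forms (elements of $H^0(C,\mathcal{I}(D))$) whose classes form an $R$-basis of $H^1_{\mathrm{dR}}(C/R)$, then the matrix $\pi^hM_2$, where $M_2$ has entries $\langle\omega_i,\phi(\omega_j)\rangle$, has entries in $R$.
   Context: $K$ is a finite extension of $\mathbb{Q}_p$ with valuation ring $R$, uniformiser $\pi$, residue field $k$, valuation $v$; $\sigma$ is an automorphism of $K$ inducing $x\mapsto x^{p'}$ on $k$, with $p'$ a power of $p$. $C\to\mathrm{Spec}(R)$ is a proper smooth curve with geometrically irreducible fibres of genus $g$, and $\mathrm{Spec}(A)\subset C$ is an open affine containing the generic point of $C_k$, $A=R[\mathbf{x}]/(f_2,\dots,f_n)$, $\mathbf{x}=(x_1,\dots,x_n)$, such that the maximal minors of $\mathrm{Jac}_{\overline f}$ generate the unit ideal in $\overline A=A\otimes_Rk$. The lift $\phi$: $R\langle\mathbf{x}\rangle$ is the ring of power series over $R$ with coefficients tending to $0$, $R\langle\mathbf{x}\rangle^\dagger$ the overconvergent ones, $A^\dagger=R\langle\mathbf{x}\rangle^\dagger/(f_2,\dots,f_n)$. $\psi$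 is the $\sigma$-semilinear endomorphism of $R\langle\mathbf{x}\rangle$ with $\psi(x_i)=x_i^{p'}$. Fix matrices $P,\Delta_2,\dots,\Delta_n$ over $R[\mathbf{x}]$ with $\mathrm{Jac}_fP\equiv\mathrm{Id}_{n-1}+\sum_jf_j\Delta_j\pmod\pi$; let $\mathbf{s}\in(\pi R\langle\mathbf{x}\rangle)^{n-1}$ be the unique solution of $f^\sigma(\psi(\mathbf{x})+\psi(P)\mathbf{S})-f^{p'}-\sum_jf_j^{p'}\psi(\Delta_j)\mathbf{S}=0$. Then $\phi$ is the $\sigma$-semilinear endomorphism of $A^\dagger$ induced by $\mathbf{x}\mapsto\psi(\mathbf{x})+\psi(P)\mathbf{s}$ (it reduces to the $p'$-power map on $\overline A$). The sheaf $\mathcal{I}(D)$: $D,D'$ are effective divisors on $C$, finite over $R$, with $\deg(D_k)\ge2g-1$ and $d(\mathcal{O}_C(D))\subseteq\Omega^1_{C/R}(D')$. $\mathcal{I}(D)\subseteq\Omega^1_{C/R}(D')$ is the inverse image under $\Omega^1_{C/R}(D')\to\Omega^1_{C/R}(D')/\Omega^1_{C/R}$ of the image of $d:\mathcal{O}_C(D)/\mathcal{O}_C\to\Omega^1_{C/R}(D')/\Omega^1_{C/R}$. One has a surjection $H^0(C,\mathcal{I}(D))\to H^1_{\mathrm{dR}}(C/R)$, which gives the class of an element. Since $|D|\cap\mathrm{Spec}(A)=\emptyset$, elements of $H^0(C,\mathcal{I}(D))$ restrict to $\Omega^1_{A/R}$. Ends and contributions: choose a finite unramified extension $L/K$, with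 valuation ring $R_L$, such that all points $q$ of the special fibre of $C_{R_L}$ outside $\mathrm{Spec}(\overline A)$ are rational over the residue field; these points are the ends. For each such $q$ choose a section $Q:\mathrm{Spec}(R_L)\to C_{R_L}$ reducing to $q$ and a local equation $t\in\mathcal{O}_{C_{R_L},q}$ of $Q$; the completion map $\mathcal{O}_{C_{R_L},q}\to R_L[[t]]$ extends uniquely to an expansion map $\xi_q:A^\dagger\to\{\sum_{m\in\mathbb{Z}}a_mt^m:a_m\in R_L,\ \lim_{m\to-\infty}a_m=0\}$. For $\omega=\sum_i g_i\,dx_i$ and $\eta=\sum_ih_i\,dx_i$ in $\Omega^1_{A/R}$ put $\xi_q(\omega)=\sum_i\xi_q(g_i)\,d\xi_q(x_i)$ and $\xi_q(\phi(\eta))=\sum_i\xi_q(\phi(h_i))\,d\xi_q(\phi(x_i))$. The contribution of the end $q$ to $\langle\omega,\phi(\eta)\rangle$ is $\mathrm{res}_q(\phi(\eta)\int\omega)$: the coefficient of $t^{-1}dt$ in $\xi_q(\phi(\eta))\cdot\int\xi_q(\omega)$, where $\int$ is termwise integration (the forms here have zero coefficient at $t^{-1}dt$). This does not depend on the choice of $t$; and $\langle\omega,\phi(\eta)\rangle$ is the sum over all ends $q$ of these contributions, which lies in $K$. *)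

(* Defs.v *)
From HB Require Import structures.
From mathcomp Require Import all_boot all_order all_algebra all_field.
From mathcomp Require Import boolp classical_sets.
From mathcomp Require Import mpoly.

Set Implicit Arguments.
Unset Strict Implicit.
Unset Printing Implicit Defensive.

Import Order.TTheory GRing.Theory Num.Theory.

Local Open Scope ring_scope.
Local Open Scope classical_set_scope.

(* Discrete valuations. Only the values [v x] with [x != 0] are meaningful. *)
Section Valuations.
Variables (K : fieldType) (v : K -> int).

Definition discrete_valuation : Prop :=
  [/\ forall x y, x != 0 -> y != 0 -> v (x * y) = v x + v y,
      forall x y, x != 0 -> y != 0 -> x + y != 0 ->
        Num.min (v x) (v y) <= v (x + y)
    & exists2 x, x != 0 & v x = 1].

Definition vring : set K := [set x | x = 0 \/ 0 <= v x].
Definition vmax : set K := [set x | x = 0 \/ 0 < v x].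
Definition uniformiser (x : K) : Prop := x != 0 /\ v x = 1.

Definition vclose (N : nat) (x y : K) : Prop := x = y \/ N%:Z <= v (x - y).

Definition vcomplete : Prop :=
  forall u : nat -> K,
    (forall N, exists M, forall m n, (M <= m)%N -> (M <= n)%N ->
       vclose N (u m) (u n)) ->
    exists l, forall N, exists M, forall m, (M <= m)%N -> vclose N (u m) l.

End Valuations.

(* [(Qp, vp)] is the completion of the rationals for the p-adic valuation. *)
Definition is_padic_field (p : nat) (Qp : fieldType) (vp : Qp -> int) : Prop :=
  [/\ prime p,
      discrete_valuation vp,
      forall r : rat, r != 0 ->
        vp (ratr r) = (logn p `|numq r|%N)%:Z - (logn p `|denq r|%N)%:Z,
      forall (x : Qp) N, exists r : rat, vclose vp N x (ratr r)
    & vcomplete vp].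

Definition is_ceil_log (p : nat) (x : rat) (j : int) : Prop :=
  p%:Q ^ (j - 1) < x <= p%:Q ^ j.

Definition mps (K : nzRingType) (n : nat) : Type := 'X_{1..n} -> K.

Section PowerSeries.
Variables (K : comNzRingType) (n : nat).
Implicit Types a b c : mps K n.

HB.instance Definition _ := gen_eqMixin (mps K n).
HB.instance Definition _ := gen_choiceMixin (mps K n).

Definition mps_of (p : {mpoly K[n]}) : mps K n := fun m => p@_m.
Definition mps_add a b : mps K n := fun m => a m + b m.
Definition mps_opp a : mps K n := fun m => - a m.
Definition mps_mul a b : mps K n := fun m =>
  \sum_(k : 'X_{1..n < (mdeg m).+1, (mdeg m).+1} | m == (k.1 + k.2)%MM)
     a k.1 * b k.2.

Let trunc d a : {mpoly K[n]} := \sum_(m : 'X_{1..n < d}) a m *: 'X_[m].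

Let mps_mulE d a b m : (mdeg m < d)%N ->
  mps_mul a b m = (trunc d a * trunc d b)@_m.
Proof.
move=> lt_md; rewrite mcoeffM; apply: eq_bigr => -[k1 k2] _ /=.
by rewrite !mcoeff_mpoly // (leq_trans (bmdeg _)).
Qed.

Fact mps_addA : associative mps_add.
Proof. by move=> a b c; apply/funext => m; rewrite /mps_add addrA. Qed.
Fact mps_addC : commutative mps_add.
Proof. by move=> a b; apply/funext => m; rewrite /mps_add addrC. Qed.
Fact mps_add0 : left_id (mps_of 0) mps_add.
Proof. by move=> a; apply/funext => m; rewrite /mps_add /mps_of mcoeff0 add0r. Qed.
Fact mps_addN : left_inverse (mps_of 0) mps_opp mps_add.
Proof.
by move=> a; apply/funext => m; rewrite /mps_add /mps_opp /mps_of mcoeff0 addNr.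
Qed.

HB.instance Definition _ :=
  GRing.isZmodule.Build (mps K n) mps_addA mps_addC mps_add0 mps_addN.

Let mcoeff_mul_ext (p q p' q' : {mpoly K[n]}) m :
  (forall k, (mdeg k <= mdeg m)%N -> p@_k = p'@_k) ->
  (forall k, (mdeg k <= mdeg m)%N -> q@_k = q'@_k) ->
  (p * q)@_m = (p' * q')@_m.
Proof.
move=> ep eq; rewrite !mcoeffM; apply: eq_bigr => -[k1 k2] _ /=.
by rewrite ep ?eq // -ltnS bmdeg.
Qed.

Let truncE d a k : (mdeg k < d)%N -> (trunc d a)@_k = a k.
Proof. exact: mcoeff_mpoly. Qed.

Fact mps_mulC : commutative mps_mul.
Proof.
by move=> a b; apply/funext => m; rewrite !(@mps_mulE (mdeg m).+1) // mulrC.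
Qed.

Fact mps_mulA : associative mps_mul.
Proof.
move=> a b c; apply/funext => m; pose d := (mdeg m).+1.
rewrite !(@mps_mulE d) //.
transitivity ((trunc d a * (trunc d b * trunc d c))@_m).
  by apply: mcoeff_mul_ext => // k le_km; rewrite truncE ?(@mps_mulE d).
rewrite mulrA; apply: mcoeff_mul_ext => // k le_km.
by rewrite truncE ?(@mps_mulE d).
Qed.

Fact mps_mul1 : left_id (mps_of 1) mps_mul.
Proof.
move=> a; apply/funext => m; rewrite (@mps_mulE (mdeg m).+1) //.
transitivity ((1 * trunc (mdeg m).+1 a)@_m); last by rewrite mul1r truncE.
by apply: mcoeff_mul_ext => // k le_km; rewrite truncE.
Qed.

Fact mps_mulDl : left_distributive mps_mul mps_add.
Proof.
move=> a b c; apply/funext => m; rewrite /mps_add !(@mps_mulE (mdeg m).+1) //.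
rewrite -mcoeffD -mulrDl; apply: mcoeff_mul_ext => // k le_km.
by rewrite mcoeffD !truncE.
Qed.

Fact mps_oner_neq0 : mps_of 1 != mps_of 0.
Proof.
apply/eqP => /(congr1 (fun a : mps K n => a 0%MM)); rewrite /mps_of mcoeff0.
by rewrite mcoeff1 eqxx => /eqP; rewrite oner_eq0.
Qed.

HB.instance Definition _ := GRing.Zmodule_isComNzRing.Build (mps K n)
  mps_mulA mps_mulC mps_mul1 mps_mulDl mps_oner_neq0.

End PowerSeries.

Section Coefficients.
Variables (K : fieldType) (v : K -> int) (n : nat).

Definition poly_over (S : set K) : set {mpoly K[n]} :=
  [set g | forall m, S g@_m].

(* The power series over the valuation ring with coefficients tending to 0. *)
Definition tate : set (mps K n) :=
  [set a | (forall m, vring v (a m)) /\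
           forall N : nat, exists M, forall m, (M <= mdeg m)%N ->
             vclose v N (a m) 0].

(* The overconvergent ones: the valuation of the coefficient of a monomial of
   degree [d] is at least [d / c - b] for suitable [c] and [b]. *)
Definition dagger : set (mps K n) :=
  [set a | (forall m, vring v (a m)) /\
           exists c b : nat, forall m,
             a m = 0 \/ (mdeg m)%:Z <= c%:Z * (v (a m) + b%:Z)].

End Coefficients.

Section Subrings.
Variable F : fieldType.
Implicit Types A B O P V : set F.

Definition is_subring A : Prop :=
  [/\ A 1, forall a b, A a -> A b -> A (a - b)
    & forall a b, A a -> A b -> A (a * b)].

Definition has_fraction_field A : Prop :=
  forall z : F, exists a b, [/\ A a, A b, b != 0 & z = a / b].

Definition is_prime_ideal A (I : set F) : Prop :=
  [/\ I `<=` A, I 0 & ~ I 1] /\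
  [/\ forall a b, I a -> I b -> I (a + b),
      forall a b, A a -> I b -> I (a * b)
    & forall a b, A a -> A b -> I (a * b) -> I a \/ I b].

Definition localisation A (I : set F) : set F :=
  [set z | exists a b, [/\ A a, A b, ~ I b & z = a / b]].

(* The points of Spec A, each represented by its local ring inside F. *)
Definition spec A : set (set F) :=
  [set P | exists2 I, is_prime_ideal A I & P = localisation A I].

Definition maxideal O : set F := [set a | O a /\ (a = 0 \/ ~ O a^-1)].

Definition is_unit_of O (a : F) : Prop := [/\ a != 0, O a & O a^-1].

Definition is_valuation_ring V : Prop :=
  is_subring V /\ forall a, a != 0 -> V a \/ V a^-1.

Definition dominates V P : Prop := P `<=` V /\ maxideal P `<=` maxideal V.

(* The monic polynomial [f] over the ring [A] is irreducible modulo [I]. *)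
Definition irreducible_mod A (I : set F) (f : {poly F}) : Prop :=
  (1 < size f)%N /\
  forall h1 h2 : {poly F}, h1 \is monic -> h2 \is monic ->
    (forall i, A h1`_i) -> (forall i, A h2`_i) ->
    (forall i, I (f - h1 * h2)`_i) -> size h1 = 1%N \/ size h2 = 1%N.

End Subrings.

Section Derivations.
Variables (K F : fieldType) (io : K -> F).

Definition is_derivation (M : lmodType F) (D : F -> M) : Prop :=
  [/\ forall a b, D (a + b) = D a + D b,
      forall a b, D (a * b) = a *: D b + b *: D a
    & forall c : K, D (io c) = 0].

(* [d : F -> Om] is the universal K-derivation, that is, the module of Kaehler
   differentials of F over K. *)
Definition is_kaehler (Om : lmodType F) (d : F -> Om) : Prop :=
  is_derivation d /\
  forall (M : lmodType F) (D : F -> M), is_derivation D ->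
    exists2 u : {linear Om -> M}, (forall a, u (d a) = D a)
      & forall u' : {linear Om -> M}, (forall a, u' (d a) = D a) -> u =1 u'.

End Derivations.

(* Integral separated schemes over the valuation ring R of [(K, v)] are given as
   Chevalley schemes (models in the sense of Zariski): an integral separated
   scheme with function field F is determined by the set of its local rings,
   which are subrings of F; its affine opens are the subsets [spec B], its
   sections over an open set are the elements of F which belong to all the
   local rings, and P is a specialisation of Q iff [P `<=` Q]. Since smooth
   R-schemes have locally free differentials, the stalks of the sheaf of
   differentials are submodules of the differentials of F over K. *)
Section Curves.
Variables (K : fieldType) (v : K -> int) (pi : K).
Variables (F : fieldType) (io : {rmorphism K -> F}).
Variables (Om : lmodType F) (d : F -> Om).

Section Presentations.
Variables (n : nat) (x : 'I_n -> F).

Definition evalx (g : {mpoly K[n]}) : F := mmap io x g.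

Definition alg : set F := [set z | exists2 g, poly_over (vring v) g & z = evalx g].

(* Evaluation at [x] identifies R[X]/(f) with R[x]. *)
Definition is_presentation m (f : 'I_m -> {mpoly K[n]}) : Prop :=
  (forall j, poly_over (vring v) (f j)) /\
  forall g, poly_over (vring v) g ->
    (evalx g = 0 <->
     exists2 c : 'I_m -> {mpoly K[n]}, forall j, poly_over (vring v) (c j)
       & g = \sum_j c j * f j).

Definition jacobian m (f : 'I_m -> {mpoly K[n]}) : 'M[{mpoly K[n]}]_(m, n) :=
  \matrix_(j, i) mderiv i (f j).

(* The maximal minors of the Jacobian matrix generate the unit ideal in the
   quotient of [alg] by its ideal [I]. *)
Definition minors_unit m (f : 'I_m -> {mpoly K[n]}) (I : set F) : Prop :=
  exists2 c : {ffun 'I_m -> 'I_n} -> {mpoly K[n]},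
    (forall s, poly_over (vring v) (c s))
    & I (evalx (\sum_s c s * \det (colsub s (jacobian f))) - 1).

End Presentations.

Variable C : set (set F).
Implicit Types (B P : set F) (U : set (set F)) (D : set F -> F).

Definition is_affine_open B : Prop :=
  [/\ exists n (x : 'I_n -> F), B = alg x,
      has_fraction_field B & spec B `<=` C].

Definition in_special_fibre P : Prop := C P /\ maxideal P (io pi).
Definition in_generic_fibre P : Prop := C P /\ P (io pi)^-1.

Definition is_special_generic_point P0 : Prop :=
  in_special_fibre P0 /\ forall P, in_special_fibre P -> P `<=` P0.

(* [b] induces a basis of M/N over S/I, where N is an S-submodule of M and I an
   ideal of the subring S of K which annihilates M/N. *)
Definition is_basis_mod (S I : set K) (V : lmodType F) (M N : set V) r
    (b : 'I_r -> V) : Prop :=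
  [/\ forall i, M (b i),
      forall z, M z -> exists2 c : 'I_r -> K, forall i, S (c i)
        & N (z - \sum_i io (c i) *: b i)
    & forall c : 'I_r -> K, (forall i, S (c i)) ->
        N (\sum_i io (c i) *: b i) -> forall i, I (c i)].

(* The differentials generated by B: for B = R[x] these are the differentials
   of B over R, for a local ring of C the stalk of the sheaf of differentials. *)
Definition diff_of B : set Om :=
  [set w | exists r (a b : 'I_r -> F),
     [/\ forall i, B (a i), forall i, B (b i) & w = \sum_i a i *: d (b i)]].

(* Smooth of relative dimension 1: locally of the form Spec R[X]/(f) with n
   variables and n - 1 equations, satisfying the Jacobian criterion. *)
Definition is_smooth : Prop :=
  forall P, C P -> exists m (x : 'I_m.+1 -> F) (f : 'I_m -> {mpoly K[m.+1]}),
    [/\ is_affine_open (alg x), spec (alg x) P, is_presentation x f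
      & minors_unit x f [set 0]].

Definition is_finite_type : Prop :=
  exists r (B : 'I_r -> set F), (forall i, is_affine_open (B i)) /\
    forall P, C P -> exists i, spec (B i) P.

(* Every valuation ring of F over R has exactly one centre on C. *)
Definition is_proper : Prop :=
  forall V, is_valuation_ring V -> (forall c, vring v c -> V (io c)) ->
    exists2 P, C P /\ dominates V P
      & forall P', C P' -> dominates V P' -> P' = P.

(* The fibre with function field O/J over the field S/I stays irreducible after
   base change to every finite extension of S/I (S/I is perfect, so that these
   are generated by one element). *)
Definition stays_irreducible (S I : set K) (O J : set F) : Prop :=
  forall f : {poly K}, f \is monic -> (forall i, S f`_i) ->
    irreducible_mod S I f -> irreducible_mod O J (map_poly io f).

Definition has_geom_irreducible_fibres : Prop :=
  stays_irreducible setT [set 0] setT [set 0] /\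
  exists2 P0, is_special_generic_point P0
    & stays_irreducible (vring v) (vmax v) P0 (maxideal P0).

Definition generic_diff : set Om :=
  [set w | forall P, in_generic_fibre P -> diff_of P w].

Definition pi_diff P0 : set Om :=
  [set w | exists2 w', diff_of P0 w' & w = io pi *: w'].

(* Representatives of the global differentials on the special fibre, among the
   rational differentials of the special fibre, which are
   [diff_of P0] modulo [pi_diff P0]. *)
Definition special_diff P0 : set Om :=
  [set w | forall P, in_special_fibre P ->
     exists w1 w2, [/\ diff_of P w1, pi_diff P0 w2 & w = w1 + w2]].

Definition fibres_have_genus (g : nat) : Prop :=
  (exists b : 'I_g -> Om, is_basis_mod setT [set 0] generic_diff [set 0] b) /\
  exists2 P0, is_special_generic_point P0
    & exists b : 'I_g -> Om,
        is_basis_mod (vring v) (vmax v) (special_diff P0) (pi_diff P0) b.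

Record is_curve (g : nat) : Prop := IsCurve {
  curve_finite_type : is_finite_type;
  curve_proper : is_proper;
  curve_smooth : is_smooth;
  curve_geom_irreducible : has_geom_irreducible_fibres;
  curve_genus : fibres_have_genus g }.

(* Effective Cartier divisors: [D P] is a local equation of D at P. *)
Definition is_effective_divisor D : Prop :=
  (forall P, C P -> P (D P) /\ D P != 0) /\
  forall P, C P -> exists B, [/\ is_affine_open B, spec B P
    & forall Q, spec B Q -> is_unit_of Q (D Q / D P)].

Definition in_support D P : Prop := C P /\ maxideal P (D P).

(* D is a closed subscheme Spec B/I of an affine open Spec B, and B/I is a finite
   R-module. *)
Definition is_finite_divisor D : Prop :=
  exists B, [/\ is_affine_open B, (forall P, in_support D P -> spec B P)
    & exists r (b : 'I_r -> F), (forall i, B (b i)) /\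
        forall a, B a -> exists2 c : 'I_r -> K, forall i, vring v (c i)
          & forall P, spec B P -> P ((a - \sum_i io (c i) * b i) / D P)].

(* The degree of the restriction of D to the special fibre, as the sum of the
   dimensions of the local rings P/(pi, D P) over the residue field. *)
Definition has_special_degree D (n : nat) : Prop :=
  exists r (P : 'I_r -> set F) (e : 'I_r -> nat),
    [/\ injective P,
        forall Q, (exists i, P i = Q) <-> in_special_fibre Q /\ in_support D Q,
        forall i, exists b : 'I_(e i) -> F^o,
          is_basis_mod (vring v) (vmax v) (P i : set F^o)
            [set z | exists a1 a2, [/\ P i a1, P i a2
                                      & z = io pi * a1 + D (P i) * a2]] b
      & n = (\sum_i e i)%N].

(* Stalks of O(D) and of the differentials with poles bounded by D. *)
Definition O_stalk D P : set F := [set u | P (D P * u)].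
Definition diff_stalk D P : set Om := [set w | diff_of P (D P *: w)].

(* The stalk at P of the sheaf I(D). *)
Definition I_stalk D D' P : set Om :=
  [set w | diff_stalk D' P w /\ exists2 u, O_stalk D P u & diff_of P (w - d u)].

Definition H0_I D D' : set Om :=
  [set w | forall P, C P -> I_stalk D D' P w].

(* De Rham cohomology as the Cech hypercohomology of a finite affine open cover;
   it does not depend on the cover. *)
Section DeRham.
Variables (r : nat) (B : 'I_r -> set F).

Definition is_affine_cover : Prop :=
  (forall i, is_affine_open (B i)) /\ forall P, C P -> exists i, spec (B i) P.

Definition cech1 : Type := ({ffun 'I_r -> Om} * {ffun 'I_r * 'I_r -> F^o})%type.

Definition dR_cocycle : set cech1 :=
  [set z : cech1 |
    [/\ forall i P, spec (B i) P -> diff_of P (z.1 i),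
        forall i j P, spec (B i) P -> spec (B j) P -> P (z.2 (i, j)),
        forall i j, d (z.2 (i, j)) = z.1 j - z.1 i
      & forall i j k, z.2 (i, j) + z.2 (j, k) = z.2 (i, k)]].

Definition dR_coboundary : set cech1 :=
  [set z : cech1 | exists2 h : 'I_r -> F, forall i P, spec (B i) P -> P (h i)
     & (forall i, z.1 i = d (h i)) /\ forall i j, z.2 (i, j) = h j - h i].

(* The cocycle [z] represents the class of [w] in H^0(C, I(D)): it becomes
   cohomologous to [(w, 0)] in the complex O(D) -> I(D), which is
   quasi-isomorphic to the de Rham complex. *)
Definition dR_represents D (w : Om) (z : cech1) : Prop :=
  exists2 u : 'I_r -> F, forall i P, spec (B i) P -> O_stalk D P (u i)
    & (forall i, w = z.1 i + d (u i)) /\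
      forall i j, 0 = z.2 (i, j) + (u j - u i).

End DeRham.

(* The classes of the forms [om i] are an R-basis of H^1_dR(C/R). *)
Definition classes_form_dR_basis D n (om : 'I_n -> Om) : Prop :=
  exists r (B : 'I_r -> set F), is_affine_cover B /\
    exists z : 'I_n -> cech1 r,
      [/\ forall i, dR_cocycle B (z i), forall i, dR_represents B D (om i) (z i)
        & is_basis_mod (V := cech1 r) (vring v) [set 0]
            (dR_cocycle B) (dR_coboundary B) z].

Definition form_of n (x : 'I_n -> F) (g : 'I_n -> {mpoly K[n]}) : Om :=
  \sum_i evalx x (g i) *: d (x i).

End Curves.

Section Lift.
Variables (K : fieldType) (v : K -> int) (sigma : K -> K) (q : nat).
Variables (m : nat) (f : 'I_m -> {mpoly K[m.+1]}).
Variables (P : 'M[{mpoly K[m.+1]}]_(m.+1, m)).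
Variables (Delta : 'I_m -> 'M[{mpoly K[m.+1]}]_m).

Definition psi (g : {mpoly K[m.+1]}) : {mpoly K[m.+1]} :=
  mmap (fun c => (sigma c)%:MP) (fun i => 'X_i ^+ q) g.

Definition psi_mx r s (A : 'M[{mpoly K[m.+1]}]_(r, s)) : 'M[mps K m.+1]_(r, s) :=
  map_mx (fun g => mps_of (psi g)) A.

Definition is_jacobian_inverse : Prop :=
  [/\ forall i j, poly_over (vring v) (P i j),
      forall l i j, poly_over (vring v) (Delta l i j)
    & forall i j, poly_over (vmax v)
        ((jacobian f *m P - (1%:M + \sum_l f l *: Delta l)) i j)].

Definition subst (y : 'I_m.+1 -> mps K m.+1) (g : {mpoly K[m.+1]}) :
    mps K m.+1 :=
  mmap (fun c => mps_of (sigma c)%:MP) y g.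

Definition lift_point (S : 'cV[mps K m.+1]_m) (i : 'I_m.+1) : mps K m.+1 :=
  mps_of (psi 'X_i) + (psi_mx P *m S) i 0.

Definition is_lift_solution (S : 'cV[mps K m.+1]_m) : Prop :=
  (forall j, tate v (S j 0) /\ forall k, vmax v (S j 0 k)) /\
  forall j, subst (lift_point S) (f j) - mps_of (f j) ^+ q
              - \sum_l mps_of (f l) ^+ q * (psi_mx (Delta l) *m S) j 0 = 0.

(* The lift phi is only applied to elements of A, given by polynomials. *)
Definition phi (S : 'cV[mps K m.+1]_m) : {mpoly K[m.+1]} -> mps K m.+1 :=
  subst (lift_point S).

End Lift.

Section Laurent.
Variables (L : fieldType) (w : L -> int).
Implicit Types a b : int -> L.

(* The sum over m = -M, ..., N - 1 of [a m]. *)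
Definition bisum_part a (M N : nat) : L :=
  \sum_(i < M) a (Negz i) + \sum_(i < N) a (Posz i).

Definition has_bisum a (s : L) : Prop :=
  forall N, exists M0, forall M1 M2, (M0 <= M1)%N -> (M0 <= M2)%N ->
    vclose w N (bisum_part a M1 M2) s.

Definition bisummable a : Prop := exists s, has_bisum a s.
Definition bisum a : L := xget 0 (has_bisum a).

(* The series with coefficients in the valuation ring and tending to 0 in
   negative degrees. *)
Definition laurent : set (int -> L) :=
  [set a | (forall m, vring w (a m)) /\
           forall N, exists M : nat, forall i : nat, (M <= i)%N ->
             vclose w N (a (Negz i)) 0].

Definition lser_mul a b : int -> L := fun m => bisum (fun i => a i * b (m - i)).
Definition lser_deriv a : int -> L := fun m => (m + 1)%:~R * a (m + 1).
(* In degree 0 this is a division by 0, which gives 0. *)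
Definition lser_int a : int -> L := fun m => a (m - 1) / m%:~R.

(* The terms of the series which computes the residue of [b * int a] dt. *)
Definition res_terms a b : int -> L := fun i => b i * lser_int a (-1 - i).

End Laurent.

Section Ends.
Variables (K : fieldType) (v : K -> int) (pi : K).
Variables (F : fieldType) (io : {rmorphism K -> F}) (C : set (set F)).
Variables (L : fieldExtType K) (w : L -> int).
Variables (FL : fieldType) (iF : {rmorphism F -> FL}) (iL : {rmorphism L -> FL}).
Implicit Types (O : set FL).

(* FL is the tensor product of F and L over K. *)
Definition is_tensor_field : Prop :=
  (forall c : K, iF (io c) = iL c%:A) /\
  forall z : FL, exists! c : {ffun 'I_(\dim {:L}) -> F},
    z = \sum_i iF (c i) * iL (vbasis {:L})`_i.

(* The image in FL of the tensor product of B and the valuation ring of L. *)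
Definition base_change (B : set F) : set FL :=
  [set z | exists r (a : 'I_r -> F) (c : 'I_r -> L),
     [/\ forall i, B (a i), forall i, vring w (c i)
       & z = \sum_i iF (a i) * iL (c i)]].

(* The points of the base change of C to the valuation ring of L. *)
Definition base_change_curve : set (set FL) :=
  [set O | exists2 B, is_affine_open v io C B & spec (base_change B) O].

Variables (m : nat) (x : 'I_m.+1 -> F) (f : 'I_m -> {mpoly K[m.+1]}).

Definition is_end O : Prop :=
  [/\ base_change_curve O, maxideal O (iL pi%:A)
    & ~ spec (base_change (alg v io x)) O].

Definition is_rational_point O : Prop :=
  forall a, O a -> exists2 c, vring w c & maxideal O (a - iL c).

(* A section of the base change of C reducing to the point with local ring O. *)
Definition is_section O (rho : FL -> L) : Prop :=
  [/\ forall a b, O a -> O b -> rho (a + b) = rho a + rho b,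
      forall a b, O a -> O b -> rho (a * b) = rho a * rho b,
      forall c, vring w c -> rho (iL c) = c,
      forall a, O a -> vring w (rho a)
    & forall a, maxideal O a -> vmax w (rho a)].

Definition is_section_equation O (rho : FL -> L) (t : FL) : Prop :=
  [/\ O t, t != 0 & forall a, O a -> (rho a = 0 <-> O (a / t))].

(* The power series [a] is the image of [b] in the completion of O: it is
   congruent to [b] modulo all powers of [t]. *)
Definition is_completion_image O (t b : FL) (a : int -> L) : Prop :=
  [/\ forall i : nat, a (Negz i) = 0, forall i, vring w (a i)
    & forall N : nat, O ((b - \sum_(i < N) iL (a (Posz i)) * t ^+ i) / t ^+ N)].

(* [xi] is a ring homomorphism from the overconvergent series modulo [f] to the
   two-sided series which extends the completion map of O. *)
Definition is_expansion_map O (t : FL) (xi : mps K m.+1 -> int -> L) : Prop :=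
  let dg := dagger v (n := m.+1) in
  [/\ forall a, dg a -> laurent w (xi a),
      xi 1 = (fun i => (i == 0)%:R),
      forall a b, dg a -> dg b -> xi (a + b) = (fun i => xi a i + xi b i)
        /\ xi (a * b) = lser_mul w (xi a) (xi b),
      forall j, xi (mps_of (f j)) = (fun=> 0)
    & forall g b c sb sc, poly_over (vring v) g -> O b -> O c -> c != 0 ->
        is_completion_image O t b sb -> is_completion_image O t c sc ->
        iF (evalx io x g) = b / c ->
        lser_mul w (xi (mps_of g)) sc = sb].

(* For the image [gp i], [xp i] of [g i], [x i] in the overconvergent series,
   the expansion of sum_i gp_i d(xp_i). *)
Definition expand_form (xi : mps K m.+1 -> int -> L)
    (gp xp : 'I_m.+1 -> mps K m.+1) : int -> L :=
  fun k => \sum_i lser_mul w (xi (gp i)) (lser_deriv (xi (xp i))) k.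

(* The terms of the series which defines res_q(phi(eta) int omega), for omega =
   sum_i g_i dx_i and eta = sum_i h_i dx_i. *)
Definition contribution_terms (ph : {mpoly K[m.+1]} -> mps K m.+1)
    (xi : mps K m.+1 -> int -> L) (g h : 'I_m.+1 -> {mpoly K[m.+1]}) : int -> L :=
  res_terms
    (expand_form xi (fun i => mps_of (g i)) (fun i => mps_of 'X_i))
    (expand_form xi (fun i => ph (h i)) (fun i => ph 'X_i)).

Definition contribution ph xi g h : L := bisum w (contribution_terms ph xi g h).

End Ends.

(* Main.v *)
Require Import Defs.
From HB Require Import structures.
From mathcomp Require Import all_boot all_order all_algebra all_field.
From mathcomp Require Import boolp classical_sets.
From mathcomp Require Import mpoly.
From mathcomp Require Import zify ring.

Set Implicit Arguments.
Unset Strict Implicit.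
Unset Printing Implicit Defensive.

Import Order.TTheory GRing.Theory Num.Theory.

Local Open Scope ring_scope.
Local Open Scope classical_set_scope.

(* Fix an end q, and let P be the local ring of C below it. At P a global section
   of I(D) has the form du + sum_k a_k db_k, where the a_k, b_k lie in P and u is
   a fraction whose denominator has Gauss norm 1. Both the expansion X = xi and
   Xi = xi o phi extend to such fractions (properness makes P part of the local
   ring of A at the kernel of X modulo pi) and to relations between differentials.
   Since X maps P to power series in t, the principal part of the integral of
   omega is that of X(u), which is integral. It remains to bound, for the lift,
   the coefficient of t^(-1-m) in Xi(a) d Xi(b) divided by m, for a, b in P.

   Choose tau in P whose expansion is a parameter modulo pi. As the residue field
   is finite, P is contained in P^Q + pi P + tau P for some power Q of p. On
   iterating, Xi(a) d Xi(b) becomes, modulo terms divisible by high powers of p or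
   having no relevant pole, a sum of terms
     sigma(pi)^i Xi(z)^(Q^M) Xi(tau)^j d Xi(tau)
   whose integrals are Xi(z)^(Q^M) Xi(tau)^(j+1) / (j+1) up to factors. Write
   Xi(tau) = X(tau)^p' + y, where pi divides y and X(tau) is a power series: by
   the binomial theorem only the quotients y^i / i contribute poles. Finally
   v(pi^i / i) >= -h, since i >= p^s for s = v_p(i) and the maximum of e s - p^s
   over the natural numbers s is attained at s = j. *)

(** * Discrete valuations and their extensions *)

(** The contribution is a two-sided infinite sum, and all estimates are termwise. The denominator m
    comes from integrating the coefficient of t^(m-1) in omega; it is transferred to the coefficient
    of t^(-1-m) in phi(eta), where exact parts absorb it. One estimate, used with two choices of
    constants, gives both the bound and the convergence of the sum. Three obstacles shape the proof.
    The expansion map is only given on overconvergent series, so the solution [S] has to be shown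
    overconvergent before xi o phi makes sense. Expansions of the lift have infinitely many negative
    powers of t, so cutting the iteration after finitely many steps requires a bound, uniform over
    P, for the growth of the poles modulo each power of the maximal ideal. Finally a denominator j+1
    may be highly divisible by p, while the elements of P in front of it are arbitrary. This is why
    they are made Q^M-th powers: the differential of such a power is divisible by a high power of p,
    and Xi(z)^(Q^M) is congruent to a power series to the same kind of precision. *)

Section Valuation.
Variables (K : fieldType) (v : K -> int) (hv : discrete_valuation v).
Implicit Types (x y : K) (n : int).

(** The case [x = 0] stands apart because [v 0] is an arbitrary integer. The predicate is membership
    in the n-th power of the maximal ideal, also for negative [n]. *)
Definition vge n x : Prop := x = 0 \/ n <= v x.

Lemma valM x y : x != 0 -> y != 0 -> v (x * y) = v x + v y.
Proof. by case: hv => h _ _; exact: h. Qed.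

Lemma val1 : v 1 = 0.
Proof.
have := valM (oner_neq0 K) (oner_neq0 K); rewrite mulr1; move: (v 1) => z; lia.
Qed.

Lemma valN x : x != 0 -> v (- x) = v x.
Proof.
move=> x0; have n1 : (-1 : K) != 0 by rewrite oppr_eq0 oner_neq0.
have := valM n1 n1; rewrite mulrNN mulr1 val1 => h.
by rewrite -mulN1r valM //; lia.
Qed.

Lemma valV x : x != 0 -> v x^-1 = - v x.
Proof.
move=> x0; have := valM x0 (invr_neq0 x0); rewrite divff // val1; lia.
Qed.

Lemma valX x k : x != 0 -> v (x ^+ k) = v x * k%:Z.
Proof.
move=> x0; elim: k => [|k IH]; first by rewrite expr0 val1 mulr0.
by rewrite exprS valM ?expf_neq0 // IH; lia.
Qed.

Lemma vge0 n : vge n 0. Proof. by left. Qed.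

Lemma vge_le n n' x : n' <= n -> vge n x -> vge n' x.
Proof. by move=> le [->|h]; [left|right; lia]. Qed.

Lemma vgeD n x y : vge n x -> vge n y -> vge n (x + y).
Proof.
case=> [->|hx]; first by rewrite add0r.
case=> [->|hy]; first by rewrite addr0; right.
have [->|x0] := eqVneq x 0; first by rewrite add0r; right.
have [->|y0] := eqVneq y 0; first by rewrite addr0; right.
have [->|xy0] := eqVneq (x + y) 0; first by left.
case: hv => _ h _; have h1 := h x y x0 y0 xy0; right.
by apply: le_trans h1; rewrite le_min hx hy.
Qed.

Lemma vgeN n x : vge n x -> vge n (- x).
Proof.
case=> [->|hx]; first by rewrite oppr0; left.
have [->|x0] := eqVneq x 0; first by rewrite oppr0; left.
by right; rewrite valN.
Qed.

Lemma vgeB n x y : vge n x -> vge n y -> vge n (x - y).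
Proof. by move=> hx hy; apply: vgeD => //; exact: vgeN. Qed.

Lemma vgeBC n x y : vge n (x - y) -> vge n (y - x).
Proof. by move/vgeN; rewrite opprB. Qed.

Lemma vge_trans n x y z : vge n (x - y) -> vge n (y - z) -> vge n (x - z).
Proof. by move=> h1 h2; have := vgeD h1 h2; rewrite addrA subrK. Qed.

Lemma vgeM n n' x y : vge n x -> vge n' y -> vge (n + n') (x * y).
Proof.
case=> [->|hx]; first by rewrite mul0r; left.
case=> [->|hy]; first by rewrite mulr0; left.
have [->|x0] := eqVneq x 0; first by rewrite mul0r; left.
have [->|y0] := eqVneq y 0; first by rewrite mulr0; left.
by right; rewrite valM //; lia.
Qed.

Lemma vgeMl n x y : vge 0 x -> vge n y -> vge n (x * y).
Proof. by move=> hx hy; have := vgeM hx hy; rewrite add0r. Qed.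

Lemma vgeMr n x y : vge n x -> vge 0 y -> vge n (x * y).
Proof. by move=> hx hy; have := vgeM hx hy; rewrite addr0. Qed.

Lemma vge1 : vge 0 1. Proof. by right; rewrite val1. Qed.

Lemma vge_sum n (I : Type) (r : seq I) (P : pred I) (G : I -> K) :
  (forall i, P i -> vge n (G i)) -> vge n (\sum_(i <- r | P i) G i).
Proof. by move=> h; apply: big_ind => //; [exact: vge0 | exact: vgeD]. Qed.

Lemma vgeX n x k : vge n x -> vge (n * k%:Z) (x ^+ k).
Proof.
move=> hx; elim: k => [|k IH]; first by rewrite expr0 mulr0; exact: vge1.
by rewrite exprS; have := vgeM hx IH; apply: vge_le; lia.
Qed.

Lemma vge0X x k : vge 0 x -> vge 0 (x ^+ k).
Proof. by move/(vgeX k); rewrite mul0r. Qed.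

Lemma vge_nat k : vge 0 k%:R.
Proof.
elim: k => [|k IH]; first exact: vge0.
by rewrite -natr1; apply: vgeD => //; exact: vge1.
Qed.

Lemma vge_int (k : int) : vge 0 k%:~R.
Proof.
case: k => k; first exact: vge_nat.
by rewrite NegzE mulrNz; apply: vgeN; exact: vge_nat.
Qed.

Lemma vge_all0 x : (forall N : nat, vge N%:Z x) -> x = 0.
Proof.
move=> h; case: (h `|v x|.+1%N) => // h1; have := abszE (v x); lia.
Qed.

Lemma vgeP n x : x != 0 -> vge n x <-> n <= v x.
Proof. by move=> /eqP x0; split=> [[]//|]; right. Qed.

Lemma vmaxE x : vmax v x <-> vge 1 x.
Proof. by rewrite /vmax /vge /=; split=> -[|]; [left|right; lia|left|right; lia]. Qed.

Lemma vcloseE N x y : vclose v N x y <-> vge N%:Z (x - y).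
Proof.
split=> -[h|h]; [by rewrite h subrr; left|by right|left|by right].
by apply/eqP; rewrite -subr_eq0 h.
Qed.

Lemma nvge1 x : vge 0 x -> ~ vge 1 x -> x != 0 /\ v x = 0.
Proof.
move=> h0 h1; have x0 : x != 0 by apply/eqP => x0; apply: h1; left.
split=> //; case: h0 => [x0'|h0]; first by rewrite x0' eqxx in x0.
apply/eqP; rewrite eq_le h0 andbT leNgt; apply/negP => h.
by apply: h1; right; lia.
Qed.

Lemma vge1M x y : vge 0 x -> vge 0 y -> vge 1 (x * y) -> vge 1 x \/ vge 1 y.
Proof.
move=> hx hy hxy; apply: contrapT => /not_orP [nx ny].
have [x0 vx] := nvge1 hx nx; have [y0 vy] := nvge1 hy ny.
by move: hxy; rewrite vgeP ?mulf_neq0 // valM // vx vy.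
Qed.

Lemma vge1X x k : vge 0 x -> vge 1 (x ^+ k) -> vge 1 x.
Proof.
move=> hx; elim: k => [|k IH].
  by rewrite expr0 vgeP ?oner_neq0 // val1.
by rewrite exprS => /vge1M [//| |//|//]; exact: vge0X.
Qed.

Lemma vgeV x : vge 0 x -> ~ vge 1 x -> vge 0 x^-1.
Proof.
by move=> h0 h1; have [x0 vx] := nvge1 h0 h1; right; rewrite valV // vx.
Qed.

Lemma n1_vge1 : ~ vge 1 1.
Proof. by rewrite vgeP ?oner_neq0 // val1. Qed.

Lemma nvge1M x y : vge 0 x -> vge 0 y -> ~ vge 1 x -> ~ vge 1 y -> ~ vge 1 (x * y).
Proof. by move=> ? ? ? ? /vge1M []. Qed.

Lemma nvge1D x y : vge 1 y -> ~ vge 1 x -> ~ vge 1 (x + y).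
Proof. by move=> hy hx h; apply: hx; have := vgeB h hy; rewrite addrK. Qed.

Lemma vge_sub_expr n x y k : vge 0 x -> vge 0 y -> vge n (x - y) ->
  vge n (x ^+ k - y ^+ k).
Proof.
move=> hx hy h; rewrite subrXX; apply: vgeMr => //; apply: vge_sum => i _.
by apply: vgeMl; exact: vge0X.
Qed.

End Valuation.

(** The prime [p] divides the inner binomial coefficients, and [c i] is the quotient. The sum starts
    at [i = 0], where [c] is set to 0. *)
Lemma expD_prime_pow (R : comNzRingType) (p : nat) (hp : prime p) (x y : R) :
  exists c : nat -> nat, (x + y) ^+ p = x ^+ p + y ^+ p +
    p%:R * \sum_(i < p) (c i)%:R * x ^+ (p - i) * y ^+ i.
Proof.
exists (fun i => if i is 0 then 0%N else ('C(p, i) %/ p)%N).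
rewrite exprDn big_ord_recr /= subnn expr0 mul1r binn mulr1n.
case: p hp => // p hp; rewrite !big_ord_recl /= subn0 expr0 mulr1 bin0 mulr1n.
rewrite !mul0r add0r -!addrA; congr (_ + _); rewrite addrC; congr (_ + _).
rewrite mulr_sumr; apply: eq_bigr => i _; rewrite /bump leq0n add1n.
have d : (p.+1 %| 'C(p.+1, i.+1))%N.
  by apply: prime_dvd_bin => //; rewrite /= ltnS; exact: ltn_ord.
rewrite -[in LHS](divnK d) -mulr_natl natrM; ring.
Qed.

Section Complete.
Variables (K : fieldType) (v : K -> int) (hv : discrete_valuation v).

Lemma complete_limit (hc : vcomplete v) (u : nat -> K) :
  (forall n, vge v n%:Z (u n.+1 - u n)) ->
  exists l, forall n, vge v n%:Z (l - u n).
Proof.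
move=> hu; have huk n k : vge v n%:Z (u (n + k)%N - u n).
  elim: k => [|k IH]; first by rewrite addn0 subrr; left.
  apply: (vge_trans hv (y := u (n + k)%N)) => //.
  by rewrite addnS; apply: vge_le (hu _); lia.
have hum n m : (n <= m)%N -> vge v n%:Z (u m - u n).
  by move=> le; rewrite -(subnKC le).
have [|l hl] := hc u.
  move=> N; exists N => m n hm hn; apply/(vcloseE v).
  apply: (vge_trans hv (y := u N)); first exact: hum.
  by apply: vgeBC => //; exact: hum.
exists l => n; have [M hM] := hl n.
have /(vcloseE v)/(vgeBC hv) h := hM (M + n)%N (leq_addr _ _).
by apply: (vge_trans hv h); apply: hum; rewrite leq_addl.
Qed.

(** Finiteness of the residue field, expressed by a list that meets every residue class, so that the
    field itself need not be constructed. *)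
Definition finite_residue : Prop :=
  exists s : seq K, forall x, vge v 0 x ->
    exists2 y, y \in s & vge v 0 y /\ vge v 1 (x - y).

Variables (p : nat) (hp : prime p) (hvp : vge v 1 p%:R).

Lemma residue_exprB x y i : vge v 0 x -> vge v 0 y ->
  vge v 1 ((x - y) ^+ (p ^ i)%N - (x ^+ (p ^ i)%N - y ^+ (p ^ i)%N)).
Proof.
move=> hx hy; elim: i => [|i IH]; first by rewrite expn0 !expr1 subrr; left.
set a := x ^+ _ in IH; set b := y ^+ _ in IH.
have ha : vge v 0 a by exact: vge0X.
have hb : vge v 0 b by exact: vge0X.
rewrite expnSr !exprM -/a -/b.
apply: (vge_trans hv (y := (a - b) ^+ p)).
  by apply: vge_sub_expr => //; [apply: vge0X => //; exact: vgeB | exact: vgeB].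
have [c hc] := expD_prime_pow hp (a - b) b.
rewrite subrK in hc; rewrite hc.
have -> : forall A B E : K, A - (A + B + E - B) = - E by move=> *; ring.
apply: vgeN => //; apply: vgeMr => //; apply: vge_sum => // j _.
by rewrite -mulrA; apply: vgeMl => //; [exact: vge_nat|];
  apply: vgeMl => //; apply: vge0X => //; exact: vgeB.
Qed.

Lemma residue_expr_iter x d k : vge v 0 x -> vge v 1 (x ^+ d - x) ->
  vge v 1 (x ^+ (d ^ k)%N - x).
Proof.
move=> hx h; elim: k => [|k IH]; first by rewrite expn0 expr1 subrr; left.
apply: (vge_trans hv (y := x ^+ d)) => //.
by rewrite expnSr exprM; apply: vge_sub_expr => //; exact: vge0X.
Qed.

(** Pigeonhole: with n the length of the list, two of the powers x^(p^i), 0 <= i <= n, agree modulo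
    the maximal ideal. Frobenius is injective on the residue field, so x^(p^d) is congruent to x for
    some d with 1 <= d <= n. The factorial of n is a multiple of every such d and therefore works
    for all x at once. *)
Lemma residue_power : finite_residue ->
  exists s, (0 < s)%N /\ forall x, vge v 0 x -> vge v 1 (x ^+ (p ^ s)%N - x).
Proof.
move=> [r hr]; exists (size r)`!; split=> [|x hx]; first exact: fact_gt0.
suff [d /andP[d0 dr] hd] : exists2 d, (0 < d <= size r)%N & vge v 1 (x ^+ (p ^ d)%N - x).
  have /dvdnP[k ->] : (d %| (size r)`!)%N by apply: dvdn_fact; rewrite d0.
  by rewrite mulnC expnM; exact: residue_expr_iter.
pose G (i : 'I_(size r).+1) := x ^+ (p ^ i)%N.
have hG i : vge v 0 (G i) by exact: vge0X.
have /fin_all_exists[y hy] : forall i, exists y, y \in r /\ vge v 1 (G i - y).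
  by move=> i; have [y ? []] := hr _ (hG i); exists y.
pose k (i : 'I_(size r).+1) : 'I_(size r) :=
  Ordinal (etrans (index_mem (y i) r) (hy i).1).
have : ~ injective k.
  by move=> /leq_card; rewrite !card_ord ltnn.
move=> nk; have [i [j [ij eij]]] : exists i j : 'I_(size r).+1, (i < j)%N /\ k i = k j.
  apply: contrapT => h; apply: nk => i j eij; apply/val_inj.
  by case: (ltngtP i j) => // lt; case: h; [exists i, j|exists j, i].
have {}eij : y i = y j.
  have := congr1 (fun a => nth 0 r (val a)) eij.
  by rewrite /= !nth_index //; [exact: (hy j).1|exact: (hy i).1].
exists (j - i)%N; first by have := ltn_ord j; lia.
apply: (@vge1X _ _ hv _ (p ^ i)%N).
  by apply: vgeB => //; exact: vge0X.
rewrite -[X in vge _ _ X](subrK (x ^+ (p ^ (j - i))%N ^+ (p ^ i)%N - x ^+ (p ^ i)%N)).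
apply: vgeD => //; first by apply: residue_exprB => //; exact: vge0X.
rewrite -exprM -expnD subnK ?(ltnW ij) //.
by apply: (vge_trans hv (hy j).2); rewrite -eij; apply: vgeBC => //; exact: (hy i).2.
Qed.

End Complete.

Section Extension.
Variables (K : fieldType) (v : K -> int) (hv : discrete_valuation v).
Variables (L : fieldExtType K) (w : L -> int) (hw : discrete_valuation w).
Variables (e : nat) (e_gt0 : (0 < e)%N).
Hypothesis hvw : forall c : K, c != 0 -> w c%:A = e%:Z * v c.

Lemma scalar_neq0 (c : K) : c != 0 -> c%:A != 0 :> L.
Proof. by rewrite scaler_eq0 oner_eq0 orbF. Qed.

Lemma vge_scalar n (c : K) : vge v n c -> vge w (e%:Z * n) (c%:A).
Proof.
case=> [->|h]; first by rewrite scale0r; left.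
have [->|c0] := eqVneq c 0; first by rewrite scale0r; left.
by right; rewrite hvw //; nia.
Qed.

Lemma vge_scale n (c : K) x : vge v n c -> vge w 0 x -> vge w (e%:Z * n) (c *: x).
Proof.
move=> hc hx; rewrite -[x]mul1r scalerAl.
by apply: vgeMr => //; exact: vge_scalar.
Qed.

Lemma vge0_scale (c : K) x : vge v 0 c -> vge w 0 x -> vge w 0 (c *: x).
Proof. by move=> hc hx; have := vge_scale hc hx; rewrite mulr0. Qed.

(** Integral elements whose residues are linearly independent over the residue field of K. *)
Definition residue_free n (E : 'I_n -> L) :=
  (forall i, vge w 0 (E i)) /\
  forall c : 'I_n -> K, (forall i, vge v 0 (c i)) ->
    vge w 1 (\sum_i c i *: E i) -> forall i, vge v 1 (c i).

(** Divide by a coefficient of least valuation: if that valuation were less than [N], reduction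
    would give a nontrivial relation, having a coefficient 1, between the residues. *)
Lemma residue_free_coord n (E : 'I_n -> L) (N : int) (k : 'I_n -> K) :
  residue_free E -> vge w (e%:Z * N) (\sum_i k i *: E i) ->
  forall i, vge v N (k i).
Proof.
move=> [hE indE] hk i; apply: contrapT => nk.
have i_ok : k i != 0 by apply/eqP => ki; apply: nk; rewrite ki; left.
case: (arg_minP (P := fun i => k i != 0) (v \o k) i_ok) => j j0 jmin /=.
have vj : v (k j) < N.
  apply: le_lt_trans (jmin i i_ok) _ => /=; rewrite ltNge.
  by apply/negP => h; apply: nk; right.
have := indE (fun l => k l / k j) _ _ j.
rewrite divff //; move=> h; apply: (n1_vge1 hv); apply: h => [l|].
  have [->|l0] := eqVneq (k l) 0; first by rewrite mul0r; left.
  have := jmin l l0; rewrite /= => le.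
  by right; rewrite valM ?invr_neq0 // valV //; lia.
under eq_bigr do rewrite mulrC -scalerA.
rewrite -scaler_sumr -[\sum_i _]mul1r scalerAl.
have h1 : vge v (- v (k j)) (k j)^-1 by right; rewrite valV.
by apply: vge_le (vgeM hw (vge_scalar h1) hk); nia.
Qed.

(** The coefficients of a linear relation over K have valuation at least every N, so residual
    independence implies independence over K. *)
Lemma residue_free_bound n (E : 'I_n -> L) : residue_free E -> (n <= \dim {:L})%N.
Proof.
move=> hE; pose T := [tuple E i | i < n].
suff : free T by rewrite /free size_tuple => /eqP <-; apply: dimvS; exact: subvf.
apply/freeP => k hk i; apply: (@vge_all0 _ v) => N.
apply: (residue_free_coord hE) => //.
have -> : \sum_i k i *: E i = 0; last by left.
by rewrite -[RHS]hk; apply: eq_bigr => j _; rewrite (nth_mktuple E).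
Qed.

Lemma residue_basis : exists n (E : 'I_n -> L), residue_free E /\
  forall x, vge w 0 x -> exists2 c : 'I_n -> K, forall i, vge v 0 (c i)
    & vge w 1 (x - \sum_i c i *: E i).
Proof.
pose Q n := `[< exists E : 'I_n -> L, residue_free E >].
have exQ : exists n, Q n.
  by exists 0%N; apply/asboolP; exists (fun=> 0); split=> [[]|? _ _ []].
have bQ n : Q n -> (n <= \dim {:L})%N.
  by move=> /asboolP[E]; exact: residue_free_bound.
case: (ex_maxnP exQ bQ) => n /asboolP[E hE] nmax.
exists n, E; split=> // x hx; apply: contrapT => nx.
suff : Q n.+1 by move/nmax; rewrite ltnn.
apply/asboolP; exists (fun i => if unlift ord0 i is Some j then E j else x).
have [E0 Ei] := hE; split=> [i|c hc].
  by case: unliftP => [j|] _.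
rewrite big_ord_recl unlift_none.
under eq_bigr do rewrite liftK.
move=> hs; suff h0 : vge v 1 (c ord0).
  move=> i; case: (unliftP ord0 i) => [j|] ->//.
  apply: (Ei (fun j => c (lift ord0 j))) => //.
  have := vgeB hw hs (vge_le _ (vge_scale h0 hx)); rewrite addrAC subrr add0r.
  by apply; lia.
apply: contrapT => n0; apply: nx; have [c0 v0] := nvge1 (hc ord0) n0.
exists (fun j => - c (lift ord0 j) / c ord0) => [j|].
  by rewrite mulNr; apply: vgeN => //; apply: vgeMl => //; exact: vgeV.
have -> : x - \sum_i (- c (lift ord0 i) / c ord0) *: E i =
   (c ord0)^-1 *: (c ord0 *: x + \sum_i c (lift ord0 i) *: E i).
  rewrite scalerDr scalerA mulVf // scale1r scaler_sumr; congr (_ + _).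
  rewrite -sumrN; apply: eq_bigr => i _.
  by rewrite scalerA mulNr scaleNr opprK mulrC.
rewrite -[X in _ *: X]mul1r scalerAl; apply: vgeMl => //.
by have := vge_scalar (vgeV hv (hc ord0) n0); rewrite mulr0.
Qed.

Lemma finite_residue_ext : finite_residue v -> finite_residue w.
Proof.
move=> [s hs]; have [n [E [[hE _] span]]] := residue_basis.
exists [seq \sum_i s`_(c i) *: E i | c : {ffun 'I_n -> 'I_(size s)}] => x hx.
have [c hc hxc] := span x hx.
have /fin_all_exists[y hy] : forall i, exists y : 'I_(size s),
    vge v 0 s`_y /\ vge v 1 (c i - s`_y).
  move=> i; have [y ys hy] := hs _ (hc i).
  by exists (Ordinal (etrans (index_mem y s) ys)); rewrite /= nth_index.
exists (\sum_i s`_([ffun i => y i] i) *: E i).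
  by apply/mapP; exists [ffun i => y i]; rewrite ?mem_enum.
split.
  by apply: vge_sum => // i _; rewrite ffunE; apply: vge0_scale => //; case: (hy i).
apply: (vge_trans hw hxc); rewrite -sumrB; apply: vge_sum => // i _.
rewrite ffunE -scalerBl; apply: vge_le (vge_scale (hy i).2 (hE i)); lia.
Qed.

Section Generators.
Variables (I : finType) (E : I -> L) (hE : forall i, vge w 0 (E i)).
Hypothesis hgen : forall x, vge w 0 x ->
  exists2 c : I -> K, forall i, vge v 0 (c i) & vge w e%:Z (x - \sum_i c i *: E i).
Hypothesis hc : vcomplete v.

Let sum_limit (a : nat -> I -> K) : (forall k i, vge v k%:Z (a k i)) ->
  exists2 l : I -> K, forall i, vge v 0 (l i) & forall n,
    vge w (e%:Z * n%:Z) (\sum_i l i *: E i - \sum_(k < n) \sum_i a k i *: E i).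
Proof.
move=> ha; have /fin_all_exists[l hl] : forall i, exists l,
    forall n : nat, vge v n%:Z (l - \sum_(k < n) a k i).
  by move=> i; apply: complete_limit => // n; rewrite big_ord_recr /= addrAC subrr add0r.
exists l => [i|n]; first by have := hl i 0%N; rewrite big_ord0 subr0.
rewrite exchange_big /= -sumrB; apply: vge_sum => // i _.
by rewrite -scaler_suml -scalerBl; exact: vge_scale.
Qed.

(** Successive approximation: the error is divided by the uniformiser of K and expanded again;
    completeness of K sums the resulting coefficients. *)
Lemma generators_span x : vge w 0 x ->
  exists2 c : I -> K, forall i, vge v 0 (c i) & x = \sum_i c i *: E i.
Proof.
move=> hx; have [_ _ [pi pi0 vpi]] := hv.
have /choice[c hcc] : forall y : L, exists c : I -> K, vge w 0 y ->
    (forall i, vge v 0 (c i)) /\ vge w e%:Z (y - \sum_i c i *: E i).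
  move=> y; have [hy|ny] := EM (vge w 0 y); last by exists (fun=> 0).
  by have [c] := hgen hy; exists c.
pose step y := pi^-1 *: (y - \sum_i c y i *: E i).
have hstep y : vge w 0 y -> vge w 0 (step y).
  move=> /hcc[_ h]; rewrite /step -[X in _ *: X]mul1r scalerAl.
  have h1 : vge v (-1) pi^-1 by right; rewrite valV // vpi.
  by apply: vge_le (vgeM hw (vge_scalar h1) h); lia.
pose y k := iter k step x.
have hy k : vge w 0 (y k) by elim: k => //= k; exact: hstep.
have hpiX k : vge v k%:Z (pi ^+ k) by right; rewrite valX // vpi mul1r.
have ha k i : vge v k%:Z (pi ^+ k * c (y k) i).
  by apply: vgeMr => //; exact: (hcc _ (hy k)).1.
have [l hl0 hl] := sum_limit ha; exists l => //.
apply/eqP; rewrite -subr_eq0; apply/eqP; apply: (@vge_all0 _ w) => n.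
apply: (@vge_le _ w (e%:Z * n%:Z)); first by nia.
have -> : x = \sum_(k < n) \sum_i (pi ^+ k * c (y k) i) *: E i + pi ^+ n *: y n.
  elim: n => [|n IH]; first by rewrite big_ord0 add0r expr0 scale1r.
  rewrite {1}IH big_ord_recr /= -addrA; congr (_ + _).
  rewrite -/(y n) /step scalerA exprSr mulfK // scalerBr.
  rewrite scaler_sumr; under [in RHS]eq_bigr do rewrite -scalerA.
  by rewrite addrC subrK.
rewrite addrAC; apply: vgeD => //; first by apply: vgeBC => //; exact: hl.
exact: vge_scale.
Qed.

(** Along a fast subsequence the differences are pi^k times integral combinations of the generators,
    which reduces convergence to the coefficients in K. *)
Lemma generators_complete : vcomplete w.
Proof.
move=> u hu; have [_ _ [pi pi0 vpi]] := hv.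
have /choice[M hM] : forall N, exists M, forall m n, (M <= m)%N -> (M <= n)%N ->
    vge w (e%:Z * N%:Z) (u m - u n).
  move=> N; have [M hM] := hu (e * N)%N; exists M => m n hm hn.
  by have /(vcloseE w) := hM m n hm hn; rewrite PoszM.
(* A nondecreasing majorant of [M], so that consecutive terms of the subsequence are close. *)
pose mm N := (\sum_(k < N.+1) M k)%N.
have leM N : (M N <= mm N)%N by rewrite /mm big_ord_recr leq_addl.
have mmS N : (mm N <= mm N.+1)%N by rewrite /mm [X in (_ <= X)%N]big_ord_recr leq_addr.
have hpiX k : vge v k%:Z (pi ^+ k) by right; rewrite valX // vpi mul1r.
have hVX k : vge v (- k%:Z) (pi ^+ k)^-1.
  by right; rewrite valV ?expf_neq0 // valX // vpi mul1r.
have /choice[c hcc] : forall k, exists c : I -> K, (forall i, vge v 0 (c i)) /\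
    u (mm k.+1) - u (mm k) = pi ^+ k *: \sum_i c i *: E i.
  move=> k; have := hM k (mm k.+1) (mm k) (leq_trans (leM k) (mmS k)) (leM k).
  set z := _ - _ => hz; have [|c hc0 hcz] := @generators_span ((pi ^+ k)^-1 *: z).
    rewrite -[z]mul1r scalerAl; apply: vge_le (vgeM hw (vge_scalar (hVX k)) hz); lia.
  by exists c; split=> //; rewrite -hcz scalerA divff ?scale1r // expf_neq0.
have ha k i : vge v k%:Z (pi ^+ k * c k i).
  by apply: vgeMr => //; exact: (hcc k).1.
have [l hl0 hl] := sum_limit ha.
exists (u (mm 0%N) + \sum_i l i *: E i) => N; exists (mm N) => m hm.
apply/(vcloseE w)/(@vge_le _ w (e%:Z * N%:Z)); first by nia.
apply: (vge_trans hw (y := u (mm N))).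
  by apply: hM; [apply: leq_trans hm|].
apply: vgeBC => //; have := hl N.
have -> : \sum_(k < N) \sum_i (pi ^+ k * c k i) *: E i = u (mm N) - u (mm 0%N).
  elim: (N) => [|n IH]; first by rewrite big_ord0 subrr.
  rewrite big_ord_recr /= {}IH.
  under eq_bigr do rewrite -scalerA.
  by rewrite -scaler_sumr -(hcc n).2; ring.
by have -> : forall S a b : L, S - (b - a) = a + S - b by move=> *; ring.
Qed.

End Generators.

(** With [pi] a uniformiser of L, the products pi^j E_i for j < e generate the integers of L modulo
    the uniformiser of K: every digit of a pi-adic expansion is a combination of the residue
    basis. *)
Lemma extension_complete : vcomplete v -> vcomplete w.
Proof.
move=> hc; have [n [E [[hE _] span]]] := residue_basis.
have [_ _ [pi pi0 vpi]] := hw.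
have hpiX k : vge w k%:Z (pi ^+ k) by right; rewrite valX // vpi mul1r.
apply: (@generators_complete ('I_n * 'I_e)%type (fun ij => pi ^+ ij.2 * E ij.1)) => //.
  by move=> [i j] /=; apply: vgeMl => //; apply: vge_le (hpiX j).
move=> x hx.
suff [c hc0 hcx] : exists2 c : nat -> 'I_n -> K, forall k i, vge v 0 (c k i)
    & vge w e%:Z (x - \sum_(k < e) \sum_i c k i *: (pi ^+ k * E i)).
  exists (fun ij : 'I_n * 'I_e => c ij.2 ij.1) => //.
  by move: hcx; rewrite exchange_big pair_big.
suff : forall N, exists2 c : nat -> 'I_n -> K, forall k i, vge v 0 (c k i)
    & vge w N%:Z (x - \sum_(k < N) \sum_i c k i *: (pi ^+ k * E i)) by exact.
elim=> [|N [c hc0 hcN]].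
  by exists (fun _ _ => 0) => [? ?|]; [left|rewrite big_ord0 subr0].
have [|d hd hdx] := span ((pi ^+ N)^-1 *
    (x - \sum_(k < N) \sum_i c k i *: (pi ^+ k * E i))).
  have hV : vge w (- N%:Z) (pi ^+ N)^-1.
    by right; rewrite valV ?expf_neq0 // valX // vpi mul1r.
  by apply: vge_le (vgeM hw hV hcN); lia.
exists (fun k => if k == N then d else c k) => [k i|]; first by case: eqP.
rewrite big_ord_recr /= eqxx.
rewrite (eq_bigr (fun k : 'I_N => \sum_i c k i *: (pi ^+ k * E i))); last first.
  by move=> k _; rewrite (ltn_eqF (ltn_ord k)).
have := vgeM hw (hpiX N) hdx.
rewrite mulrBr mulrA mulfV ?expf_neq0 // mul1r [_ * \sum_i _]mulr_sumr.
rewrite [X in _ - X](eq_bigr _ (fun i _ => esym (scalerAr (d i) (pi ^+ N) (E i)))).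
by rewrite opprD addrA; apply: vge_le; lia.
Qed.

End Extension.

(** Bundled so that the Laurent series over such a field form a type with one parameter, on which
    ring structures can be declared. Completeness gives a meaning to the infinite sums in
    products. *)
Record cdvField := CDVField {
  cdv_sort :> fieldType;
  cdv_val : cdv_sort -> int;
  cdv_valP : discrete_valuation cdv_val;
  cdv_complete : vcomplete cdv_val }.

(** * Two-sided Laurent series *)

Section Bisums.
Variable V : cdvField.
Notation w := (@cdv_val V).
Let hw := @cdv_valP V.
Implicit Types (c : int -> V) (N : int) (r : seq int).

Definition win M T : seq int := [seq Negz i | i <- iota 0 M] ++ [seq Posz i | i <- iota 0 T].

Lemma win_uniq M T : uniq (win M T).
Proof.
rewrite cat_uniq !map_inj_uniq ?iota_uniq //= ?andbT => [|i j [] //|i j [] //].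
by apply/hasPn => _ /mapP[i _ ->]; apply/mapP => -[].
Qed.

Lemma mem_win M T i : (i \in win M T) = (- M%:Z <= i < T%:Z).
Proof.
rewrite mem_cat; case: i => i.
  rewrite mem_map ?mem_iota; last by move=> ? ? [].
  by case: mapP => [[] //|_] /=; lia.
rewrite mem_map ?mem_iota; last by move=> ? ? [].
by case: (X in _ || X) / mapP => [[] //|_]; rewrite NegzE /=; lia.
Qed.

Lemma bisum_part_win c M T : bisum_part c M T = \sum_(i <- win M T) c i.
Proof.
rewrite /bisum_part big_cat !big_map /=.
rewrite -(big_mkord xpredT (fun i => c (Negz i))) -(big_mkord xpredT (fun i => c (Posz i))).
by rewrite /index_iota !subn0.
Qed.

(** The common indices cancel, and each remaining one lies outside one of the two lists. *)
Lemma sum_approx N c r r' : uniq r -> uniq r' ->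
  (forall i, i \notin r -> vge w N (c i)) -> (forall i, i \notin r' -> vge w N (c i)) ->
  vge w N (\sum_(i <- r) c i - \sum_(i <- r') c i).
Proof.
move=> ur ur' hr hr'.
rewrite (bigID (mem r')) [X in _ - X](bigID (mem r)) /=.
have -> : \sum_(i <- r | i \in r') c i = \sum_(i <- r' | i \in r) c i.
  rewrite -big_filter -[RHS]big_filter; apply: perm_big.
  apply: uniq_perm; rewrite ?filter_uniq // => i.
  by rewrite !mem_filter andbC.
have -> : forall A B C : V, A + B - (A + C) = B - C by move=> *; ring.
by apply: vgeB => //; apply: vge_sum.
Qed.

Definition null c := forall N : nat, exists M : nat, forall i,
  M%:Z <= `|i| -> vge w N%:Z (c i).

Lemma null_win c (N : nat) : null c -> exists M : nat, forall M1 M2 i,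
  (M <= M1)%N -> (M <= M2)%N -> i \notin win M1 M2 -> vge w N%:Z (c i).
Proof.
move=> /(_ N)[M hM]; exists M => M1 M2 i h1 h2; rewrite mem_win => h.
by apply: hM; lia.
Qed.

Lemma null_bisum c : null c -> has_bisum w c (bisum w c).
Proof.
move=> hc; suff : bisummable w c by rewrite /bisum; case=> s hs; apply: (xgetPex 0); exists s.
have /choice[M hM] := fun N : nat => null_win N hc.
have [|s hs] := complete_limit hw (@cdv_complete V)
  (u := fun n => \sum_(i <- win (M n) (M n)) c i).
  move=> n; apply: sum_approx; rewrite ?win_uniq // => i.
    by move/(hM n.+1 _ _ _ (leqnn _) (leqnn _)); apply: vge_le; lia.
  exact: hM.
exists s => N; exists (M N) => M1 M2 h1 h2; apply/(vcloseE w).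
rewrite bisum_part_win; apply: (vge_trans hw (y := \sum_(i <- win (M N) (M N)) c i)).
  by apply: sum_approx; rewrite ?win_uniq // => i; exact: hM.
by apply: vgeBC.
Qed.

(** Arbitrary lists of indices are allowed, and not only windows, because the ring laws translate
    and reflect the index set. *)
Lemma bisum_approx c s (N : int) r : null c -> has_bisum w c s -> uniq r ->
  (forall i, vge w 0 (c i)) -> (forall i, i \notin r -> vge w N (c i)) ->
  vge w N (s - \sum_(i <- r) c i).
Proof.
move=> hc hs ur h0 hr.
have key (n : nat) : (forall i, i \notin r -> vge w n%:Z (c i)) ->
    vge w n%:Z (s - \sum_(i <- r) c i).
  move=> hn; have [M hM] := null_win n hc; have [M0 hM0] := hs n.
  have /(vcloseE w)/(vgeBC hw) := hM0 (maxn M M0) (maxn M M0) (leq_maxr _ _) (leq_maxr _ _).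
  rewrite bisum_part_win => h; apply: (vge_trans hw h).
  by apply: sum_approx; rewrite ?win_uniq // => i; apply: hM; rewrite leq_maxl.
case: N hr => n hr; first exact: key.
apply: (@vge_le _ w 0); first by rewrite NegzE; lia.
by apply: (key 0%N).
Qed.

End Bisums.

Record lau (V : cdvField) := Lau {
  lcoef :> int -> V;
  lcoefP : laurent (@cdv_val V) lcoef }.

Section LaurentRing.
Variable V : cdvField.
Notation w := (@cdv_val V).
Let hw := @cdv_valP V.
Implicit Types (a b c : lau V) (m i : int) (N : int).

(** Divisibility by the N-th power of the maximal ideal. The negation for [N = 1] means Gauss norm 1
    and characterises the units ([lau_unitE]). *)
Definition ediv N a := forall i, vge w N (a i).
(** Modulo the N-th power of the maximal ideal, the pole order is at most [M]. *)
Definition cut N a (M : nat) := forall i, i < - M%:Z -> vge w N (a i).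

Lemma lau_ext a b : (forall i, a i = b i) -> a = b.
Proof.
case: a b => [a ha] [b hb] /= /funext e; move: ha hb; rewrite e => ha hb.
by congr Lau; exact: Prop_irrelevance.
Qed.

Lemma lau0 a : ediv 0 a. Proof. by case: a => a []. Qed.

Lemma lau_cut a N : exists M, cut N a M.
Proof.
case: a => a [h0 h]; have [M hM] := h `|N|%N; exists M => i hi.
case: i hi => k hk; first by lia.
apply: (@vge_le _ w `|N|%N%:Z); first by lia.
have /hM/(vcloseE w) : (M <= k)%N by rewrite NegzE in hk; lia.
by rewrite subr0.
Qed.

Lemma cut_le N a M M' : (M <= M')%N -> cut N a M -> cut N a M'.
Proof. by move=> le h i hi; apply: h; lia. Qed.

Lemma lau_mk (f : int -> V) : (forall i, vge w 0 (f i)) ->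
  (forall N : nat, exists M : nat, forall i, i < - M%:Z -> vge w N%:Z (f i)) -> laurent w f.
Proof.
move=> h0 h; split=> [m|N]; first exact: h0.
have [M hM] := h N; exists M => i hi; apply/(vcloseE w); rewrite subr0.
by apply: hM; rewrite NegzE; lia.
Qed.

Lemma cutP2 a b N : exists M, cut N a M /\ cut N b M.
Proof.
have [M1 h1] := lau_cut a N; have [M2 h2] := lau_cut b N.
by exists (maxn M1 M2); split; [apply: cut_le h1|apply: cut_le h2];
  rewrite ?leq_maxl ?leq_maxr.
Qed.

Let term_ge a b m N M i : cut N a M -> cut N b M -> i < - M%:Z \/ m + M%:Z < i ->
  vge w N (a i * b (m - i)).
Proof.
move=> ha hb [h|h]; first by apply: vgeMr => //; [exact: ha|exact: lau0].
by apply: vgeMl => //; [exact: lau0|apply: hb; lia].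
Qed.

Lemma mul_null a b m : null (fun i => a i * b (m - i)).
Proof.
move=> N; have [M [ha hb]] := cutP2 a b N%:Z.
exists (M + `|m|).+1%N => i hi; apply: term_ge ha hb _; lia.
Qed.

Let mul_ge0 a b m i : vge w 0 (a i * b (m - i)).
Proof. by apply: vgeMl => //; exact: lau0. Qed.

Lemma lser_mul_approx a b m N r : uniq r ->
  (forall i, i \notin r -> vge w N (a i * b (m - i))) ->
  vge w N (lser_mul w a b m - \sum_(i <- r) a i * b (m - i)).
Proof.
move=> ur hr; apply: (@bisum_approx V (fun i => a i * b (m - i))) => //.
  exact: mul_null.
exact: (null_bisum (mul_null a b m)).
Qed.

Lemma lser_mul_ge a b m N : (forall i, vge w N (a i * b (m - i))) ->
  vge w N (lser_mul w a b m).
Proof.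
by move=> h; have := @lser_mul_approx a b m N [::] isT; rewrite big_nil subr0; apply.
Qed.

Fact lser_mul_laurent a b : laurent w (lser_mul w a b).
Proof.
apply: lau_mk => [m|N]; first by apply: lser_mul_ge.
have [M [ha hb]] := cutP2 a b N%:Z; exists (M + M)%N => m hm.
by apply: lser_mul_ge => i; apply: (term_ge ha hb); lia.
Qed.

Definition lau_mul a b := Lau (lser_mul_laurent a b).

Lemma lau_sep a b : (forall (N : nat) i, vge w N%:Z (a i - b i)) -> a = b.
Proof.
move=> h; apply: lau_ext => i; apply/eqP; rewrite -subr_eq0; apply/eqP.
by apply: (@vge_all0 _ w) => N.
Qed.

Fact lau_add_subproof a b : laurent w (fun i => a i + b i).
Proof.
apply: lau_mk => [i|N]; first by apply: vgeD => //; exact: lau0.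
have [M [ha hb]] := cutP2 a b N%:Z; exists M => i hi.
by apply: vgeD => //; [exact: ha|exact: hb].
Qed.
Definition lau_add a b := Lau (lau_add_subproof a b).

Fact lau_opp_subproof a : laurent w (fun i => - a i).
Proof.
apply: lau_mk => [i|N]; first by apply: vgeN => //; exact: lau0.
have [M ha] := lau_cut a N%:Z; exists M => i hi.
by apply: vgeN => //; exact: ha.
Qed.
Definition lau_opp a := Lau (lau_opp_subproof a).

(* To be total, [x * t ^ n] is replaced by 0 if [x] is not integral. *)
Definition mono_fun (x : V) (n : int) : int -> V :=
  fun i => if (i == n) && `[< vge w 0 x >] then x else 0.
Fact mono_subproof (x : V) (n : int) : laurent w (mono_fun x n).
Proof.
rewrite /mono_fun; apply: lau_mk => [i|N].
  by case: ifP => [/andP[_ /asboolP]|] // _; left.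
by exists `|n|%N => i hi; case: ifP => [/andP[/eqP ei _]|_]; [lia|left].
Qed.
Definition mono (x : V) (n : int) := Lau (mono_subproof x n).

Lemma monoE (x : V) (n i : int) : vge w 0 x -> mono x n i = if i == n then x else 0.
Proof. by move=> /asboolP h; rewrite /= /mono_fun h andbT. Qed.

Definition lau_zero := mono 0 0.
Definition lau_one := mono 1 0.

Fact lau_addA : associative lau_add.
Proof. by move=> a b c; apply: lau_ext => i; rewrite /= addrA. Qed.
Fact lau_addC : commutative lau_add.
Proof. by move=> a b; apply: lau_ext => i; rewrite /= addrC. Qed.
Fact lau_add0 : left_id lau_zero lau_add.
Proof.
by move=> a; apply: lau_ext => i; rewrite /= /mono_fun if_same add0r.
Qed.
Fact lau_addN : left_inverse lau_zero lau_opp lau_add.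
Proof.
by move=> a; apply: lau_ext => i; rewrite /= /mono_fun if_same addNr.
Qed.

HB.instance Definition _ := gen_eqMixin (lau V).
HB.instance Definition _ := gen_choiceMixin (lau V).
HB.instance Definition _ :=
  GRing.isZmodule.Build (lau V) lau_addA lau_addC lau_add0 lau_addN.

Fact lau_mulC : commutative lau_mul.
Proof.
move=> a b; apply: lau_sep => N m /=.
have [M [ha hb]] := cutP2 a b N%:Z.
pose r := win (M + `|m|) (M + `|m|).+1.
have ur : uniq r by exact: win_uniq.
have h1 : vge w N%:Z (lser_mul w a b m - \sum_(i <- r) a i * b (m - i)).
  by apply: lser_mul_approx => // i; rewrite mem_win => hi; apply: (term_ge ha hb); lia.
have inj : injective (fun i : int => m - i) by move=> i j; lia.
have h2 : vge w N%:Z (lser_mul w b a m - \sum_(i <- map (fun i => m - i) r) b i * a (m - i)).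
  apply: lser_mul_approx; first by rewrite map_inj_uniq.
  move=> i; rewrite {1}(_ : i = m - (m - i)); last by lia.
  by rewrite (mem_map inj r (m - i)) mem_win => hi; apply: (term_ge hb ha); lia.
apply: (vge_trans hw h1); apply: vgeBC => //; rewrite big_map in h2.
rewrite (eq_bigr (fun i => b (m - i) * a (m - (m - i)))) // => i _.
by rewrite mulrC; congr (_ * a _); lia.
Qed.

(** Modulo every power of the maximal ideal, both sides agree with the same finite double sum. *)
Fact lau_mulA : associative lau_mul.
Proof.
move=> a b c; apply: lau_sep => N m /=.
have [M1 [ha hb]] := cutP2 a b N%:Z; have [M2 hc] := lau_cut c N%:Z.
pose M := maxn M1 M2.
have {}ha : cut N%:Z a M by apply: cut_le ha; rewrite leq_maxl.
have {}hb : cut N%:Z b M by apply: cut_le hb; rewrite leq_maxl.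
have {}hc : cut N%:Z c M by apply: cut_le hc; rewrite leq_maxr.
(* Modulo the chosen power the factors have poles of order at most M and their products of order at
   most 2 M; the window contains all indices that can matter in degree m. *)
pose T := ((M + M) + (M + `|m|)).+1%N; pose r := win T T.
have ur : uniq r by exact: win_uniq.
have hr i : i \notin r -> i < - T%:Z \/ T%:Z <= i by rewrite mem_win; lia.
have hab k : k < - T%:Z -> vge w N%:Z (lser_mul w a b k).
  by move=> hk; apply: lser_mul_ge => i; apply: (term_ge ha hb); lia.
have hbc k : k < - (M + M)%N%:Z -> vge w N%:Z (lser_mul w b c k).
  by move=> hk; apply: lser_mul_ge => i; apply: (term_ge hb hc); lia.
have nn a' i : vge w 0 (lcoef a' i) by exact: lau0.
have nab k : vge w 0 (lser_mul w a b k) by exact: (lau0 (lau_mul a b)).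
have nbc k : vge w 0 (lser_mul w b c k) by exact: (lau0 (lau_mul b c)).
have h1 : vge w N%:Z (lser_mul w (lau_mul a b) c m -
    \sum_(k <- r) \sum_(i <- r) a i * b (k - i) * c (m - k)).
  apply: (vge_trans hw (y := \sum_(k <- r) lser_mul w a b k * c (m - k))).
    apply: (@lser_mul_approx (lau_mul a b)) => [//|k] /hr [hk|hk].
      by apply: vgeMr => //; exact: hab.
    by apply: vgeMl => //; apply: hc; lia.
  rewrite -sumrB; apply: vge_sum => // k _; rewrite -mulr_suml -mulrBl.
  have [hk|hk] := ltP (m - k) (- M%:Z).
    apply: vgeMl => //; last exact: hc.
    apply: vgeB => //.
    by apply: (vge_sum hw) => i _; apply: vgeMl.
  apply: vgeMr => //; apply: lser_mul_approx => // i /hr hi.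
  by apply: (term_ge ha hb); lia.
have h2 : vge w N%:Z (lser_mul w a (lau_mul b c) m -
    \sum_(i <- r) \sum_(k <- r) a i * b (k - i) * c (m - k)).
  apply: (vge_trans hw (y := \sum_(i <- r) a i * lser_mul w b c (m - i))).
    apply: (@lser_mul_approx _ (lau_mul b c)) => [//|i] /hr [hi|hi].
      by apply: vgeMr => //; apply: ha; lia.
    by apply: vgeMl => //; apply: hbc; lia.
  rewrite -sumrB; apply: vge_sum => // i _.
  under eq_bigr do rewrite -mulrA; rewrite -mulr_sumr -mulrBr.
  have [hi|hi] := ltP i (- M%:Z).
    apply: vgeMr => //; first exact: ha.
    apply: vgeB => //.
    by apply: (vge_sum hw) => k _; apply: vgeMl.
  apply: vgeMl => //; have inj : injective (fun k : int => k - i) by move=> j k; lia.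
  have := @lser_mul_approx b c (m - i) N%:Z (map (fun k => k - i) r).
  rewrite map_inj_uniq // big_map (eq_bigr (fun k => b (k - i) * c (m - k))); last first.
    by move=> k _; congr (_ * c _); lia.
  apply=> // j; rewrite {1}(_ : j = (j + i) - i); last by lia.
  by rewrite (mem_map inj r (j + i)) => /hr hj; apply: (term_ge hb hc); lia.
apply: (vge_trans hw h2); apply: vgeBC => //.
by rewrite exchange_big.
Qed.

End LaurentRing.

Section LaurentTheory.
Variable V : cdvField.
Notation w := (@cdv_val V).
Let hw := @cdv_valP V.
Implicit Types (a b c : lau V) (x : V) (N : int).

Lemma lser_mul_mono (x : V) n a m : vge w 0 x ->
  lser_mul w (mono x n) a m = x * a (m - n).
Proof.
move=> hx; apply/eqP; rewrite -subr_eq0; apply/eqP; apply: (@vge_all0 _ w) => N.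
have := @lser_mul_approx V (mono x n) a m N [:: n] isT.
rewrite big_seq1 monoE // eqxx; apply=> i; rewrite inE => /negPf ni.
by rewrite monoE // ni mul0r; left.
Qed.

Fact lau_mul1 : left_id (lau_one V) (@lau_mul V).
Proof.
move=> a; apply: lau_ext => m.
by rewrite [LHS]lser_mul_mono ?mul1r ?subr0 //; exact: vge1.
Qed.

Fact lau_mulDl : left_distributive (@lau_mul V) (@lau_add V).
Proof.
move=> a b c; apply: lau_sep => N m.
have [M1 h1] := mul_null a c m N; have [M2 h2] := mul_null b c m N.
pose r := win (maxn M1 M2) (maxn M1 M2).
have ur : uniq r by exact: win_uniq.
have hr i : i \notin r -> M1%:Z <= `|i| /\ M2%:Z <= `|i|.
  by rewrite mem_win; split; lia.
have e1 : vge w N%:Z (lser_mul w a c m - \sum_(i <- r) a i * c (m - i)).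
  by apply: lser_mul_approx => // i /hr[? ?]; exact: h1.
have e2 : vge w N%:Z (lser_mul w b c m - \sum_(i <- r) b i * c (m - i)).
  by apply: lser_mul_approx => // i /hr[? ?]; exact: h2.
have e3 : vge w N%:Z (lser_mul w (lau_add a b) c m
    - \sum_(i <- r) lau_add a b i * c (m - i)).
  apply: lser_mul_approx => // i /hr[? ?].
  by rewrite [lau_add a b i]/= mulrDl; apply: vgeD => //; [exact: h1|exact: h2].
have := vgeB hw e3 (vgeD hw e1 e2); rewrite [lau_add (lau_mul a c) _ _]/=.
have -> : \sum_(i <- r) lau_add a b i * c (m - i) =
   \sum_(i <- r) a i * c (m - i) + \sum_(i <- r) b i * c (m - i).
  by rewrite -big_split /=; apply: eq_bigr => i _; rewrite mulrDl.
have -> : forall A B C D E : V, A - (B + C) - (D - B + (E - C)) = A - (D + E).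
  by move=> *; ring.
exact.
Qed.

Fact lau_oner_neq0 : lau_one V != lau_zero V.
Proof.
apply/eqP => /(congr1 (fun a => lcoef a 0)); rewrite !monoE ?eqxx; [|left=> //|exact: vge1].
by move/eqP; rewrite oner_eq0.
Qed.

HB.instance Definition _ := GRing.Zmodule_isComNzRing.Build (lau V)
  (@lau_mulA V) (@lau_mulC V) lau_mul1 lau_mulDl lau_oner_neq0.

Lemma lauD a b i : (a + b) i = a i + b i. Proof. by []. Qed.
Lemma lauN a i : (- a) i = - a i. Proof. by []. Qed.
Lemma lauB a b i : (a - b) i = a i - b i. Proof. by []. Qed.
Lemma lauM a b : (a * b : lau V) = lser_mul w a b :> (int -> V). Proof. by []. Qed.
Lemma lau0E i : (0 : lau V) i = 0.
Proof. by rewrite [LHS]/= /mono_fun if_same. Qed.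
Lemma lau1E i : (1 : lau V) i = (i == 0)%:R.
Proof. by rewrite [LHS](@monoE V 1 0 i (vge1 hw)); case: (i == 0). Qed.

Lemma lau_sum (I : Type) (r : seq I) (P : pred I) (G : I -> lau V) i :
  (\sum_(k <- r | P k) G k) i = \sum_(k <- r | P k) G k i.
Proof. by elim/big_rec2: _ => [|k x b _ <-]; rewrite ?lau0E // lauD. Qed.

Lemma lauM_approx a b m N r : uniq r ->
  (forall i, i \notin r -> vge w N (a i * b (m - i))) ->
  vge w N ((a * b) m - \sum_(i <- r) a i * b (m - i)).
Proof. exact: lser_mul_approx. Qed.

Lemma lauM_ge a b m N : (forall i, vge w N (a i * b (m - i))) -> vge w N ((a * b) m).
Proof. exact: lser_mul_ge. Qed.

Lemma mono_mul (x : V) n a m : vge w 0 x -> (mono x n * a) m = x * a (m - n).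
Proof. exact: lser_mul_mono. Qed.

Lemma lau_eq (a b : lau V) : (forall N : nat, ediv N%:Z (a - b)) -> a = b.
Proof. by move=> h; apply: lau_sep => N i; exact: h. Qed.

Lemma ediv0 N : ediv N (0 : lau V). Proof. by move=> i; rewrite lau0E; left. Qed.
Lemma ediv_le N N' a : N' <= N -> ediv N a -> ediv N' a.
Proof. by move=> le h i; apply: vge_le (h i). Qed.
Lemma edivD N a b : ediv N a -> ediv N b -> ediv N (a + b).
Proof. by move=> ha hb i; apply: vgeD. Qed.
Lemma edivN N a : ediv N a -> ediv N (- a).
Proof. by move=> ha i; apply: vgeN. Qed.
Lemma edivB N a b : ediv N a -> ediv N b -> ediv N (a - b).
Proof. by move=> ha hb; apply: edivD => //; exact: edivN. Qed.
Lemma edivM N N' a b : ediv N a -> ediv N' b -> ediv (N + N') (a * b).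
Proof. by move=> ha hb m; apply: lauM_ge => i; apply: vgeM. Qed.
Lemma edivMl N a b : ediv N b -> ediv N (a * b).
Proof. by move=> hb; have := edivM (@lau0 V a) hb; rewrite add0r. Qed.
Lemma edivMr N a b : ediv N a -> ediv N (a * b).
Proof. by rewrite mulrC; exact: edivMl. Qed.
Lemma ediv_sum N (I : Type) (r : seq I) (P : pred I) (G : I -> lau V) :
  (forall k, P k -> ediv N (G k)) -> ediv N (\sum_(k <- r | P k) G k).
Proof. by move=> h; apply: big_ind => //; [exact: ediv0 | exact: edivD]. Qed.
Lemma edivX N a k : ediv N a -> ediv (N * k%:Z) (a ^+ k).
Proof.
move=> ha; elim: k => [|k IH]; first by rewrite mulr0; exact: lau0.
by rewrite exprS; apply: ediv_le (edivM ha IH); lia.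
Qed.
Lemma edivBC N a b : ediv N (a - b) -> ediv N (b - a).
Proof. by move/edivN; rewrite opprB. Qed.
Lemma ediv_trans N b a c : ediv N (a - b) -> ediv N (b - c) -> ediv N (a - c).
Proof. by move=> h1 h2; have := edivD h1 h2; rewrite addrA subrK. Qed.
Lemma edivBM N a b a' b' : ediv N (a - a') -> ediv N (b - b') ->
  ediv N (a * b - a' * b').
Proof.
move=> ha hb; have -> : a * b - a' * b' = a * (b - b') + (a - a') * b' by ring.
by apply: edivD; [exact: edivMl|exact: edivMr].
Qed.
Lemma edivBX N a b k : ediv N (a - b) -> ediv N (a ^+ k - b ^+ k).
Proof. by move=> h; rewrite subrXX; apply: edivMr. Qed.

Definition cst (x : V) : lau V := mono x 0.

Lemma cstM x a m : vge w 0 x -> (cst x * a) m = x * a m.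
Proof. by move=> hx; rewrite mono_mul // subr0. Qed.
Lemma cstE x i : vge w 0 x -> cst x i = if i == 0 then x else 0.
Proof. exact: monoE. Qed.
Lemma cst0 : cst 0 = 0. Proof. by []. Qed.
Lemma cst1 : cst 1 = 1. Proof. by []. Qed.
Lemma cstD (x y : V) : vge w 0 x -> vge w 0 y -> cst (x + y) = cst x + cst y.
Proof.
move=> hx hy; apply: lau_ext => i; rewrite lauD !cstE //; last exact: vgeD.
by case: eqP; rewrite ?addr0.
Qed.
Lemma cst_mul (x y : V) : vge w 0 x -> vge w 0 y -> cst (x * y) = cst x * cst y.
Proof.
move=> hx hy; apply: lau_ext => i; rewrite cstM // !cstE //; last exact: vgeMl.
by case: eqP; rewrite ?mulr0.
Qed.
Lemma cst_nat k : (k%:R : lau V) = cst k%:R.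
Proof.
elim: k => [|k IH]; first by rewrite cst0.
by rewrite -!natr1 IH cstD ?cst1 //; [exact: vge_nat|exact: vge1].
Qed.
Lemma ediv_cst N x : vge w N x -> ediv N (cst x).
Proof.
by move=> h i; rewrite /= /mono_fun; case: ifP => // _; left.
Qed.

Lemma ediv_divide (n : nat) x a : x != 0 -> w x = n%:Z -> ediv n%:Z a ->
  exists b, a = cst x * b.
Proof.
move=> x0 wx ha.
have hl : laurent w (fun i => x^-1 * a i).
  have hV : vge w (- n%:Z) x^-1 by right; rewrite valV // wx.
  apply: lau_mk => [i|N]; first by apply: vge_le (vgeM hw hV (ha i)); lia.
  have [M hM] := lau_cut a (N + n)%N%:Z; exists M => i hi.
  by apply: vge_le (vgeM hw hV (hM i hi)); lia.
exists (Lau hl); apply: lau_ext => i; rewrite cstM /=; last by right; rewrite wx.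
by rewrite mulrA divff // mul1r.
Qed.

Definition psr a := forall i, i < 0 -> a i = 0.

Lemma psr0 : psr 0. Proof. by move=> i _; rewrite lau0E. Qed.
Lemma psr_cst x : psr (cst x).
Proof. by move=> i hi; rewrite /= /mono_fun; case: eqP => //; lia. Qed.
Lemma psr1 : psr 1. Proof. exact: psr_cst. Qed.
Lemma psrD a b : psr a -> psr b -> psr (a + b).
Proof. by move=> ha hb i hi; rewrite lauD ha // hb // addr0. Qed.
Lemma psrN a : psr a -> psr (- a).
Proof. by move=> ha i hi; rewrite lauN ha // oppr0. Qed.
Lemma psrB a b : psr a -> psr b -> psr (a - b).
Proof. by move=> ha hb; apply: psrD => //; exact: psrN. Qed.
Lemma psr_coefM a b (n : nat) : psr a -> psr b ->
  (a * b) n%:Z = \sum_(i < n.+1) a i%:Z * b (n - i)%N%:Z.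
Proof.
move=> ha hb; apply/eqP; rewrite -subr_eq0; apply/eqP; apply: (@vge_all0 _ w) => N.
have -> : \sum_(i < n.+1) a i%:Z * b (n - i)%N%:Z =
    \sum_(i <- win 0 n.+1) a i * b (n%:Z - i).
  rewrite -(bisum_part_win (fun i => a i * b (n%:Z - i))) /bisum_part big_ord0 add0r.
  by apply: eq_bigr => i _; rewrite subzn // -ltnS.
apply: lauM_approx; first exact: win_uniq.
move=> i; rewrite mem_win => hi.
have [h|h] := ltP i 0; first by rewrite ha // mul0r; left.
by rewrite hb ?mulr0; [left|lia].
Qed.
Lemma psrM a b : psr a -> psr b -> psr (a * b).
Proof.
move=> ha hb m hm; apply: (@vge_all0 _ w) => N; apply: lauM_ge => i.
have [h|h] := ltP i 0; first by rewrite ha // mul0r; left.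
by rewrite hb ?mulr0; [left|lia].
Qed.
Lemma psrX a k : psr a -> psr (a ^+ k).
Proof. by move=> ha; elim: k => [|k IH]; [exact: psr1|rewrite exprS; exact: psrM]. Qed.
Lemma psr_sum (I : Type) (r : seq I) (P : pred I) (G : I -> lau V) :
  (forall k, P k -> psr (G k)) -> psr (\sum_(k <- r | P k) G k).
Proof. by move=> h; apply: big_ind => //; [exact: psr0 | exact: psrD]. Qed.
Lemma psr_coefM0 a b : psr a -> psr b -> (a * b) 0 = a 0 * b 0.
Proof. by move=> ha hb; rewrite (psr_coefM 0) // big_ord1. Qed.
Lemma psr_coefM1 a b : psr a -> psr b -> (a * b) 1 = a 0 * b 1 + a 1 * b 0.
Proof. by move=> ha hb; rewrite (psr_coefM 1) // big_ord_recr big_ord1. Qed.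
Lemma psr_coefX0 a k : psr a -> (a ^+ k) 0 = a 0 ^+ k.
Proof.
move=> ha; elim: k => [|k IH]; first by rewrite lau1E.
by rewrite !exprS psr_coefM0 ?IH //; exact: psrX.
Qed.
Lemma psr_coefX1 a k : psr a -> (a ^+ k) 1 = k%:R * a 0 ^+ k.-1 * a 1.
Proof.
move=> ha; elim: k => [|k IH]; first by rewrite lau1E !mul0r.
rewrite exprS psr_coefM1 ?psr_coefX0 ?IH //; last exact: psrX.
by case: k {IH} => [|k]; rewrite ?expr0 /= ?exprS -?natr1; ring.
Qed.
Lemma psr_mk (f : nat -> V) : (forall n, vge w 0 (f n)) ->
  exists2 a, psr a & forall n : nat, a n%:Z = f n.
Proof.
move=> hf; have h : laurent w (fun i => if i is Posz n then f n else 0).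
  apply: lau_mk => [[n|n]|N]; [exact: hf|by left|].
  by exists 0%N => -[n|n] hn; [lia|left].
by exists (Lau h) => // -[].
Qed.
Lemma psr_ext a b : psr a -> psr b -> (forall n : nat, a n%:Z = b n%:Z) -> a = b.
Proof.
move=> ha hb h; apply: lau_ext => -[n|n]; first exact: h.
by rewrite ha ?hb.
Qed.

Lemma psr_inv a : psr a -> ~ vge w 1 (a 0) -> exists2 b, psr b & a * b = 1.
Proof.
move=> ha na; have [a0 wa] := nvge1 (lau0 a 0) na.
have hV : vge w 0 (a 0)^-1 by apply: vgeV => //; exact: lau0.
(* A coefficient of the inverse depends on all earlier ones, so the recursion builds the list of the
   first [n] coefficients. *)
pose fix s n : seq V := if n is k.+1 then rcons (s k)
  ((k == 0%N)%:R / a 0 - (a 0)^-1 * \sum_(i < k) a (k - i)%N%:Z * (s k)`_i) else [::].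
have ss n : size (s n) = n by elim: n => //= n IH; rewrite size_rcons IH.
pose f n := (s n.+1)`_n.
have sf n (i : nat) : (i < n)%N -> (s n)`_i = f i.
  elim: n => // n IH; rewrite ltnS leq_eqVlt => /orP[/eqP-> //|lt].
  by rewrite /= nth_rcons ss lt IH.
have fE n : f n = (n == 0%N)%:R / a 0 - (a 0)^-1 * \sum_(i < n) a (n - i)%N%:Z * f i.
  rewrite {1}/f /= nth_rcons ss ltnn eqxx; congr (_ - _ * _).
  by apply: eq_bigr => i _; rewrite sf.
have hf n : vge w 0 (f n).
  have [k] := ubnP n; elim: k n => // k IH n; rewrite ltnS => le.
  rewrite fE; apply: vgeB => //; first by apply: vgeMl => //; exact: vge_nat.
  apply: vgeMl => //; apply: vge_sum => // i _; apply: vgeMl => //; first exact: lau0.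
  by apply: IH; apply: leq_trans le.
have [b hb be] := psr_mk hf; exists b => //; apply: psr_ext.
- exact: psrM.
- exact: psr1.
move=> n; rewrite psr_coefM // big_ord_recl subn0 be fE lau1E.
rewrite [X in _ + X](reindex_inj rev_ord_inj) /=.
rewrite [X in _ + X](eq_bigr (fun i : 'I_n => a (n - i)%N%:Z * f i)); last first.
  move=> i _; rewrite be /bump leq0n; congr (lcoef a _ * f _).
    by rewrite add1n subnSK.
  by have := ltn_ord i; lia.
by rewrite mulrBr mulrCA divff // mulr1 mulVKf // subrK.
Qed.

(** The geometric series converges coefficientwise. Its sum is again tame in negative degrees
    because it agrees with the partial sum [S N] modulo the N-th power of the maximal ideal. *)
Lemma ediv_geometric (y : lau V) : ediv 1 y -> exists b, (1 - y) * b = 1.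
Proof.
move=> hy; pose S n := \sum_(k < n) y ^+ k.
have hX k : ediv k%:Z (y ^+ k) by apply: ediv_le (edivX k hy); lia.
have /choice[l hl] : forall i, exists x, forall n : nat, vge w n%:Z (x - S n i).
  move=> i; apply: complete_limit => //; first exact: cdv_complete.
  by move=> n; rewrite /S big_ord_recr /= addrAC subrr add0r; exact: hX.
have h : laurent w l.
  apply: lau_mk => [i|N]; first by have := hl i 0%N; rewrite /S big_ord0 lau0E subr0.
  have [M hM] := lau_cut (S N) N%:Z; exists M => i hi.
  by have := vgeD hw (hl i N) (hM i hi); rewrite subrK.
exists (Lau h); apply: lau_eq => N.
apply: (@ediv_trans _ ((1 - y) * S N)).
  by rewrite -mulrBr; apply: edivMl => i; exact: hl.
have -> : (1 - y) * S N - 1 = - y ^+ N.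
  have -> : (1 - y) * S N - 1 = - ((y - 1) * S N) - 1 by ring.
  by rewrite -subrX1; ring.
exact: edivN.
Qed.

(** Shift the lowest coefficient that is a unit to degree 0. The part in nonnegative degrees is then
    an invertible power series, congruent to the shifted series modulo the maximal ideal, and a
    geometric series corrects the difference. *)
Lemma ediv1_inv a : ~ ediv 1 a -> exists b, b * a = 1.
Proof.
move=> na; have [M hM] := lau_cut a 1.
pose Q n := ~~ `[< vge w 1 (a (n%:Z - M%:Z)) >].
have exQ : exists n, Q n.
  apply: contrapT => nQ; apply: na => i.
  have [lt|le] := ltP i (- M%:Z); first exact: hM.
  apply: contrapT => ni; apply: nQ; exists `|(i + M%:Z)%R|%N; apply/asboolPn.
  by have -> : `|(i + M%:Z)%R|%N%:Z - M%:Z = i by lia.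
case: (ex_minnP exQ) => n /asboolPn; set n0 := _ - _ => nn minn.
have low i : i < n0 -> vge w 1 (a i).
  move=> lt; have [lt'|le] := ltP i (- M%:Z); first exact: hM.
  apply: contrapT => ni; have := minn `|(i + M%:Z)%R|%N.
  rewrite /Q; have -> : `|(i + M%:Z)%R|%N%:Z - M%:Z = i by lia.
  by move/asboolPn: ni => -> /(_ isT); rewrite /n0 in lt; lia.
pose a' := mono 1 (- n0) * a.
have a'E i : a' i = a (i + n0) by rewrite mono_mul ?mul1r ?opprK //; exact: vge1.
have [g hg ge] := psr_mk (fun n => lau0 a' n%:Z).
have [|h hh ghE] := @psr_inv g hg; first by rewrite (ge 0%N) a'E add0r.
have hy : ediv 1 (1 - a' * h).
  rewrite -ghE -mulrBl; apply: edivMr => i; rewrite lauB.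
  case: i => i; first by rewrite ge subrr; left.
  by rewrite hg // sub0r; apply: vgeN => //; rewrite a'E; apply: low; lia.
have [b] := ediv_geometric hy; have -> : 1 - (1 - a' * h) = a' * h by ring.
by move=> e; exists (b * h * mono 1 (- n0)); rewrite -[RHS]e /a'; ring.
Qed.

Lemma ediv1_unit a b : a * b = 1 -> ~ ediv 1 a.
Proof.
move=> ab ha; apply: (n1_vge1 hw).
by have := edivMr b ha; rewrite ab => /(_ 0); rewrite lau1E.
Qed.

(** A coefficient of least valuation, the content of the series, can be factored out. *)
Lemma lau_factor a : a != 0 -> exists x n b,
  [/\ x != 0, w x = Posz n, a = cst x * b & ~ ediv 1 b].
Proof.
move=> a0; have [i ai] : exists i, a i != 0.
  apply: contrapT => h; case/eqP: a0; apply: lau_ext => i; rewrite lau0E.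
  by apply: contrapT => /eqP ai; apply: h; exists i.
pose Q n := `[< exists2 j, a j != 0 & w (a j) = Posz n >].
have pos j : a j != 0 -> 0 <= w (a j) by move/vgeP <-; exact: lau0.
have exQ : exists n, Q n.
  by exists `|w (a i)|%N; apply/asboolP; exists i => //; rewrite gez0_abs // pos.
case: (ex_minnP exQ) => n /asboolP[j aj wj] minn.
have hd : ediv n%:Z a.
  move=> k; have [->|ak] := eqVneq (a k) 0; first by left.
  right; have := minn `|w (a k)|%N; have := pos k ak => pk.
  suff : Q `|w (a k)|%N by move=> -> /(_ isT); lia.
  by apply/asboolP; exists k => //; rewrite gez0_abs.
have [b ab] := ediv_divide aj wj hd; exists (a j), n, b; split=> //.
move=> /(_ j) h; have hx : vge w 0 (a j) by exact: lau0.
have e : a j * 1 = a j * b j by rewrite -cstM // -ab mulr1.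
by move/(mulfI aj): e h => <-; exact: n1_vge1.
Qed.

Lemma cst_mul_eq0 x a : x != 0 -> vge w 0 x -> cst x * a = 0 -> a = 0.
Proof.
move=> x0 hx h; apply: lau_ext => i; rewrite lau0E.
by have := congr1 (fun a => lcoef a i) h; rewrite cstM // lau0E => /eqP;
  rewrite mulf_eq0 (negPf x0) => /eqP.
Qed.

Definition lau_unit : pred (lau V) := fun a => `[< exists b, b * a = 1 >].
Definition lau_inv a : lau V := xget a [set b | b * a = 1].

Fact lau_mulVr : {in lau_unit, left_inverse 1 lau_inv *%R}.
Proof. by move=> a /asboolP[b hb]; apply: (xgetPex a (P := [set b | b * a = 1])); exists b. Qed.
Fact lau_unitPl a b : b * a = 1 -> lau_unit a.
Proof. by move=> h; apply/asboolP; exists b. Qed.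
Fact lau_inv_out : {in [predC lau_unit], lau_inv =1 id}.
Proof.
by move=> a /asboolPn h; apply: xgetPN => b hb; apply: h; exists b.
Qed.

HB.instance Definition _ :=
  GRing.ComNzRing_hasMulInverse.Build (lau V) lau_mulVr lau_unitPl lau_inv_out.

Fact lau_mul_eq0 a b : a * b = 0 -> (a == 0) || (b == 0).
Proof.
move=> ab; have [//|a0] := eqVneq a 0; apply/eqP.
have [x [n [u [x0 wx e hu]]]] := lau_factor a0.
have [u' u'u] := ediv1_inv hu.
have hx : vge w 0 x by right; rewrite wx.
move: ab; rewrite e -mulrA => /(cst_mul_eq0 x0 hx) ub.
by rewrite -[b]mul1r -u'u -mulrA ub mulr0.
Qed.

HB.instance Definition _ :=
  GRing.ComUnitRing_isIntegral.Build (lau V) lau_mul_eq0.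

Lemma lau_unitE a : (a \is a GRing.unit) <-> ~ ediv 1 a.
Proof.
split=> [ua|/ediv1_inv[b ba]]; first exact: (ediv1_unit (divrr ua)).
by apply/unitrP; exists b; split=> //; rewrite mulrC.
Qed.

Lemma ediv1M a b : ediv 1 (a * b) -> ediv 1 a \/ ediv 1 b.
Proof.
move=> h; apply: contrapT => /not_orP [/lau_unitE ua /lau_unitE ub].
by apply: (lau_unitE (a * b)).1 h; rewrite unitrM ua ub.
Qed.

(** Compare the contents. This is what makes the pullback of the Gauss valuation to F a valuation
    ring. *)
Lemma lau_div_total a b : (exists c, a = c * b) \/ (exists c, b = c * a).
Proof.
have [->|a0] := eqVneq a 0; first by left; exists 0; rewrite mul0r.
have [->|b0] := eqVneq b 0; first by right; exists 0; rewrite mul0r.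
have [x [n [u [x0 wx ae /lau_unitE hu]]]] := lau_factor a0.
have [y [k [u' [y0 wy be /lau_unitE hu']]]] := lau_factor b0.
have key (x1 y1 : V) (n1 k1 : nat) (u1 u1' : lau V) : y1 != 0 -> x1 != 0 ->
    w x1 = n1%:Z -> w y1 = k1%:Z ->
    (k1 <= n1)%N -> u1' \is a GRing.unit ->
    exists c, cst x1 * u1 = c * (cst y1 * u1').
  move=> y10 x10 wx1 wy1 le uu; exists (cst (x1 / y1) * u1 / u1').
  have h1 : vge w 0 y1 by right; rewrite wy1.
  have h2 : vge w 0 (x1 / y1).
    by right; rewrite valM ?invr_neq0 // valV // wx1 wy1; lia.
  by rewrite mulrCA divrK // mulrA -cst_mul // mulrCA divff // mulr1.
rewrite ae be; case/orP: (leq_total k n) => le; [left|right].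
  apply: (key _ _ _ _ _ _ y0 x0 wx wy le hu').
by apply: (key _ _ _ _ _ _ x0 y0 wy wx le hu).
Qed.

End LaurentTheory.

Section Derivation.
Variable V : cdvField.
Notation w := (@cdv_val V).
Let hw := @cdv_valP V.
Implicit Types (a b : lau V) (N : int).

Fact der_subproof a : laurent w (lser_deriv a).
Proof.
rewrite /lser_deriv; apply: lau_mk => [i|N].
  by apply: vgeMl => //; [exact: vge_int|exact: lau0].
have [M hM] := lau_cut a N%:Z; exists M.+1 => i hi.
by apply: vgeMl => //; [exact: vge_int|apply: hM; lia].
Qed.
Definition der a := Lau (der_subproof a).

Lemma derE a i : der a i = (i + 1)%:~R * a (i + 1). Proof. by []. Qed.

Lemma derD a b : der (a + b) = der a + der b.
Proof. by apply: lau_ext => i; rewrite derE !lauD !derE mulrDr. Qed.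
Lemma der0 : der 0 = 0.
Proof. by apply: lau_ext => i; rewrite derE !lau0E mulr0. Qed.

Lemma der_cst x : der (cst x) = 0.
Proof.
apply: lau_ext => i; rewrite derE lau0E /= /mono_fun.
by case: eqP => [->|_]; rewrite ?mul0r ?mulr0.
Qed.

(** Modulo each power of the maximal ideal the products are finite sums over windows, one of them
    translated by 1; termwise the identity is i + (m + 1 - i) = m + 1. *)
Lemma derM a b : der (a * b) = der a * b + a * der b.
Proof.
apply: lau_eq => N m; rewrite lauB lauD derE.
have [M hM] := mul_null a b (m + 1) N.
pose r := win M M; have ur : uniq r by exact: win_uniq.
have hr i : i \notin r -> vge w N%:Z (a i * b (m + 1 - i)).
  by rewrite mem_win => hi; apply: hM; lia.
have e1 := lauM_approx ur hr.
have e2 : vge w N%:Z ((a * der b) m - \sum_(i <- r) a i * der b (m - i)).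
  apply: lauM_approx => // i hi; rewrite derE mulrCA.
  apply: vgeMl => //; first exact: vge_int.
  by rewrite (_ : m - i + 1 = m + 1 - i); [exact: hr|lia].
have inj : injective (fun i : int => i - 1) by move=> i j; lia.
have e3 : vge w N%:Z ((der a * b) m -
    \sum_(i <- map (fun i => i - 1) r) der a i * b (m - i)).
  apply: lauM_approx; first by rewrite map_inj_uniq.
  move=> i; rewrite {1}(_ : i = (i + 1) - 1); last by lia.
  rewrite (mem_map inj r (i + 1)) => hi; rewrite derE -mulrA.
  apply: vgeMl => //; first exact: vge_int.
  by rewrite (_ : m - i = m + 1 - (i + 1)); [exact: hr|lia].
rewrite big_map in e3.
have := vgeB hw (vgeMl hw (vge_int hw (m + 1)) e1) (vgeD hw e3 e2).
set X := \sum_(i <- r) _; set Y := \sum_(i <- r) _; set Z := \sum_(i <- r) _.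
have -> : forall A B C D : V, A * (B - X) - (C - Y + (D - Z)) =
    A * B - (C + D) + (Y + Z - A * X) by move=> *; ring.
have -> : Y + Z = (m + 1)%:~R * X; last by rewrite subrr addr0.
rewrite /Y /Z /X -big_split mulr_sumr; apply: eq_bigr => i _ /=.
rewrite /lser_deriv (_ : m - (i - 1) = m + 1 - i); last by lia.
rewrite (_ : i - 1 + 1 = i); last by lia.
rewrite (_ : m - i + 1 = m + 1 - i); last by lia.
rewrite (_ : (m + 1)%:~R = i%:~R + (m + 1 - i)%:~R :> V); first by ring.
by rewrite -intrD; congr (_%:~R); lia.
Qed.

Lemma derX a n : der (a ^+ n) = n%:R * a ^+ n.-1 * der a.
Proof.
elim: n => [|n IH]; first by rewrite -cst1 der_cst mul0r mul0r.
rewrite exprS derM IH; case: n {IH} => [|n] /=; first by rewrite expr0; ring.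
by rewrite exprS -!natr1; ring.
Qed.

Lemma psr_der a : psr a -> psr (der a).
Proof.
move=> ha i hi; rewrite derE; have [->|h] := eqVneq i (- 1); first by rewrite mul0r.
by rewrite ha ?mulr0 //; lia.
Qed.

End Derivation.

(** * Growth of poles modulo powers of the maximal ideal *)

Section Weights.
Variable V : cdvField.
Notation w := (@cdv_val V).
Let hw := @cdv_valP V.
Variables (M N : nat) (M_gt0 : (0 < M)%N).
Implicit Types (a b : lau V).

(* Modulo the N-th power of the maximal ideal, the valuation of the coefficient
   of t ^ i is at least (c - i) / M. *)
Definition wt (c : int) a := forall i k : int,
  k <= N%:Z -> M%:Z * (k - 1) < c - i -> vge w k (a i).

Lemma wt_coef c a i : wt c a -> [\/ a i = 0, N%:Z <= w (a i) | c - i <= M%:Z * w (a i)].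
Proof.
move=> h; have [a0|a0] := eqVneq (a i) 0; first by constructor 1.
have [h1|h1] := leP N%:Z (w (a i)); first by constructor 2.
have [h2|h2] := leP (c - i) (M%:Z * w (a i)); first by constructor 3.
have : vge w (w (a i) + 1) (a i).
  by move: (w (a i)) h1 h2 => z h1 h2; apply: h; [lia|rewrite addrK].
by rewrite vgeP // gerDl.
Qed.

Lemma wt_le c c' a : c' <= c -> wt c a -> wt c' a.
Proof. by move=> le h i k hk hi; apply: h => //; lia. Qed.

Lemma wtD c a b : wt c a -> wt c b -> wt c (a + b).
Proof. by move=> ha hb i k hk hi; apply: vgeD => //; [exact: ha|exact: hb]. Qed.

Lemma wtN c a : wt c a -> wt c (- a).
Proof. by move=> ha i k hk hi; apply: vgeN => //; exact: ha. Qed.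

Lemma wtB c a b : wt c a -> wt c b -> wt c (a - b).
Proof. by move=> ha hb; apply: wtD => //; exact: wtN. Qed.

Lemma wtM c c' a b : wt c a -> wt c' b -> wt (c + c') (a * b).
Proof.
move=> ha hb m k hk hm; apply: lauM_ge => i.
have [->|a0] := eqVneq (a i) 0; first by rewrite mul0r; left.
have [->|b0] := eqVneq (b (m - i)) 0; first by rewrite mulr0; left.
have /(vgeP _ _ a0) pa := lau0 a i; have /(vgeP _ _ b0) pb := lau0 b (m - i).
right; rewrite valM //.
have := wt_coef i ha; have := wt_coef (m - i) hb.
move: (w (a i)) (w (b (m - i))) pa pb => x y pa pb.
case=> [/eqP|h2|h2]; [by rewrite (negPf b0)|by lia|].
case=> [/eqP|h1|h1]; [by rewrite (negPf a0)|by lia|nia].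
Qed.

Lemma ediv_wt c a : ediv N%:Z a -> wt c a.
Proof. by move=> h i k hk _; apply: vge_le (h i). Qed.

Lemma wt0_coef a : (forall i, i < 0 -> a i = 0) -> wt 0 a.
Proof.
move=> h i k hk hi; have [lt|le] := ltP i 0; first by rewrite h //; left.
by apply: vge_le (lau0 a i); nia.
Qed.

Lemma psr_wt a : psr a -> wt 0 a. Proof. exact: wt0_coef. Qed.

Lemma psr_wt1 a : psr a -> a 0 = 0 -> wt 1 a.
Proof.
move=> h h0 i k hk hi; have [lt|le] := ltP i 1; last first.
  by apply: vge_le (lau0 a i); nia.
have [->|i0] := eqVneq i 0; first by rewrite h0; left.
by rewrite h; [left|lia].
Qed.

Lemma wtX c a n : wt c a -> wt (c * n%:Z) (a ^+ n).
Proof.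
move=> ha; elim: n => [|n IH]; first by rewrite mulr0; apply: psr_wt; exact: psr1.
by rewrite exprS; apply: wt_le (wtM ha IH); lia.
Qed.

Lemma wt_sum c (I : Type) (r : seq I) (P : pred I) (G : I -> lau V) :
  (forall k, P k -> wt c (G k)) -> wt c (\sum_(k <- r | P k) G k).
Proof.
by move=> h; apply: big_ind => //; [apply: ediv_wt; exact: ediv0 | exact: wtD].
Qed.

Lemma wt_der c a : wt c a -> wt (c - 1) (der a).
Proof.
move=> h i k hk hi; rewrite derE; apply: vgeMl => //; first exact: vge_int.
by apply: h => //; lia.
Qed.

(** From degree -m on, the required valuation (1 - i) / M is at most 1 because m < M; below that
    degree the coefficients vanish modulo the N-th power. *)
Lemma ediv1_wt a m : cut N%:Z a m -> (m < M)%N -> ediv 1 a -> wt 1 a.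
Proof.
move=> hc lt h i k hk hi; have [l|l] := ltP i (- m%:Z).
  by apply: vge_le (hc i l).
by apply: vge_le (h i); nia.
Qed.

(** Let [h] be the inverse of [b] and write a h = 1 - y. Then a^-1 = h S + a^-1 y^N with S the
    truncated geometric series in y; the last term is divisible by the N-th power of the maximal
    ideal, and the other factors have weight 0. *)
Lemma wt_inv a b : psr b -> ~ vge w 1 (b 0) -> ediv 1 (a - b) -> wt 0 a ->
  wt 0 a^-1.
Proof.
move=> hb nb hab ha; have [h hh bh] := psr_inv hb nb.
have ua : a \is a GRing.unit.
  by apply/lau_unitE => /(edivB hab) h1; apply: nb; move: (h1 0);
    rewrite !lauB addrAC subrr sub0r => /(vgeN hw); rewrite opprK.
pose y := (b - a) * h.
have y1 : ediv 1 y by apply: edivMr; exact: edivBC.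
have wy : wt 0 y.
  rewrite -[0 : int]addr0; apply: wtM; last exact: psr_wt.
  by apply: wtB => //; exact: psr_wt.
have ah : a * h = 1 - y by rewrite /y mulrBl bh; ring.
pose S := \sum_(k < N) y ^+ k.
have aS : a * (h * S) = 1 - y ^+ N.
  have eS : (1 - y) * S = - ((y - 1) * S) by ring.
  by rewrite mulrA ah eS -subrX1 opprB.
have -> : a^-1 = h * S + a^-1 * y ^+ N.
  by apply: (mulrI ua); rewrite mulrDr aS mulrA !divrr // mul1r subrK.
apply: wtD; last first.
  by apply/ediv_wt/edivMl/(ediv_le _ (edivX N y1)); lia.
rewrite -[0 : int]addr0; apply: wtM; first exact: psr_wt.
by apply: wt_sum => k _; have := wtX (n := k) wy; rewrite mul0r.
Qed.

End Weights.

(** * Congruences between p-power iterates *)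

Section Frobenius.
Variable V : cdvField.
Notation w := (@cdv_val V).
Let hw := @cdv_valP V.
Variables (p : nat) (hp : prime p) (hwp : vge w 1 p%:R).
Implicit Types (a b : lau V).

Lemma ediv_p : ediv 1 (p%:R : lau V).
Proof. by rewrite cst_nat; exact: ediv_cst. Qed.

(** The congruence gains one power: (a - b)^p since p >= 2, and the mixed terms through the factor
    p. *)
Lemma ediv_expr_p (n : nat) a b : ediv n.+1%:Z (a - b) ->
  ediv n.+2%:Z (a ^+ p - b ^+ p).
Proof.
move=> h; have [c hc] := expD_prime_pow hp b (a - b).
have [d hd] := expD_prime_pow hp (a - b) b.
rewrite subrK in hd; rewrite hd.
set S := \sum_(i < p) _; have -> : forall A B C : lau V, A + B + C - B = A + C.
  by move=> *; ring.
apply: edivD.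
  by apply: ediv_le (edivX p h); have := prime_gt1 hp; nia.
suff hS : ediv n.+1%:Z S by apply: ediv_le (edivM ediv_p hS); lia.
apply: ediv_sum => i _; apply: edivMr; apply: edivMl.
have -> : (p - i = (p - i).-1.+1)%N by have := ltn_ord i; lia.
by rewrite exprS; exact: edivMr.
Qed.

Lemma ediv_expr_p_pow n a b : ediv 1 (a - b) ->
  ediv n.+1%:Z (a ^+ (p ^ n)%N - b ^+ (p ^ n)%N).
Proof.
move=> h; elim: n => [|n IH]; first by rewrite expn0 !expr1.
by rewrite expnSr !exprM; exact: ediv_expr_p.
Qed.

Lemma ediv_exprD_p n a b :
  ediv 1 ((a + b) ^+ (p ^ n)%N - (a ^+ (p ^ n)%N + b ^+ (p ^ n)%N)).
Proof.
elim: n => [|n IH]; first by rewrite expn0 !expr1 subrr; exact: ediv0.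
rewrite expnSr !exprM.
apply: (@ediv_trans _ _ ((a ^+ (p ^ n)%N + b ^+ (p ^ n)%N) ^+ p)); first exact: edivBX.
have [c ->] := expD_prime_pow hp (a ^+ (p ^ n)%N) (b ^+ (p ^ n)%N).
by rewrite addrAC subrr add0r; apply: edivMr; exact: ediv_p.
Qed.

End Frobenius.

(** * Principal parts of differential forms *)

Section Span.
Variable G : zmodType.
Implicit Types (S T : set G) (x y : G).

(** An intersection of additive monoids, so that membership is itself an induction principle. *)
Definition addspan S : set G := [set x | forall T, T 0 -> S `<=` T ->
  (forall y z, T y -> T z -> T (y + z)) -> T x].

Lemma addspan0 S : addspan S 0. Proof. by move=> T. Qed.
Lemma addspan_gen S x : S x -> addspan S x. Proof. by move=> h T _ /(_ _ h). Qed.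
Lemma addspanD S x y : addspan S x -> addspan S y -> addspan S (x + y).
Proof. by move=> hx hy T T0 ST TD; apply: (TD); [exact: hx|exact: hy]. Qed.
Lemma addspan_sub S T x : S `<=` addspan T -> addspan S x -> addspan T x.
Proof. by move=> h; apply; [exact: addspan0|exact: h|exact: addspanD]. Qed.
Lemma addspanMn S x n : addspan S x -> addspan S (x *+ n).
Proof.
by move=> h; elim: n => [|n IH]; [exact: addspan0|rewrite mulrS; exact: addspanD].
Qed.
End Span.

Lemma addspanM (R : pzRingType) (S T : set R) x :
  (forall s, S s -> addspan T (x * s)) -> forall y, addspan S y -> addspan T (x * y).
Proof.
move=> h y hy; apply: (hy [set y | addspan T (x * y)]) => [|//|a b ha hb] /=.
  by rewrite mulr0; exact: addspan0.
by rewrite mulrDr; exact: addspanD.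
Qed.

(** * Principal parts along an abstract Frobenius lift [f] of the expansion [Y] *)

Section Estimate.
Variable V : cdvField.
Notation w := (@cdv_val V).
Let hw := @cdv_valP V.
Hypothesis char0 : forall n : nat, (0 < n)%N -> n%:R != 0 :> V.
Variables (p : nat) (hp : prime p) (hwp : vge w 1 p%:R).
Variables (F : fieldType) (P : set F) (hP : is_subring P).
Variables (f Y : F -> lau V) (q' : nat) (q'_gt0 : (0 < q')%N).
Hypothesis fD : forall a b, P a -> P b -> f (a + b) = f a + f b.
Hypothesis fM : forall a b, P a -> P b -> f (a * b) = f a * f b.
Hypothesis f1 : f 1 = 1.
Hypothesis psrY : forall b, P b -> psr (Y b).
Hypothesis fY : forall b, P b -> ediv 1 (f b - Y b ^+ q').
Variables (pF tau : F) (P_pF : P pF) (P_tau : P tau).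
Variables (c0 : V) (hc0 : vge w 1 c0).
Hypothesis f_pF : f pF = cst c0.
Hypothesis Y_tau : vge w 1 (Y tau 0).
Variables (s : nat) (s_gt0 : (0 < s)%N).
Hypothesis expand : forall b, P b ->
  exists b1 b2, [/\ P b1, P b2 & b = b ^+ (p ^ s)%N + pF * b1 + tau * b2].
Hypothesis weight0 : forall N : nat, exists M0 : nat, forall M, (M0 <= M)%N ->
  forall b, P b -> wt M N 0 (f b).

Let P1 : P 1. Proof. by case: hP. Qed.
Let PB a b : P a -> P b -> P (a - b). Proof. by case: hP => _ h _; exact: h. Qed.
Let PM a b : P a -> P b -> P (a * b). Proof. by case: hP => _ _ h; exact: h. Qed.
Let P0 : P 0. Proof. by rewrite -(subrr 1); exact: PB. Qed.
Let PD a b : P a -> P b -> P (a + b).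
Proof. by move=> ha hb; rewrite -[b]opprK; apply: PB => //; rewrite -sub0r; exact: PB. Qed.
Let PX a n : P a -> P (a ^+ n).
Proof. by move=> ha; elim: n => [|n IH]; [|rewrite exprS; exact: PM]. Qed.
Let fX a n : P a -> f (a ^+ n) = f a ^+ n.
Proof.
by move=> ha; elim: n => [|n IH]; rewrite ?exprS ?fM ?IH //; exact: PX.
Qed.

Let QQ Mx := ((p ^ s) ^ Mx)%N.

(** The expansion is applied again to the power of [b], which makes the exponent divisible by any
    given power of [p]. *)
Lemma expand_iter Mx b : P b -> exists b1 b2,
  [/\ P b1, P b2 & b = b ^+ QQ Mx + pF * b1 + tau * b2].
Proof.
move=> hb; elim: Mx => [|Mx [b1 [b2 [h1 h2 e]]]].
  by exists 0, 0; split=> //; rewrite /QQ expn0 expr1 !mulr0 !addr0.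
have [c1 [c2 [k1 k2 e']]] := expand (PX (QQ Mx) hb).
exists (b1 + c1), (b2 + c2); split; [exact: PD|exact: PD|].
by rewrite {1}e {1}e' /QQ expnSr exprM; ring.
Qed.

Section Level.
Variable Mx : nat.
Notation Qx := (QQ Mx).

(** These sets separate, for functions and for forms, the terms that are integrated explicitly from
    the negligible ones: multiples of [Qx], and terms with many factors [f pF] or [f tau]. *)
Definition gen_main J : set (lau V) := [set x | exists i j z,
  [/\ (j < J)%N, P z & x = f pF ^+ i * f z ^+ Qx * f tau ^+ j]].
Definition gen_rest N : set (lau V) := [set x | exists i j z,
  [/\ (i + j = N)%N, P z & x = f pF ^+ i * f tau ^+ j * f z]].
Definition gen_mainform J : set (lau V) := [set x | exists2 y, gen_main J y & x = y * der (f tau)].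
Definition gen_small : set (lau V) := [set x | exists y, x = Qx%:R * y].
Definition gen_restform N : set (lau V) := [set x | exists i j a b,
  [/\ (N <= i + j)%N, P a, P b & x = f pF ^+ i * f tau ^+ j * (f a * der (f b))]].

Lemma gen_mainform_in J (i j : nat) z : (j < J)%N -> P z ->
  gen_mainform J (f pF ^+ i * f z ^+ Qx * f tau ^+ j * der (f tau)).
Proof. by move=> lt hz; exists (f pF ^+ i * f z ^+ Qx * f tau ^+ j) => //; exists i, j, z. Qed.

Lemma gen_small_in y : gen_small (Qx%:R * y). Proof. by exists y. Qed.

(** Expanding [z] in a remaining term produces a main term and two terms with one more factor [f pF]
    or [f tau]. *)
Lemma span_fun N b : P b -> addspan (gen_main N `|` gen_rest N) (f b).
Proof.
move=> hb; elim: N => [|N IH].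
  by apply: addspan_gen; right; exists 0%N, 0%N, b; rewrite !expr0 !mul1r.
apply: addspan_sub IH => _ [[i [j [z [lt hz ->]]]]|[i [j [z [eN hz ->]]]]].
  by apply: addspan_gen; left; exists i, j, z; split=> //; exact: ltnW.
have [z1 [z2 [h1 h2 e]]] := expand_iter Mx hz.
rewrite e !fD ?fM ?fX ?mulrDr //; last 4 first.
- exact: PX.
- exact: PM.
- by apply: PD; [exact: PX|exact: PM].
- exact: PM.
apply: addspanD; first apply: addspanD; apply: addspan_gen.
- by left; exists i, j, z; split=> //; [lia|ring].
- by right; exists i.+1, j, z1; split=> //; [lia|rewrite exprS; ring].
- by right; exists i, j.+1, z2; split=> //; [lia|rewrite exprS; ring].
Qed.

(** Differentiate the expansion of [f b]: powers of [f pF] are constants, the derivative of a Qx-th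
    power is a multiple of [Qx], and powers of [f tau] give main forms. The order [N.+1] is taken
    because differentiation may lose a factor [f tau]. *)
Lemma span_form N a b : P a -> P b ->
  addspan (gen_mainform (N + N).+2 `|` gen_small `|` gen_restform N) (f a * der (f b)).
Proof.
move=> ha hb.
have dp : der (f pF) = 0 by rewrite f_pF der_cst.
have dpX i : der (f pF ^+ i) = 0 by rewrite derX dp mulr0.
have h : addspan (gen_mainform N.+1 `|` gen_small `|` gen_restform N) (der (f b)).
  pose T := [set x | addspan (gen_mainform N.+1 `|` gen_small `|` gen_restform N) (der x)].
  suff : T (f b) by []; apply: (@span_fun N.+1 _ hb T).
  - by rewrite /T /= der0; exact: addspan0.
  - move=> _ [[i [j [z [lt hz ->]]]]|[i [j [z [eN hz ->]]]]]; rewrite /T /=.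
      rewrite !derM dpX !derX mul0r add0r.
      have -> : f pF ^+ i * (Qx%:R * f z ^+ Qx.-1 * der (f z)) * f tau ^+ j
        + f pF ^+ i * f z ^+ Qx * (j%:R * f tau ^+ j.-1 * der (f tau)) =
        Qx%:R * (f pF ^+ i * (f z ^+ Qx.-1 * der (f z)) * f tau ^+ j) +
        (f pF ^+ i * f z ^+ Qx * f tau ^+ j.-1 * der (f tau)) *+ j.
        by rewrite -[_ *+ j]mulr_natl; ring.
      apply: addspanD; first by apply: addspan_gen; left; right; exact: gen_small_in.
      apply: addspanMn; apply: addspan_gen; left; left.
      by apply: gen_mainform_in => //; lia.
    rewrite !derM dpX !derX mul0r add0r.
    have -> : f pF ^+ i * (j%:R * f tau ^+ j.-1 * der (f tau)) * f z =
      (f pF ^+ i * f tau ^+ j.-1 * (f z * der (f tau))) *+ j.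
      by rewrite -[_ *+ j]mulr_natl; ring.
    apply: addspanD.
      case: j eN => [|j] eN; first by rewrite mulr0n; exact: addspan0.
      by apply: addspanMn; apply: addspan_gen; right; exists i, j, z, tau; split=> //; rewrite /=; lia.
    by apply: addspan_gen; right; exists i, j, 1, z; rewrite f1 mul1r; split=> //; lia.
  - by move=> x y; rewrite /T /= derD; exact: addspanD.
apply: addspanM h => x [[[y hy ->]|[y ->]]|[i [j [c [d [le hc hd ->]]]]]]; last first.
- apply: addspan_gen; right; exists i, j, (a * c), d.
  by split=> //; [exact: PM|rewrite fM //; ring].
- by apply: addspan_gen; left; right; exists (f a * y); ring.
(* Only main forms call for an expansion of [f a] as well. The exponents of [f tau] are then at most
   N and N - 1, and their sum respects the bound (N + N).+2. *)
case: hy => i [j [z [lt hz ->]]].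
rewrite mulrC; apply: addspanM (@span_fun N _ ha) => _ [] [i' [j' [z' [lt' hz' ->]]]].
  apply: addspan_gen; left; left.
  have -> : f pF ^+ i * f z ^+ Qx * f tau ^+ j * der (f tau) *
      (f pF ^+ i' * f z' ^+ Qx * f tau ^+ j') =
    f pF ^+ (i + i') * f (z * z') ^+ Qx * f tau ^+ (j + j') * der (f tau).
    by rewrite fM // exprMn !exprD; ring.
  by apply: gen_mainform_in; [lia|exact: PM].
apply: addspan_gen; right; exists (i + i')%N, (j + j')%N, (z ^+ Qx * z'), tau.
split=> //; [lia|by apply: PM => //; exact: PX|].
by rewrite fM // ?fX // ?exprD; [ring|exact: PX].
Qed.

End Level.

Let y := f tau - Y tau ^+ q'.

(** The hypothesis only concerns the quotients y^i / i at poles of order at least [m0]. With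
    [c = -h] and [m0 = 0] this yields the bound, with large [c] and suitable [m0] the convergence of
    the contribution. *)
Lemma form_estimate (c : int) (m0 : nat) :
  (forall i m : nat, (0 < i)%N -> (m0 <= m)%N -> vge w c ((y ^+ i) (- m%:Z) / i%:R)) ->
  forall a b, P a -> P b -> forall m : nat, (0 < m)%N -> (m0 <= m)%N ->
    vge w c ((f a * der (f b)) (-1 - m%:Z) / m%:R).
Proof.
move=> hy a b ha hb m m_gt0 le_m0.
have vnat k : (0 < k)%N -> 0 <= w k%:R.
  by move=> /char0 k0; rewrite -vgeP //; exact: vge_nat.
have vdiv (k : nat) (d : int) x : (0 < k)%N -> vge w (d + w k%:R) x -> vge w d (x / k%:R).
  move=> /char0 k0 hx; have hV : vge w (- w k%:R) k%:R^-1 by right; rewrite valV.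
  by have := vgeM hw hx hV; rewrite addrK.
(* Precision at which a term remains harmless after division by [m]. *)
pose N1 := `|(c + w m%:R)%R|%N.
have hN1 x : vge w N1%:Z x -> vge w c (x / m%:R).
  by move=> hx; apply: vdiv => //; apply: vge_le hx; rewrite /N1; lia.
have psY : psr (Y tau ^+ q') by apply/psrX/psrY.
have y1 : ediv 1 y by exact: fY.
have [M0 hM0] := weight0 N1; have [m1 hm1] := lau_cut y N1%:Z.
(* Large enough for the uniform weights, and for [y], whose pole order at this precision is at most
   [m1], to have weight 1. *)
pose M := maxn M0 m1.+1.
have M_gt0 : (0 < M)%N by rewrite /M; lia.
have wf z : P z -> wt M N1 0 (f z) by apply: hM0; rewrite leq_maxl.
have wtau : wt M N1 1 (f tau).
  set x0 := (Y tau ^+ q') 0.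
  have hx0 : vge w 1 x0.
    rewrite /x0 psr_coefX0; last exact: psrY.
    case: (q') q'_gt0 => // k _; rewrite exprS; apply: vgeMr => //.
    by apply: vge0X => //; exact: lau0.
  have -> : f tau = (Y tau ^+ q' - cst x0) + cst x0 + y by rewrite /y; ring.
  apply: wtD; last by apply: (ediv1_wt M_gt0 hm1) => //; rewrite /M; lia.
  apply: wtD.
    apply: psr_wt1 => //; first by apply: psrB => //; exact: psr_cst.
    by rewrite lauB cstE ?eqxx ?subrr //; exact: lau0.
  apply: (@ediv1_wt _ _ _ _ _ 0%N) => //; last exact: ediv_cst.
  by move=> i hi; left; apply: (psr_cst x0); lia.
(* If i + j >= N, then either i >= N1 and the power of [f pF] is negligible, or j > M N1 and the
   weight j - 1 of the form forces valuation at least N1 in negative degrees. *)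
pose N := (N1 + M * N1 + 1)%N.
(* Bounds the valuations of all denominators [j.+1] that occur in main forms. *)
pose B := (\sum_(j < (N + N).+2) `|(w (j.+1)%:R)%R|)%N.
have hB (j : nat) : (j < (N + N).+2)%N -> w j.+1%:R <= B%:Z.
  move=> lt; rewrite /B (bigD1 (Ordinal lt)) //=.
  by rewrite PoszD gez0_abs ?lerDl // vnat.
(* So many factors [p] in the exponent outweigh the denominators [j.+1] and [m] and the bound
   [c]. *)
pose Mx := (N1 + B + `|c|)%N.
have hQ : vge w Mx%:Z (QQ Mx)%:R.
  rewrite /QQ -expnM natrX; apply: vge_le (vgeX hw _ hwp); nia.
have hQd z : P z -> ediv Mx%:Z (f z ^+ QQ Mx - (Y z ^+ q') ^+ QQ Mx).
  move=> hz; rewrite /QQ -expnM.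
  by apply: ediv_le (ediv_expr_p_pow hp hwp (s * Mx) (fY hz)); nia.
pose T := [set x : lau V | vge w c (x (-1 - m%:Z) / m%:R)].
suff : T (f a * der (f b)) by [].
apply: (@span_form Mx N _ _ ha hb T).
- by rewrite /T /mkset lau0E mul0r; left.
- move=> _ [[[_ [i [j [z [lt hz ->]]]] ->]|[x ->]]|[i [j [a1 [b1 [le h1 h2 ->]]]]]];
    rewrite /T /mkset; last first.
  + apply: hN1; have [le1|lt1] := leqP N1 i.
      suff h : ediv N1%:Z (f pF ^+ i * f tau ^+ j * (f a1 * der (f b1))) by exact: h.
      rewrite f_pF; apply/edivMr/edivMr.
      by apply: ediv_le (edivX i (ediv_cst hc0)); lia.
    have h := wtM M_gt0 (wtM M_gt0 (wtX M_gt0 (n := i) (wf _ P_pF)) (wtX M_gt0 (n := j) wtau))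
      (wtM M_gt0 (wf _ h1) (wt_der M_gt0 (wf _ h2))).
    by apply: h => //; rewrite /N in le; nia.
  + apply: hN1; have h := edivMr x (ediv_cst hQ); rewrite -cst_nat in h.
    by apply: vge_le (h _); rewrite /Mx; lia.
  (* Up to a multiple of the exponent [QQ Mx], this is [j.+1] times a primitive of the main form. *)
  pose g := f pF ^+ i * f z ^+ QQ Mx * f tau ^+ j.+1.
  set X := _ * der (f tau).
  pose E := f pF ^+ i * f z ^+ (QQ Mx).-1 * der (f z) * f tau ^+ j.+1.
  have dg : der g = (QQ Mx)%:R * E + j.+1%:R * X.
    rewrite /g !derM !derX /= f_pF der_cst mulr0 mul0r add0r -f_pF /E /X; ring.
  have j0 := char0 (ltn0Sn j); have m0' := char0 m_gt0.
  (* In degree -1 - m the derivation multiplies by -m, so the denominator [m] cancels and only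
     [j.+1] is left. *)
  have eX : X (-1 - m%:Z) / m%:R = - (g (- m%:Z) / j.+1%:R)
      - ((QQ Mx)%:R * E) (-1 - m%:Z) / j.+1%:R / m%:R.
    have eM : (j.+1%:R * X : lau V) (-1 - m%:Z) = j.+1%:R * X (-1 - m%:Z).
      by rewrite cst_nat cstM //; exact: vge_nat.
    have := congr1 (fun x => lcoef x (-1 - m%:Z)) dg.
    rewrite derE lauD eM.
    rewrite (_ : -1 - m%:Z + 1 = - m%:Z); last by lia.
    rewrite mulrNz => e0.
    have e : j.+1%:R * X (-1 - m%:Z) = - m%:R * g (- m%:Z) - ((QQ Mx)%:R * E) (-1 - m%:Z).
      by rewrite [- m%:R * _]e0; ring.
    have -> : X (-1 - m%:Z) = (j.+1%:R * X (-1 - m%:Z)) / j.+1%:R.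
      by rewrite mulrAC divff // mul1r.
    have fld (J m' G q : V) : J != 0 -> m' != 0 ->
      (- m' * G - q) / J / m' = - (G / J) - q / J / m'.
      by move=> J0 m'0; field; rewrite J0 m'0.
    by rewrite e fld.
  rewrite eX; apply: vgeB => //; last first.
    apply/hN1/vdiv => //; have h := edivMr E (ediv_cst hQ); rewrite -cst_nat in h.
    by apply: vge_le (h _); have := hB j lt; rewrite /Mx; lia.
  (* At this precision the power of [f z] may be replaced by the power series [rz]. *)
  apply: vgeN => //; set rz := (Y z ^+ q') ^+ QQ Mx.
  have ps_z : psr rz by apply/psrX/psrX/psrY.
  have -> : g = f pF ^+ i * f tau ^+ j.+1 * (f z ^+ QQ Mx - rz) +
      f pF ^+ i * rz * (Y tau ^+ q' + y) ^+ j.+1.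
    by rewrite /y [Y tau ^+ q' + _]addrC subrK /g; ring.
  rewrite lauD mulrDl; apply: vgeD => //.
    apply: vdiv => //; have h := edivMl (f pF ^+ i * f tau ^+ j.+1) (hQd z hz).
    by apply: vge_le (h _); have := hB j lt; rewrite /Mx; lia.
  rewrite exprDn mulr_sumr lau_sum mulr_suml; apply: vge_sum => // -[k lek] _; rewrite ![nat_of_ord (Ordinal lek)]/=.
  set rk := f pF ^+ i * rz * Y tau ^+ q' ^+ (j.+1 - k).
  have ps_k : psr rk.
    by apply: psrM; [apply: psrM => //; rewrite f_pF; exact/psrX/psr_cst|exact: psrX].
  rewrite mulrnAr mulrA -/rk -[_ *+ _]mulr_natl cst_nat cstM; last exact: vge_nat.
  (* The term without [y] is a power series and has no coefficient in degree -m. *)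
  case: k lek rk ps_k => [|k] lek rk ps_k.
    by rewrite expr0 mulr1 ps_k ?mulr0 ?mul0r; [left|lia].
  (* Since C(j+1, k+1) / (j+1) = C(j, k) / (k+1), the denominator j+1, which nothing compensates, is
     traded for k+1, which goes with y^(k+1). *)
  have -> : 'C(j.+1, k.+1)%:R * (rk * y ^+ k.+1) (- m%:Z) / j.+1%:R =
      'C(j, k)%:R * ((rk * y ^+ k.+1) (- m%:Z) / k.+1%:R).
    have k0 := char0 (ltn0Sn k); have := congr1 (fun n => n%:R : V) (mul_bin_diag j.+1 k).
    rewrite !natrM /= => e.
    have fld (J k' C C' q : V) : J != 0 -> k' != 0 -> J * C = k' * C' ->
      C' * q / J = C * (q / k').
      move=> J0 k'0 eC; have -> : C' = J * C / k' by rewrite eC mulrC mulKf.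
      by field; rewrite J0 k'0.
    exact: fld e.
  apply: vgeMl => //; first exact: vge_nat.
  (* The power series factor brings in the coefficients of [y ^+ k.+1] in degrees at most -m only,
     so the hypothesis for poles of order at least [m0] still applies. *)
  apply: vdiv => //; apply: lauM_ge => l; have [l0|l0] := ltP l 0.
    by rewrite ps_k // mul0r; left.
  apply: vgeMl => //; first exact: lau0.
  have k0 := char0 (ltn0Sn k).
  have := hy k.+1 (m + `|l|)%N isT (leq_trans le_m0 (leq_addr _ _)).
  rewrite (_ : - (m + `|l|)%N%:Z = - m%:Z - l); last by lia.
  have h1 : vge w (w k.+1%:R) k.+1%:R by right.
  by move=> h; have := vgeM hw h h1; rewrite divfK.
- by move=> x1 x2; rewrite /T /mkset lauD mulrDl; exact: vgeD.
Qed.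

End Estimate.

Lemma poly_over_ind (K : fieldType) n (S : set K) (Pr : {mpoly K[n]} -> Prop) :
  S 0 -> S 1 -> (forall c, S c -> Pr c%:MP) -> (forall i, Pr 'X_i) ->
  (forall g h, Pr g -> Pr h -> Pr (g + h)) ->
  (forall g h, Pr g -> Pr h -> Pr (g * h)) ->
  forall g, poly_over S g -> Pr g.
Proof.
move=> S0 S1 PC PX PD PM g hg; rewrite [g]mpolyE.
have P0 : Pr 0 by rewrite -mpolyC0; exact: PC.
have P1 : Pr 1 by rewrite -mpolyC1; exact: PC.
apply: big_ind; [exact: P0|exact: PD|move=> m _]; rewrite -mul_mpolyC; apply: (PM); first exact/PC/hg.
rewrite mpolyXE_id; apply: big_ind; [exact: P1|exact: PM|move=> i _].
by elim: (m i) => [|k IH]; [rewrite expr0|rewrite exprS; apply: (PM)].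
Qed.

(** * Overconvergent series and the lift *)

Section PowerSeriesMorphism.
Variables (K : fieldType) (n : nat).

Fact mps_of_additive : zmod_morphism (@mps_of K n).
Proof. by move=> a b; apply/funext => m; rewrite /mps_of mcoeffB. Qed.
HB.instance Definition _ :=
  GRing.isZmodMorphism.Build {mpoly K[n]} (mps K n) (@mps_of K n) mps_of_additive.

Fact mps_of_multiplicative : monoid_morphism (@mps_of K n).
Proof.
split=> // a b; apply/funext => k.
rewrite (_ : (mps_of a * mps_of b) k = mps_mul (mps_of a) (mps_of b) k) //.
exact: mcoeffM.
Qed.
HB.instance Definition _ :=
  GRing.isMonoidMorphism.Build {mpoly K[n]} (mps K n) (@mps_of K n) mps_of_multiplicative.

Lemma mps0 m : (0 : mps K n) m = 0. Proof. exact: mcoeff0. Qed.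
Lemma mps1 m : (1 : mps K n) m = (m == 0%MM)%:R. Proof. by rewrite -mcoeff1. Qed.
Lemma mpsM (a b : mps K n) m : (a * b) m =
  \sum_(k : 'X_{1..n < (mdeg m).+1, (mdeg m).+1} | m == (k.1 + k.2)%MM) a k.1 * b k.2.
Proof. by []. Qed.
Lemma mps_constM c (b : mps K n) m : (mps_of c%:MP * b) m = c * b m.
Proof.
pose g : {mpoly K[n]} := \sum_(k : 'X_{1..n < (mdeg m).+1}) b k *: 'X_[k].
have gE k : (mdeg k <= mdeg m)%N -> g@_k = b k by move=> le; rewrite mcoeff_mpoly.
rewrite -gE // -mcoeffCM mcoeffM mpsM; apply: eq_bigr => -[k1 k2] _ /=.
by rewrite gE // -ltnS bmdeg.
Qed.
Lemma mps_natE (k : nat) : (k%:R : mps K n) = mps_of (k%:R)%:MP.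
Proof. by rewrite -[RHS]/(mps_of _) mpolyC_nat rmorph_nat. Qed.

End PowerSeriesMorphism.

Section Subst.
Variables (K : fieldType) (sigma : {rmorphism K -> K}) (m : nat).
Variable y : 'I_m.+1 -> mps K m.+1.
Implicit Types (g h : {mpoly K[m.+1]}).

Let csub : {rmorphism K -> mps K m.+1} := @mps_of K m.+1 \o (@mpolyC m.+1 K \o sigma).

Lemma substE g : subst sigma y g = mmap csub y g. Proof. by []. Qed.
Lemma substD g h : subst sigma y (g + h) = subst sigma y g + subst sigma y h.
Proof. by rewrite !substE rmorphD. Qed.
Lemma substM g h : subst sigma y (g * h) = subst sigma y g * subst sigma y h.
Proof. by rewrite !substE rmorphM. Qed.
Lemma subst1 : subst sigma y 1 = 1.
Proof. by rewrite !substE rmorph1. Qed.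
Lemma subst0 : subst sigma y 0 = 0.
Proof. by rewrite !substE rmorph0. Qed.
Lemma substC c : subst sigma y c%:MP = mps_of (sigma c)%:MP.
Proof. by rewrite substE mmapC. Qed.
Lemma substX i : subst sigma y 'X_i = y i.
Proof. by rewrite substE mmapX mmap1U. Qed.

End Subst.

Section Psi.
Variables (K : fieldType) (sigma : {rmorphism K -> K}) (q m : nat).
Implicit Types (g h : {mpoly K[m.+1]}).

Let cpsi : {rmorphism K -> {mpoly K[m.+1]}} := @mpolyC m.+1 K \o sigma.

Lemma psiE g : psi sigma q g = mmap cpsi (fun i => 'X_i ^+ q) g. Proof. by []. Qed.
Lemma psiX i : psi sigma q ('X_i : {mpoly K[m.+1]}) = 'X_i ^+ q.
Proof. by rewrite psiE mmapX mmap1U. Qed.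

Lemma mps_of_psi g : mps_of (psi sigma q g) = subst sigma (fun i => mps_of 'X_i ^+ q) g.
Proof.
rewrite psiE substE /mmap rmorph_sum; apply: eq_bigr => k _.
rewrite rmorphM; congr (_ * _); rewrite /mmap1 rmorph_prod.
by apply: eq_bigr => i _; rewrite !rmorphXn.
Qed.

End Psi.

Section MpsWeights.
Variables (K : fieldType) (v : K -> int) (hv : discrete_valuation v) (n : nat).
Implicit Types (a b : mps K n).

Definition mge (N : int) a := forall m, vge v N (a m).

Lemma mge_le N N' a : N' <= N -> mge N a -> mge N' a.
Proof. by move=> le h m; apply: vge_le (h m). Qed.
Lemma mge0 N : mge N 0. Proof. by move=> m; rewrite mps0; left. Qed.
Lemma mge1 : mge 0 1.
Proof. by move=> m; rewrite mps1; exact: vge_nat. Qed.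
Lemma mgeD N a b : mge N a -> mge N b -> mge N (a + b).
Proof. by move=> ha hb m; apply: vgeD. Qed.
Lemma mgeN N a : mge N a -> mge N (- a).
Proof. by move=> ha m; apply: vgeN. Qed.
Lemma mgeB N a b : mge N a -> mge N b -> mge N (a - b).
Proof. by move=> ha hb; apply: mgeD => //; exact: mgeN. Qed.
Lemma mgeM N N' a b : mge N a -> mge N' b -> mge (N + N') (a * b).
Proof. by move=> ha hb m; apply: vge_sum => // k _; exact: vgeM. Qed.
Lemma mgeMl N a b : mge 0 a -> mge N b -> mge N (a * b).
Proof. by move=> ha hb; rewrite -[N]add0r; exact: mgeM. Qed.
Lemma mgeMr N a b : mge N a -> mge 0 b -> mge N (a * b).
Proof. by move=> ha hb; rewrite -[N]addr0; exact: mgeM. Qed.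
Lemma mge_sum N (I : Type) (r : seq I) (P : pred I) (G : I -> mps K n) :
  (forall i, P i -> mge N (G i)) -> mge N (\sum_(i <- r | P i) G i).
Proof. by move=> h; apply: big_ind => //; [exact: mge0|exact: mgeD]. Qed.
Lemma mge0X a k : mge 0 a -> mge 0 (a ^+ k).
Proof.
by move=> ha; elim: k => [|k IH]; [exact: mge1|rewrite exprS; exact: mgeMl].
Qed.
Lemma mge_const N c : vge v N c -> mge N (mps_of c%:MP).
Proof. by move=> h m; rewrite /mps_of mcoeffC; case: eqP => _; rewrite ?mulr1 // mulr0; left. Qed.
Lemma mge_nat k : mge 0 k%:R.
Proof. by rewrite mps_natE; apply: mge_const; exact: vge_nat. Qed.
Lemma mge_X i : mge 0 (mps_of 'X_i).
Proof. by move=> m; rewrite /mps_of mcoeffX; exact: vge_nat. Qed.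

(* For the level [k] going to infinity: the valuation of the coefficient of a
   monomial of degree d is at least (d + al) / c. *)
Section Level.
Variables (c : nat) (c_gt0 : (0 < c)%N).

Definition pw (al k : int) a := forall m (l : int),
  l <= k -> c%:Z * (l - 1) < (mdeg m)%:Z + al -> vge v l (a m).

Lemma pw_coef al k a m : pw al k a -> a m != 0 ->
  k <= v (a m) \/ (mdeg m)%:Z + al <= c%:Z * v (a m).
Proof.
move=> h a0; have [h1|h1] := leP k (v (a m)); first by left.
have [h2|h2] := leP ((mdeg m)%:Z + al) (c%:Z * v (a m)); first by right.
have : vge v (v (a m) + 1) (a m).
  by move: (v (a m)) h1 h2 => z h1 h2; apply: h; [lia|rewrite addrK].
by rewrite vgeP // gerDl.
Qed.

Lemma pw_le al al' k k' a : al' <= al -> k' <= k -> pw al k a -> pw al' k' a.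
Proof. by move=> h1 h2 h m l hl hm; apply: h; lia. Qed.
Lemma pwD al k a b : pw al k a -> pw al k b -> pw al k (a + b).
Proof. by move=> ha hb m l hl hm; apply: vgeD => //; [exact: ha|exact: hb]. Qed.
Lemma pwN al k a : pw al k a -> pw al k (- a).
Proof. by move=> ha m l hl hm; apply: vgeN => //; exact: ha. Qed.
Lemma pw0 al k : pw al k 0.
Proof. by move=> m l _ _; rewrite mps0; left. Qed.
Lemma pw_sum al k (I : Type) (r : seq I) (P : pred I) (G : I -> mps K n) :
  (forall i, P i -> pw al k (G i)) -> pw al k (\sum_(i <- r | P i) G i).
Proof. by move=> h; apply: big_ind => //; [exact: pw0|exact: pwD]. Qed.

(** Multiplication by a series divisible by the i'-th power of the uniformiser raises the level from
    [k] to [k + i']. This gain drives the induction on the level for [S]. *)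
Lemma pwM i i' al al' k k' k0 a b : mge i a -> mge i' b -> k0 <= k + i' -> k0 <= i + k' ->
  pw al k a -> pw al' k' b -> pw (al + al') k0 (a * b).
Proof.
move=> ha hb le1 le2 pa pb m l hl hm; apply: vge_sum => // -[m1 m2] /= /eqP em.
have [->|a0] := eqVneq (a m1) 0; first by rewrite mul0r; left.
have [->|b0] := eqVneq (b m2) 0; first by rewrite mulr0; left.
right; rewrite valM //.
have /(vgeP _ _ a0) := ha m1; have /(vgeP _ _ b0) := hb m2.
have := pw_coef pa a0; have := pw_coef pb b0.
have := congr1 mdeg em; rewrite mdegD.
have arith (x y : int) (d1 d2 d : nat) : c%:Z * (l - 1) < d%:Z + (al + al') ->
    d = (d1 + d2)%N -> k' <= y \/ d2%:Z + al' <= c%:Z * y ->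
    k <= x \/ d1%:Z + al <= c%:Z * x -> i' <= y -> i <= x -> l <= x + y.
  by move=> h0 ed; move: h0; rewrite ed => ? [?|?] [?|?] ? ?; nia.
exact: arith hm.
Qed.

Lemma pw_poly (B : nat) k g : (msize g <= B)%N -> mge 0 (mps_of g) ->
  pw (- B%:Z) k (mps_of g).
Proof.
move=> hB h m l _ hl; have [lt|le] := ltnP (mdeg m) B.
  by apply: vge_le (h m); nia.
by left; apply: memN_msupp_eq0; apply: msize_mdeg_ge; exact: leq_trans le.
Qed.

Lemma pw_poly1 (B : nat) k g : (msize g <= B)%N -> mge 1 (mps_of g) ->
  pw (c%:Z - B%:Z) k (mps_of g).
Proof.
move=> hB h m l _ hl; have [lt|le] := ltnP (mdeg m) B.
  by apply: vge_le (h m); nia.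
by left; apply: memN_msupp_eq0; apply: msize_mdeg_ge; exact: leq_trans le.
Qed.

End Level.

(** Overconvergence becomes a bound at every level with fixed constants, which can be proved by
    induction on the level. *)
Lemma daggerP a : dagger v a <-> mge 0 a /\ exists c b : nat, (0 < c)%N /\
  forall k, pw c (- b%:Z) k a.
Proof.
split=> -[h0 [c [b h]]]; split=> //.
  exists c.+1, (c.+1 * b)%N; split=> // k m l _ hl.
  case: (h m) => [am|hm]; first by left.
  have [a0|a0] := eqVneq (a m) 0; first by left.
  right; have /(vgeP _ _ a0) := h0 m; move: (v (a m)) hm hl => x; rewrite PoszM; nia.
case: h => c_gt0 h; exists c, b => m.
have [a0|a0] := eqVneq (a m) 0; first by left.
right; have /(vgeP _ _ a0) pos := h0 m.
case: (pw_coef c_gt0 (h (v (a m) + 1)) a0); first by rewrite gerDl.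
by move: (v (a m)) pos => x; nia.
Qed.

Lemma pw_dagger_le (c c' b b' : nat) k a : (0 < c)%N -> (c <= c')%N -> (b <= b')%N -> mge 0 a ->
  (forall k, pw c (- b%:Z) k a) -> pw c' (- b'%:Z) k a.
Proof.
move=> c0 hc hb h0 h m l hl hm.
have [l0|l0] := leP l 0; first by apply: vge_le (h0 m).
by apply: (h l) => //; nia.
Qed.

Lemma dagger2 a a' : dagger v a -> dagger v a' -> exists c b : nat,
  [/\ (0 < c)%N, forall k, pw c (- b%:Z) k a & forall k, pw c (- b%:Z) k a'].
Proof.
move=> /daggerP[h0 [c [b [c0 h]]]] /daggerP[h0' [c' [b' [c0' h']]]].
exists (maxn c c'), (maxn b b'); split=> [|k|k]; first by lia.
  by apply: pw_dagger_le h; rewrite ?leq_maxl.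
by apply: pw_dagger_le h'; rewrite ?leq_maxr.
Qed.

Lemma dagger_ge0 a : dagger v a -> mge 0 a. Proof. by case. Qed.

Lemma daggerD a b : dagger v a -> dagger v b -> dagger v (a + b).
Proof.
move=> ha hb; have [c [B [c0 h h']]] := dagger2 ha hb; apply/daggerP; split.
  by apply: mgeD; exact: dagger_ge0.
by exists c, B; split=> // k; exact: pwD.
Qed.
Lemma daggerM a b : dagger v a -> dagger v b -> dagger v (a * b).
Proof.
move=> ha hb; have [c [B [c0 h h']]] := dagger2 ha hb; apply/daggerP; split.
  by apply: mgeMl; exact: dagger_ge0.
exists c, (B + B)%N; split=> // k.
have -> : - (B + B)%N%:Z = - B%:Z + - B%:Z by lia.
apply: (@pwM c c0 0 0 _ _ k k) => //; try exact: dagger_ge0; by rewrite ?addr0 ?add0r.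
Qed.
Lemma dagger_poly g : mge 0 (mps_of g) -> dagger v (mps_of g).
Proof.
move=> h; apply/daggerP; split=> //; exists 1%N, (msize g); split=> // k.
exact: pw_poly.
Qed.
Lemma dagger_const c : vge v 0 c -> dagger v (mps_of (c%:MP : {mpoly K[n]})).
Proof. by move=> h; apply: dagger_poly; exact: mge_const. Qed.
Lemma dagger0 : dagger v (0 : mps K n).
Proof. by rewrite -(rmorph0 (@mps_of K n)) -mpolyC0; apply: dagger_const; left. Qed.
Lemma dagger1 : dagger v (1 : mps K n).
Proof. by rewrite -(rmorph1 (@mps_of K n)) -mpolyC1; apply: dagger_const; exact: vge1. Qed.
Lemma daggerX a k : dagger v a -> dagger v (a ^+ k).
Proof.
by move=> ha; elim: k => [|k IH]; [exact: dagger1|rewrite exprS; exact: daggerM].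
Qed.
Lemma dagger_sum (I : Type) (r : seq I) (P : pred I) (G : I -> mps K n) :
  (forall i, P i -> dagger v (G i)) -> dagger v (\sum_(i <- r | P i) G i).
Proof. by move=> h; apply: big_ind => //; [exact: dagger0|exact: daggerD]. Qed.

(** All valuations drop by 1, which is paid for by replacing the constant b by b + c. *)
Lemma dagger_divide x a : v x = 1 -> x != 0 -> dagger v a -> mge 1 a ->
  exists2 b, dagger v b & a = mps_of x%:MP * b.
Proof.
move=> vx x0 ha h1.
have hV : vge v (-1) x^-1 by right; rewrite valV // vx.
exists (fun m => x^-1 * a m : K); last first.
  by apply/funext => m; rewrite mps_constM mulrA divff // mul1r.
have /daggerP[_ [c [b [c0 h]]]] := ha; apply/daggerP; split.
  by move=> m; apply: vge_le (vgeM hv hV (h1 m)).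
exists c, (b + c)%N; split=> // k m l hl hm.
by apply: vge_le (vgeM hv hV (h (k + 1) m (l + 1) _ _)); lia.
Qed.

End MpsWeights.

(** * Frobenius congruences and Taylor expansion *)

Section Lift.
Variables (K : fieldType) (v : K -> int) (hv : discrete_valuation v).
Variables (p : nat) (hp : prime p) (hvp : vge v 1 p%:R) (a : nat).
Notation q := (p ^ a)%N.
Variable sigma : {rmorphism K -> K}.
Hypothesis hsigma : forall c, vring v c -> vmax v (sigma c - c ^+ q).
Variable m : nat.
Notation mpol := {mpoly K[m.+1]}.
Notation ser := (mps K m.+1).

Lemma q_gt0 : (0 < q)%N. Proof. by rewrite expn_gt0 prime_gt0. Qed.

Lemma sigma_ge0 c : vge v 0 c -> vge v 0 (sigma c).
Proof.
move=> hc; have /(vmaxE v) h := hsigma hc.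
by rewrite -[sigma c](subrK (c ^+ q)); apply: vgeD => //; [apply: vge_le h|exact: vge0X].
Qed.

Lemma sigma_ge1 c : vge v 1 c -> vge v 1 (sigma c).
Proof.
move=> hc; have h0 : vge v 0 c by exact: vge_le hc.
have /(vmaxE v) h := hsigma h0.
rewrite -[sigma c](subrK (c ^+ q)); apply: vgeD => //.
by apply: vge_le (vgeX hv q hc); have := q_gt0; lia.
Qed.

Lemma mps_frobenius (x y : ser) : mge v 0 x -> mge v 0 y ->
  mge v 1 ((x + y) ^+ q - (x ^+ q + y ^+ q)).
Proof.
move=> hx hy; elim: a => [|k IH]; first by rewrite expn0 !expr1 subrr; exact: mge0.
have X0 (z : ser) i : mge v 0 z -> mge v 0 (z ^+ i) by exact: mge0X.
set A := (x + y) ^+ _ in IH; set B := x ^+ _ + _ in IH.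
have hA : mge v 0 A by apply: X0; exact: mgeD.
have hB : mge v 0 B by apply: mgeD => //; exact: X0.
rewrite expnSr !exprM -/A.
rewrite -[A ^+ p](subrK (B ^+ p)) -addrA.
apply: mgeD => //.
  rewrite subrXX; apply: mgeMr => //; apply: mge_sum => // i _.
  by apply: mgeMl => //; exact: X0.
have [c ->] := expD_prime_pow hp (x ^+ (p ^ k)%N) (y ^+ (p ^ k)%N).
rewrite addrAC subrr add0r; apply: mgeMr => //.
  by rewrite mps_natE; exact: mge_const.
apply: mge_sum => // i _; apply: mgeMl => //; last by apply/X0/X0.
by apply: mgeMl => //; [exact: mge_nat|apply/X0/X0].
Qed.

Lemma mmap1_ge0 (y : 'I_m.+1 -> ser) k : (forall i, mge v 0 (y i)) -> mge v 0 (mmap1 y k).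
Proof.
move=> hy; apply: big_ind => [|x z hx hz|i _]; [exact: mge1|exact: mgeMl|exact: mge0X].
Qed.

Lemma subst_ge (N : int) y (g : mpol) : (forall i, mge v 0 (y i)) ->
  (N = 0 \/ N = 1) -> (forall k, vge v N g@_k) -> mge v N (subst sigma y g).
Proof.
move=> hy hN hg; rewrite /subst /mmap; apply: mge_sum => // k _.
apply: mgeMr => //; last exact: mmap1_ge0.
apply: mge_const; move: (hg k); case: hN => ->; [exact: sigma_ge0|exact: sigma_ge1].
Qed.

Lemma psi_ge (N : int) (g : mpol) : (N = 0 \/ N = 1) -> (forall k, vge v N g@_k) ->
  mge v N (mps_of (psi sigma q g)).
Proof.
move=> hN hg; rewrite mps_of_psi; apply: subst_ge => // i.
by apply: mge0X => //; exact: mge_X.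
Qed.

Lemma psi_frobenius (g : mpol) : poly_over (vring v) g ->
  mge v 1 (mps_of (psi sigma q g) - mps_of g ^+ q).
Proof.
pose D (g : mpol) := subst sigma (fun i => mps_of 'X_i ^+ q) g.
suff h : poly_over (vring v) g ->
  [/\ mge v 0 (mps_of g), mge v 0 (D g) & mge v 1 (D g - mps_of g ^+ q)].
  by rewrite mps_of_psi => /h[].
move: g; apply: poly_over_ind => [||c hc|i|g h [g1 g2 g3] [h1 h2 h3]|g h [g1 g2 g3] [h1 h2 h3]].
- by left.
- exact: vge1.
- have sc := sigma_ge0 hc; rewrite /D substC; split; try exact: mge_const.
  rewrite -rmorphXn -rmorphB -rmorphXn -mpolyCB; apply: mge_const.
  by apply/(vmaxE v)/hsigma.
- rewrite /D substX subrr; split; [exact: mge_X| |exact: mge0].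
  by apply: mge0X => //; exact: mge_X.
- rewrite /D substD rmorphD; split; [exact: mgeD|exact: mgeD|].
  have e (A B C E F : ser) : A + B - C = (A - E) + (B - F) - (C - (E + F)) by ring.
  rewrite (e _ _ _ (mps_of g ^+ q) (mps_of h ^+ q)).
  by apply: mgeB (mps_frobenius g1 h1) => //; apply: mgeD.
- rewrite /D substM rmorphM; split; [exact: mgeMl|exact: mgeMl|].
  rewrite exprMn.
  have -> : forall A B E F : ser, A * B - E * F = A * (B - F) + (A - E) * F.
    by move=> *; ring.
  by apply: mgeD => //; [exact: mgeMl|apply: mgeMr => //; exact: mge0X].
Qed.

Notation y0 := (fun i : 'I_m.+1 => mps_of ('X_i : mpol) ^+ q).

(** The remainder [R] is quadratic in [z]. As the entries of [z] are divisible by the uniformiser, a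
    product of two of them is controlled at one level more than [z], whence [k + 1]. The constant
    [B] depends on [g] only, so it survives the induction on the level. *)
Lemma taylor (g : mpol) : poly_over (vring v) g ->
  exists B : nat, forall (c : nat) (k be : int) (z : 'I_m.+1 -> ser),
  (0 < c)%N -> 0 <= be ->
  (forall i, pw v c be k (z i)) -> (forall i, mge v 1 (z i)) ->
  exists G1 R, [/\ subst sigma (fun i => y0 i + z i) g = subst sigma y0 g + G1 + R,
    G1 = \sum_i subst sigma y0 (mderiv i g) * z i,
    mge v 0 (subst sigma y0 g) /\ (forall k', pw v c (- B%:Z) k' (subst sigma y0 g)),
    mge v 1 G1 /\ pw v c (be - B%:Z) k G1
    & mge v 1 R /\ pw v c (be + be - B%:Z) (k + 1) R].
Proof.
move: g; apply: poly_over_ind => [||c0 hc|i|g h [B1 H1] [B2 H2]|g h [B1 H1] [B2 H2]].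
- by left.
- exact: vge1.
- exists 1%N => c k be z c_gt0 be0 hz hz1; exists 0, 0; rewrite !substC !addr0.
  have ge0 : mge v 0 (mps_of ((sigma c0)%:MP : mpol)) by apply/mge_const/sigma_ge0.
  split=> //.
  + by rewrite big1 // => j _; rewrite mderivC subst0 mul0r.
  + by split=> // k'; apply: pw_poly => //; rewrite msizeC; case: eqP.
  + by split; [exact: mge0|exact: pw0].
  + by split; [exact: mge0|exact: pw0].
- exists (msize ('X_i ^+ q : mpol)) => c k be z c_gt0 be0 hz hz1.
  exists (z i), 0; rewrite !substX addr0.
  have ge0 : mge v 0 (y0 i) by apply: mge0X => //; exact: mge_X.
  split=> //.
  + rewrite (bigD1 i) //= big1 ?addr0 => [|j ji].
      rewrite mderivX mnmE eqxx scale1r (_ : (U_(i) - U_(i))%MM = 0%MM) ?mpolyX0 ?subst1 ?mul1r //.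
      by apply/mnmP => l; rewrite mnmBE subnn mnm0E.
    by rewrite mderivX mnmE eq_sym (negPf ji) scale0r subst0 mul0r.
  + by split=> // k'; rewrite -rmorphXn; apply: pw_poly => //; rewrite rmorphXn.
  + by split=> //; apply: pw_le (hz i) => //; lia.
  + by split; [exact: mge0|exact: pw0].
- exists (B1 + B2)%N => c k be z c_gt0 be0 hz hz1.
  have [G1 [R1 [e1 d1 [a1 b1] [a2 b2] [a3 b3]]]] := H1 c k be z c_gt0 be0 hz hz1.
  have [G2 [R2 [e2 d2 [a4 b4] [a5 b5] [a6 b6]]]] := H2 c k be z c_gt0 be0 hz hz1.
  exists (G1 + G2), (R1 + R2); rewrite !substD e1 e2; split.
  + by ring.
  + by rewrite d1 d2 -big_split; apply: eq_bigr => i _; rewrite mderivD substD mulrDl.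
  + split; first exact: mgeD.
    by move=> k'; apply: pwD => //; [apply: pw_le (b1 k')|apply: pw_le (b4 k')] => //; lia.
  + split; first exact: mgeD.
    by apply: pwD => //; [apply: pw_le b2|apply: pw_le b5] => //; lia.
  + split; first exact: mgeD.
    by apply: pwD => //; [apply: pw_le b3|apply: pw_le b6] => //; lia.
exists (B1 + B2)%N => c k be z c_gt0 be0 hz hz1.
have [G1 [R1 [e1 d1 [a1 b1] [a2 b2] [a3 b3]]]] := H1 c k be z c_gt0 be0 hz hz1.
have [G2 [R2 [e2 d2 [a4 b4] [a5 b5] [a6 b6]]]] := H2 c k be z c_gt0 be0 hz hz1.
rewrite !substM e1 e2; set g0 := subst sigma y0 g in e1 a1 b1 *.
set h0 := subst sigma y0 h in e2 a4 b4 *.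
have w0 (x : ser) : mge v 1 x -> mge v 0 x by apply: mge_le.
exists (g0 * G2 + G1 * h0), (G1 * G2 + R1 * h0 + R1 * G2 + R1 * R2 + g0 * R2 + G1 * R2).
split.
- by ring.
- rewrite d1 d2 mulr_sumr mulr_suml -big_split; apply: eq_bigr => i _.
  by rewrite mderivM substD !substM -/g0 -/h0 /=; ring.
- split; first exact: mgeMl.
  move=> k'; have := pwM hv c_gt0 (k0 := k') a1 a4 _ _ (b1 k') (b4 k').
  by rewrite addr0 add0r => h'; apply: pw_le (h' _ _) => //; lia.
- split; first by apply: mgeD => //; [exact: mgeMl|exact: mgeMr].
  apply: pwD => //.
    have := pwM hv c_gt0 (k0 := k) a1 a5 _ _ (b1 k) b5.
    by rewrite add0r => h'; apply: pw_le (h' _ _) => //; lia.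
  have := pwM hv c_gt0 (k0 := k) a2 a4 _ _ b2 (b4 k).
  by rewrite addr0 => h'; apply: pw_le (h' _ _) => //; lia.
- split.
    do !(apply: mgeD => //); by [apply: mgeMl => //; exact: w0|apply: mgeMr => //; exact: w0].
  do !(apply: pwD => //).
  + have h' := pwM hv c_gt0 (k0 := k + 1) a2 a5 _ _ b2 b5; apply: pw_le (h' _ _) => //; lia.
  + have h' := pwM hv c_gt0 (k0 := k + 1) a3 a4 _ _ b3 (b4 k).
    by apply: pw_le (h' _ _) => //; lia.
  + have h' := pwM hv c_gt0 (k0 := k + 1) a3 a5 _ _ b3 b5; apply: pw_le (h' _ _) => //; lia.
  + have h' := pwM hv c_gt0 (k0 := k + 1) a3 a6 _ _ b3 b6; apply: pw_le (h' _ _) => //; lia.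
  + have h' := pwM hv c_gt0 (k0 := k + 1) a1 a6 _ _ (b1 (k + 1)) b6.
    by apply: pw_le (h' _ _) => //; lia.
  + have h' := pwM hv c_gt0 (k0 := k + 1) a2 a6 _ _ b2 b6; apply: pw_le (h' _ _) => //; lia.
Qed.

End Lift.

(** * Overconvergence of the solution and of the lift *)

Section LiftSolution.
Variables (K : fieldType) (v : K -> int) (hv : discrete_valuation v).
Variables (p : nat) (hp : prime p) (hvp : vge v 1 p%:R) (a : nat).
Notation q := (p ^ a)%N.
Variable sigma : {rmorphism K -> K}.
Hypothesis hsigma : forall c, vring v c -> vmax v (sigma c - c ^+ q).
Variables (m : nat) (f : 'I_m -> {mpoly K[m.+1]}).
Hypothesis hf : forall j, poly_over (vring v) (f j).
Variables (P : 'M[{mpoly K[m.+1]}]_(m.+1, m)) (Delta : 'I_m -> 'M[{mpoly K[m.+1]}]_m).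
Hypothesis hP : is_jacobian_inverse v f P Delta.
Variable S : 'cV[mps K m.+1]_m.
Hypothesis hS : is_lift_solution v sigma q f P Delta S.
Notation mpol := {mpoly K[m.+1]}.
Notation ser := (mps K m.+1).

Lemma lift_ge1 j : mge v 1 (S j 0).
Proof. by case: hS => h _ k; have [_ /(_ k) /(vmaxE v)] := h j. Qed.

Let H := jacobian f *m P - (1%:M + \sum_l f l *: Delta l).

Let cpsi : {rmorphism mpol -> ser} :=
  @mps_of K m.+1 \o mmap (@mpolyC m.+1 K \o sigma) (fun i => 'X_i ^+ q).

Let psi_mxE r s (A : 'M[mpol]_(r, s)) : psi_mx sigma q A = map_mx cpsi A.
Proof. by []. Qed.

Let z i := (psi_mx sigma q P *m S) i 0.
Notation y0 := (fun i : 'I_m.+1 => mps_of ('X_i : mpol) ^+ q).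

Let lift_pointE i : lift_point sigma q P S i = y0 i + z i.
Proof. by rewrite /lift_point psiX rmorphXn. Qed.

(* The equation for [S] in fixed point form, the nonlinear part being [R]. *)
Let fixed_point j R G1 :
  subst sigma (fun i => y0 i + z i) (f j) = subst sigma y0 (f j) + G1 + R ->
  G1 = \sum_i subst sigma y0 (mderiv i (f j)) * z i ->
  S j 0 = - (mps_of (psi sigma q (f j) - f j ^+ q)
    + \sum_l mps_of (psi sigma q (f l) - f l ^+ q) * (psi_mx sigma q (Delta l) *m S) j 0
    + (psi_mx sigma q H *m S) j 0 + R).
Proof.
move=> e1 e2; have [_ /(_ j)] := hS.
have -> : subst sigma (lift_point sigma q P S) (f j) = subst sigma y0 (f j) + G1 + R.
  by rewrite -e1; congr (subst sigma _ _); apply/funext => i; rewrite lift_pointE.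
have eG : G1 = (psi_mx sigma q H *m S) j 0 + S j 0 +
    \sum_l mps_of (psi sigma q (f l)) * (psi_mx sigma q (Delta l) *m S) j 0.
  rewrite e2.
  have -> : \sum_i subst sigma y0 (mderiv i (f j)) * z i =
      (psi_mx sigma q (jacobian f *m P) *m S) j 0.
    rewrite psi_mxE map_mxM -mulmxA [RHS]mxE; apply: eq_bigr => i _.
    by rewrite mxE [jacobian f j i]mxE -mps_of_psi.
  have -> : jacobian f *m P = H + (1%:M + \sum_l f l *: Delta l) by rewrite subrK.
  rewrite !psi_mxE map_mxD [map_mx cpsi (1%:M + _)]map_mxD map_mx1 mulmxDl mulmxDl mul1mx mxE -addrA.
  congr (_ + _); rewrite mxE; congr (_ + _).
  rewrite raddf_sum mulmx_suml summxE; apply: eq_bigr => l _.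
  by rewrite /= map_mxZ -scalemxAl mxE.
rewrite eG -mps_of_psi => e; rewrite !rmorphB !rmorphXn.
have -> : \sum_l mps_of (psi sigma q (f l) - f l ^+ q) * (psi_mx sigma q (Delta l) *m S) j 0
  = \sum_l mps_of (psi sigma q (f l)) * (psi_mx sigma q (Delta l) *m S) j 0
    - \sum_l mps_of (f l) ^+ q * (psi_mx sigma q (Delta l) *m S) j 0.
  by rewrite -sumrB; apply: eq_bigr => l _; rewrite rmorphB rmorphXn mulrBl.
apply/eqP; rewrite -subr_eq0; apply/eqP; rewrite -[RHS]e; ring.
Qed.

(** Induction on the level with slope and shift fixed in advance. In the fixed point form, every
    occurrence of [S] comes with a further factor divisible by the uniformiser or sits in the
    quadratic remainder, so control at level [k] gives control at level [k + 1]. *)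
Lemma lift_dagger j : dagger v (S j 0).
Proof.
have [hP0 hD0 hH0] := hP.
have P0 i l k : vge v 0 (P i l)@_k by exact: hP0.
have D0 l i i' k : vge v 0 (Delta l i i')@_k by exact: hD0.
have H0 i l k : vge v 1 (H i l)@_k by apply/(vmaxE v); exact: hH0.
have /choice[Bf hBf] : forall j, exists B : nat, forall (c : nat) (k be : int)
    (z : 'I_m.+1 -> ser), (0 < c)%N -> 0 <= be ->
    (forall i, pw v c be k (z i)) -> (forall i, mge v 1 (z i)) ->
    exists G1 R, [/\ subst sigma (fun i => y0 i + z i) (f j) = subst sigma y0 (f j) + G1 + R,
    G1 = \sum_i subst sigma y0 (mderiv i (f j)) * z i,
    mge v 0 (subst sigma y0 (f j)) /\ (forall k', pw v c (- B%:Z) k' (subst sigma y0 (f j))),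
    mge v 1 G1 /\ pw v c (be - B%:Z) k G1
    & mge v 1 R /\ pw v c (be + be - B%:Z) (k + 1) R].
  by move=> l; exact: (taylor hv hp hsigma (hf l)).
pose B := (\max_l Bf l + \max_il msize (psi sigma q (P il.1 il.2)) +
  \max_il msize (psi sigma q (H il.1 il.2)) +
  \max_(l : 'I_m * 'I_m * 'I_m) msize (psi sigma q (Delta l.1.1 l.1.2 l.2)) +
  \max_l msize (psi sigma q (f l) - f l ^+ q))%N.
have BP i l : (msize (psi sigma q (P i l)) <= B)%N.
  have := leq_bigmax (F := fun il => msize (psi sigma q (P il.1 il.2))) (i, l).
  by rewrite /B /=; lia.
have BH i l : (msize (psi sigma q (H i l)) <= B)%N.
  have := leq_bigmax (F := fun il => msize (psi sigma q (H il.1 il.2))) (i, l).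
  by rewrite /B /=; lia.
have BD l i i' : (msize (psi sigma q (Delta l i i')) <= B)%N.
  have := leq_bigmax (F := fun l => msize (psi sigma q (Delta l.1.1 l.1.2 l.2))) (l, i, i').
  by rewrite /B /=; lia.
have BE l : (msize (psi sigma q (f l) - f l ^+ q) <= B)%N.
  have := leq_bigmax (F := fun l => msize (psi sigma q (f l) - f l ^+ q)) l.
  by rewrite /B /=; lia.
have BB l : (Bf l <= B)%N by have := leq_bigmax (F := Bf) l; rewrite /B /=; lia.
(* The shift al = 3 B satisfies 2 (al - B) - B >= al, as the quadratic remainder requires, and the
   slope satisfies c - B >= al, as the term without [S] requires. *)
pose c := (4 * B).+1; have c_gt0 : (0 < c)%N by [].
pose al : int := (3 * B)%N%:Z.
suff h (k : nat) : forall j, pw v c al k%:Z (S j 0).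
  apply/daggerP; split; first by apply: mge_le (lift_ge1 j).
  exists c, 0%N; split=> // k; apply: pw_le (h `|k|%N j); rewrite /al; lia.
elim: k => [|k IH] l.
  by move=> k' l' hl _; apply: vge_le (lift_ge1 l k'); lia.
have poly0 (A : mpol) k' : (msize (psi sigma q A) <= B)%N -> (forall k, vge v 0 A@_k) ->
    pw v c (- B%:Z) k' (mps_of (psi sigma q A)) /\ mge v 0 (mps_of (psi sigma q A)).
  move=> hB hA; have h0 : mge v 0 (mps_of (psi sigma q A)) by apply: psi_ge => //; left.
  by split=> //; exact: pw_poly.
have z1 i : mge v 1 (z i).
  rewrite /z mxE; apply: mge_sum => // l' _; apply: mgeMl => //; last exact: lift_ge1.
  by rewrite mxE; exact: (poly0 _ 0 (BP i l') (P0 i l')).2.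
have wz i : pw v c (al - B%:Z) k%:Z (z i).
  rewrite /z mxE; apply: pw_sum => // l' _; rewrite mxE.
  have [h1 h2] := poly0 _ k%:Z (BP i l') (P0 i l').
  have := pwM hv c_gt0 (k0 := k%:Z) h2 (lift_ge1 l') _ _ h1 (IH l').
  by rewrite add0r => h'; apply: pw_le (h' _ _) => //; lia.
have be0 : 0 <= al - B%:Z by rewrite /al; lia.
have [G1 [R [e1 e2 _ _ [R1 wR]]]] := hBf l c k%:Z (al - B%:Z) z c_gt0 be0 wz z1.
have E1 l' : mge v 1 (mps_of (psi sigma q (f l') - f l' ^+ q)).
  by rewrite rmorphB rmorphXn; exact: (psi_frobenius hv hp hvp hsigma (hf l')).
rewrite (fixed_point e1 e2); apply: pwN => //; do !(apply: pwD => //).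
- apply: pw_le (pw_poly1 c_gt0 (BE l) (E1 l)) => //; rewrite /al /c; lia.
- apply: pw_sum => // l' _.
  have w1 := pw_poly1 c_gt0 (k := k%:Z) (BE l') (E1 l').
  have s1 : mge v 1 ((psi_mx sigma q (Delta l') *m S) l 0).
    rewrite mxE; apply: mge_sum => // i _; apply: mgeMl => //; last exact: lift_ge1.
    by rewrite mxE; exact: (poly0 _ 0 (BD l' l i) (D0 l' l i)).2.
  have w2 : pw v c (al - B%:Z) k%:Z ((psi_mx sigma q (Delta l') *m S) l 0).
    rewrite mxE; apply: pw_sum => // i _; rewrite mxE.
    have [h1 h2] := poly0 _ k%:Z (BD l' l i) (D0 l' l i).
    have := pwM hv c_gt0 (k0 := k%:Z) h2 (lift_ge1 i) _ _ h1 (IH i).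
    by rewrite add0r => h'; apply: pw_le (h' _ _) => //; lia.
  have h' := pwM hv c_gt0 (k0 := k.+1%:Z) (E1 l') s1 _ _ w1 w2.
  by apply: pw_le (h' _ _) => //; rewrite /al /c; lia.
- rewrite mxE; apply: pw_sum => // i _; rewrite mxE.
  have h1 : mge v 1 (mps_of (psi sigma q (H l i))) by apply: psi_ge => //; right.
  have w1 := pw_poly1 c_gt0 (k := k%:Z) (BH l i) h1.
  have h' := pwM hv c_gt0 (k0 := k.+1%:Z) h1 (lift_ge1 i) _ _ w1 (IH i).
  by apply: pw_le (h' _ _) => //; rewrite /al /c; lia.
- by apply: pw_le wR; rewrite /al; have := BB l; lia.
Qed.

Lemma lift_point_dagger i : dagger v (lift_point sigma q P S i).
Proof.
have [hP0 _ _] := hP.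
rewrite lift_pointE; apply: daggerD => //.
  by apply: daggerX => //; apply: dagger_poly => //; exact: mge_X.
rewrite /z mxE; apply: dagger_sum => // l _; rewrite mxE; apply: daggerM => //.
  by apply: dagger_poly => //; apply: psi_ge => //; [left|exact: hP0].
exact: lift_dagger.
Qed.

Lemma phi_dagger g : poly_over (vring v) g -> dagger v (phi sigma q P S g).
Proof.
move: g; apply: poly_over_ind => [||c hc|i|g h hg hh|g h hg hh]; rewrite /phi.
- by left.
- exact: vge1.
- by rewrite substC; apply: dagger_const => //; exact: (sigma_ge0 hv hsigma).
- by rewrite substX; exact: lift_point_dagger.
- by rewrite substD; exact: daggerD.
- by rewrite substM; exact: daggerM.
Qed.

(** This puts phi(f_j) into the ideal generated by the f_l, so that the expansion of the lift also
    factors through A. *)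
Lemma phi_equation j : phi sigma q P S (f j) = \sum_l mps_of (f l) *
  (mps_of (f l) ^+ q.-1 * ((l == j)%:R + (psi_mx sigma q (Delta l) *m S) j 0)).
Proof.
have [_ /(_ j) e] := hS; have q0 : (0 < q)%N by rewrite expn_gt0 prime_gt0.
have -> : phi sigma q P S (f j) = mps_of (f j) ^+ q +
    \sum_l mps_of (f l) ^+ q * (psi_mx sigma q (Delta l) *m S) j 0.
  by apply/eqP; rewrite -subr_eq0; apply/eqP; rewrite -[RHS]e /phi; ring.
under [RHS]eq_bigr do rewrite mulrA -exprS prednK // mulrDr.
rewrite big_split /=; congr (_ + _).
rewrite (bigD1 j) //= eqxx mulr1 big1 ?addr0 // => l /negPf ->.
by rewrite mulr0.
Qed.

Lemma equation_dagger j l : dagger v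
  (mps_of (f l) ^+ q.-1 * ((l == j)%:R + (psi_mx sigma q (Delta l) *m S) j 0)).
Proof.
have [_ hD _] := hP; apply: daggerM => //.
  by apply: daggerX => //; apply: dagger_poly => //; exact: hf.
apply: daggerD => //.
  by case: (l == j); [exact: dagger1|exact: dagger0].
rewrite mxE; apply: dagger_sum => // i _; rewrite mxE; apply: daggerM => //.
  by apply: dagger_poly => //; apply: psi_ge => //; [left|exact: hD].
exact: lift_dagger.
Qed.

(** The correction remains overconvergent after division by the uniformiser, so that [xi] may be
    applied to the quotient. *)
Lemma lift_point_close (x : K) i : v x = 1 -> x != 0 ->
  exists2 b, dagger v b & lift_point sigma q P S i = mps_of 'X_i ^+ q + mps_of x%:MP * b.
Proof.
move=> vx x0; rewrite lift_pointE; have [hP0 _ _] := hP.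
have [||b hb e] := @dagger_divide _ _ hv _ x (z i) vx x0.
- rewrite /z mxE; apply: dagger_sum => // l _; rewrite mxE; apply: daggerM => //.
    by apply: dagger_poly => //; apply: psi_ge => //; [left|exact: hP0].
  exact: lift_dagger.
- rewrite /z mxE; apply: mge_sum => // l _; apply: mgeMl => //; last exact: lift_ge1.
  by rewrite mxE; apply: psi_ge => //; [left|exact: hP0].
by exists b => //; rewrite -e.
Qed.

End LiftSolution.

(** * Local rings and base change *)

Section Submodules.
Variable R : comNzRingType.
Implicit Types (S G J : set R).

Definition submod S J := [/\ J 0, forall x y, J x -> J y -> J (x + y)
  & forall s x, S s -> J x -> J (s * x)].
Definition sspan S G : set R := [set x | forall J, submod S J -> G `<=` J -> J x].

Lemma sspan_submod S G : submod S (sspan S G).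
Proof.
split=> [J [J0 _ _] //|x y hx hy J hJ hG|s x hs hx J hJ hG].
  by have [_ JD _] := hJ; apply: (JD); [exact: hx|exact: hy].
by have [_ _ JM] := hJ; apply: (JM) => //; exact: hx.
Qed.
Lemma sspan_gen S G x : G x -> sspan S G x.
Proof. by move=> h J _; exact. Qed.
Lemma sspan_sub S G G' x : G `<=` sspan S G' -> sspan S G x -> sspan S G' x.
Proof. by move=> h hx; apply: hx => //; exact: sspan_submod. Qed.

(** Equivalent to the ascending chain condition, in the form in which it is applied to sequences
    constructed in the proofs. *)
Definition noetherian S := forall a : nat -> R, (forall n, S (a n)) ->
  exists n, sspan S [set x | exists2 i, (i < n)%N & x = a i] (a n).

End Submodules.

(** * The Hilbert basis theorem *)

Section Hilbert.
Variables (T : fieldType) (S : set T) (hS : is_subring S).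
Hypothesis noethS : noetherian S.

Let S1 : S 1. Proof. by case: hS. Qed.
Let SB a b : S a -> S b -> S (a - b). Proof. by case: hS => _ h _; exact: h. Qed.
Let SM a b : S a -> S b -> S (a * b). Proof. by case: hS => _ _ h; exact: h. Qed.
Let S0 : S 0. Proof. by rewrite -(subrr 1); exact: SB. Qed.
Let SN a : S a -> S (- a). Proof. by move=> h; rewrite -sub0r; exact: SB. Qed.
Let SD a b : S a -> S b -> S (a + b).
Proof. by move=> ha hb; rewrite -[b]opprK; apply: SB => //; exact: SN. Qed.
Let Ssum (I : Type) (r : seq I) (P : pred I) (G : I -> T) :
  (forall i, P i -> S (G i)) -> S (\sum_(i <- r | P i) G i).
Proof. by move=> h; apply: big_ind => //; exact: SD. Qed.

Definition polyS : set {poly T} := [set p | forall i, S p`_i].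

Let pS0 : polyS 0. Proof. by move=> i; rewrite coef0. Qed.
Let pS1 : polyS 1. Proof. by move=> i; rewrite coef1; case: eqP. Qed.
Let pSD p q : polyS p -> polyS q -> polyS (p + q).
Proof. by move=> hp hq i; rewrite coefD; exact: SD. Qed.
Let pSN p : polyS p -> polyS (- p).
Proof. by move=> hp i; rewrite coefN; exact: SN. Qed.
Let pSM p q : polyS p -> polyS q -> polyS (p * q).
Proof. by move=> hp hq i; rewrite coefM; apply: Ssum => j _; exact: SM. Qed.
Let pSXn n : polyS 'X^n. Proof. by move=> i; rewrite coefXn; case: eqP. Qed.
Let pSC c : S c -> polyS c%:P.
Proof. by move=> hc i; rewrite coefC; case: eqP. Qed.

(** Choose successively elements of least degree in the ideal outside the span of those chosen
    before. By the chain condition for leading coefficients, some [q k] can be reduced to smaller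
    degree by a combination of its predecessors, contrary to minimality. *)
Lemma hilbert_basis : noetherian polyS.
Proof.
move=> p hp; apply: contrapT => /forallNP np.
pose I := sspan polyS [set x | exists i, x = p i].
have hI : submod polyS I by exact: sspan_submod.
have [I0 ID IM] := hI.
have ISp x : I x -> polyS x.
  by move=> h; apply: (h polyS) => [|_ [i ->]] //; split.
have Ifin x : I x -> exists N, sspan polyS [set x | exists2 i, (i < N)%N & x = p i] x.
  have mono N N' z : (N <= N')%N -> sspan polyS [set x | exists2 i, (i < N)%N & x = p i] z ->
      sspan polyS [set x | exists2 i, (i < N')%N & x = p i] z.
    move=> le; apply: sspan_sub => _ [i lt ->]; apply: sspan_gen; exists i => //.
    exact: leq_trans le.
  move=> h0; apply: (h0 [set x | exists N, sspan polyS
    [set x | exists2 i, (i < N)%N & x = p i] x]) => [|_ [i ->]]; last first.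
    by exists i.+1; apply: sspan_gen; exists i.
  split=> [|z z' [N h] [N' h']|s z hs [N h]].
  - by exists 0%N; case: (sspan_submod polyS [set x | exists2 i, (i < 0)%N & x = p i]).
  - exists (maxn N N').
    have [_ hD _] := sspan_submod polyS [set x | exists2 i, (i < maxn N N')%N & x = p i].
    by apply: (hD); [apply: mono h; rewrite leq_maxl|apply: mono h'; rewrite leq_maxr].
  - exists N; have [_ _ hM] := sspan_submod polyS [set x | exists2 i, (i < N)%N & x = p i].
    exact: hM.
have Ifin_seq (qs : seq {poly T}) : (forall z, z \in qs -> I z) -> exists N, forall z,
    z \in qs -> sspan polyS [set x | exists2 i, (i < N)%N & x = p i] z.
  elim: qs => [|z qs IH] hq; first by exists 0%N.
  have [|N hN] := IH; first by move=> z' hz'; apply: hq; rewrite inE hz' orbT.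
  have [N' hN'] := Ifin z (hq _ (mem_head _ _)).
  exists (maxn N N') => z'; rewrite inE => /orP[/eqP->|/hN h].
    apply: sspan_sub hN' => _ [i lt ->]; apply: sspan_gen; exists i => //.
    by apply: leq_trans lt _; rewrite leq_maxr.
  apply: sspan_sub h => _ [i lt ->]; apply: sspan_gen; exists i => //.
  by apply: leq_trans lt _; rewrite leq_maxl.
have next (qs : seq {poly T}) : exists x, (forall z, z \in qs -> I z) ->
    [/\ I x, ~ sspan polyS [set` qs] x &
    forall z, I z -> ~ sspan polyS [set` qs] z -> (size x <= size z)%N].
  have [hq|nq] := EM (forall z, z \in qs -> I z); last by exists 0.
  pose Q n := `[< exists z, [/\ I z, ~ sspan polyS [set` qs] z & size z = n] >].
  have exQ : exists n, Q n.
    apply: contrapT => nQ.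
    have sub z : I z -> sspan polyS [set` qs] z.
      move=> hz; apply: contrapT => nz; apply: nQ; exists (size z).
      by apply/asboolP; exists z.
    have [N hN] := Ifin_seq qs hq.
    apply: (np N); apply: sspan_sub (sub (p N) _); first by move=> z; exact: hN.
    by apply: sspan_gen; exists N.
  case: (ex_minnP exQ) => n /asboolP[z [h1 h2 h3]] hn; exists z => _; split=> // z' k1 k2.
  by rewrite h3; apply: hn; apply/asboolP; exists z'.
have /choice[nxt hnxt] := next.
pose fix qs n : seq {poly T} := if n is k.+1 then nxt (qs k) :: qs k else [::].
pose q n := nxt (qs n).
have qsS n : qs n.+1 = q n :: qs n by [].
have mem_qs n z : z \in qs n <-> exists2 i, (i < n)%N & z = q i.
  elim: n z => [|n IH] z; first by split=> // -[].
  rewrite qsS inE; split=> [/orP[/eqP->|]|[i]].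
  - by exists n.
  - by move=> /(IH z).1[i lt ->]; exists i => //; exact: ltnW.
  rewrite ltnS leq_eqVlt => /orP[/eqP-> ->|lt ->]; first by rewrite eqxx.
  by apply/orP; right; apply: (IH _).2; exists i.
have Iqs n z : z \in qs n -> I z.
  elim: n z => // n IH z; rewrite qsS inE => /orP[/eqP->|/IH //].
  by have [] := hnxt (qs n) IH.
have hq n := hnxt (qs n) (Iqs n).
have le_size i k : (i <= k)%N -> (size (q i) <= size (q k))%N.
  move=> le; have [_ _ hmin] := hq i; have [Ik nk _] := hq k; apply: hmin => // h.
  apply: nk; apply: sspan_sub h => z /= /mem_qs[j lt ->]; apply: sspan_gen.
  by apply/mem_qs; exists j => //; exact: leq_trans le.
have q0 k : q k != 0.
  apply/eqP => e; have [_ nk _] := hq k; apply: nk; rewrite -/(q k) e.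
  by case: (sspan_submod polyS [set` qs k]).
have [|k hk] := @noethS (fun n => lead_coef (q n)).
  by move=> n; have [/ISp h _ _] := hq n; exact: h.
have [Ik nk hmin] := hq k; rewrite -/(q k) in Ik nk hmin.
pose sp := sspan polyS [set` qs k].
have [sp0 spD spM] : submod polyS sp by exact: sspan_submod.
(* The relation between leading coefficients lifts to the [q i]: their degrees increase with the
   index, so powers of the variable bring all of them to the degree of [q k]. *)
have [u [hu1 hu2 hu3]] : exists u, [/\ sp u, (size u <= size (q k))%N
    & u`_(size (q k)).-1 = lead_coef (q k)].
  apply: (hk [set l | exists u, [/\ sp u, (size u <= size (q k))%N
    & u`_(size (q k)).-1 = l]]) => [|_ [i lt ->]].
    split=> [|l l' [u [h1 h2 h3]] [u' [h1' h2' h3']]|s l hs [u [h1 h2 h3]]].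
    - by exists 0; rewrite size_poly0 coef0; split.
    - exists (u + u'); rewrite coefD h3 h3'; split=> //; first exact: spD.
      by apply: leq_trans (size_polyD _ _) _; rewrite geq_max h2.
    - exists (s%:P * u); rewrite coefCM h3; split=> //; first by apply: (spM) => //; exact: pSC.
      by rewrite mul_polyC; apply: leq_trans (size_scale_leq _ _) _.
  have le := le_size i k (ltnW lt).
  exists ('X^(size (q k) - size (q i)) * q i); split.
  - by apply: (spM) => //; apply: sspan_gen; apply/mem_qs; exists i.
  - by rewrite mulrC size_mulXn // subnK.
  rewrite coefXnM lead_coefE; have := q0 i; rewrite -size_poly_gt0 => s0.
  by case: ltnP => h; [lia|congr (_ `_ _); lia].
have Iu : I u.
  by apply: (hu1 I) => // z; exact: (Iqs k).
have hd : I (q k - u) by apply: (ID) => //; rewrite -mulN1r; apply: (IM) => //; exact: pSN.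
have nd : ~ sp (q k - u) by move=> h; apply: nk; have := spD _ _ h hu1; rewrite subrK.
have := hmin _ hd nd; apply/negP; rewrite -ltnNge.
have sk : (0 < size (q k))%N by rewrite size_poly_gt0.
rewrite -(prednK sk) ltnS; apply/leq_sizeP => j.
rewrite leq_eqVlt => /orP[/eqP<-|lt]; first by rewrite coefB hu3 lead_coefE subrr.
by rewrite coefB !nth_default ?subrr //; [apply: leq_trans hu2 _|]; rewrite -(prednK sk).
Qed.

Definition adjoin (y : T) : set T := [set x | exists2 p, polyS p & x = p.[y]].

Lemma adjoin_subring y : is_subring (adjoin y).
Proof.
split=> [|_ _ [p hp ->] [q hq ->]|_ _ [p hp ->] [q hq ->]].
- by exists 1 => //; rewrite hornerC.
- by exists (p - q); rewrite ?hornerD ?hornerN //; apply: pSD => //; exact: pSN.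
- by exists (p * q); rewrite ?hornerM //; exact: pSM.
Qed.

Lemma adjoin_sub y : S `<=` adjoin y.
Proof. by move=> c hc; exists c%:P; [exact: pSC|rewrite hornerC]. Qed.

Lemma adjoin_gen y : adjoin y y.
Proof. by exists 'X; [exact: (pSXn 1)|rewrite hornerX]. Qed.

Lemma adjoin_noetherian y : noetherian (adjoin y).
Proof.
move=> a ha; have /choice[p hp] : forall n, exists p, polyS p /\ a n = p.[y].
  by move=> n; have [p] := ha n; exists p.
have [n hn] := hilbert_basis (fun n => (hp n).1); exists n.
pose G := [set x | exists2 i, (i < n)%N & x = a i].
have [G0 GD GM] := sspan_submod (adjoin y) G.
rewrite (hp n).2; apply: (hn [set q | sspan (adjoin y) G q.[y]]) => [|_ [i lt ->] /=].
  split=> [|q r /= h1 h2|q r hq h] /=; first by rewrite horner0.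
    by rewrite hornerD; exact: GD.
  by rewrite hornerM; apply: (GM) => //; exists q.
by rewrite -(hp i).2; apply: sspan_gen; exists i.
Qed.

End Hilbert.

(** * Localisations and Krull's intersection theorem *)

Section Localisation.
Variables (F : fieldType) (A : set F) (hA : is_subring A) (I : set F).
Hypothesis hI : is_prime_ideal A I.

Lemma prime_neq0 b : ~ I b -> b != 0.
Proof. by case: hI => -[_ I0 _] _ nb; apply/eqP => e; apply: nb; rewrite e. Qed.

Let O := localisation A I.

Lemma loc_in a : A a -> O a.
Proof.
by move=> ha; case: hI => -[_ _ n1] _; case: hA => A1 _ _; exists a, 1; rewrite divr1.
Qed.

Lemma loc_inv a : A a -> ~ I a -> O a^-1.
Proof. by move=> ha na; case: hA => A1 _ _; exists 1, a; rewrite mul1r. Qed.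

Let nIM b b' : A b -> A b' -> ~ I b -> ~ I b' -> ~ I (b * b').
Proof. by move=> hb hb' nb nb' h; case: hI => _ [_ _ /(_ _ _ hb hb' h)[]]. Qed.

Lemma loc_subring : is_subring O.
Proof.
have [A1 AB AM] := hA; split; first exact: loc_in.
  move=> _ _ [a [b [ha hb nb ->]]] [a' [b' [ha' hb' nb' ->]]].
  exists (a * b' - a' * b), (b * b'); split; [|exact: AM|exact: nIM|].
    by apply: AB; apply: AM.
  by rewrite -mulNr addf_div ?prime_neq0 // mulNr.
move=> _ _ [a [b [ha hb nb ->]]] [a' [b' [ha' hb' nb' ->]]].
exists (a * a'), (b * b'); split; [exact: AM|exact: AM|exact: nIM|].
by rewrite mulf_div.
Qed.

Lemma loc_maxideal a : A a -> I a -> maxideal O a.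
Proof.
move=> ha Ia; split; first exact: loc_in.
have [->|a0] := eqVneq a 0; first by left.
right=> -[b [c [hb hc nc e]]]; apply: (nc).
have -> : c = b * a by apply: (mulIf (invr_neq0 a0)); rewrite mulfK // e mulrC divfK ?prime_neq0.
by case: hI => _ [_ IM _]; exact: IM.
Qed.

Lemma loc_maxP z : O z -> (maxideal O z <-> exists a b, [/\ I a, A b, ~ I b & z = a / b]).
Proof.
move=> hz; split=> [[_ hm]|[a [b [ha hb nb ->]]]].
  have [a [b [ha hb nb e]]] := hz; exists a, b; split=> //.
  apply: contrapT => na; case: hm => [z0|]; last first.
    by apply; rewrite e invf_div; exists b, a.
  move: na; have -> : a = 0.
    by move: e; rewrite z0 => /esym/eqP; rewrite mulf_eq0 invr_eq0 (negPf (prime_neq0 nb)) orbF => /eqP.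
  by case: hI => -[_ I0 _].
have Aa : A a by case: hI => -[IA _ _] _; exact: IA.
have [A1 _ AM] := hA; have [_ _ OM] := loc_subring.
have [_ hm] := loc_maxideal Aa ha; split; first by exists a, b.
case: hm => [->|hm]; first by left; rewrite mul0r.
right=> h; apply: hm; have [a0|a0] := eqVneq a 0.
  by rewrite a0 invr0; apply: loc_in; case: hA => A1' AB _; rewrite -(subrr 1); exact: AB.
have -> : a^-1 = (a / b)^-1 * b^-1 by rewrite invf_div mulrAC divff ?mul1r ?prime_neq0.
by apply: OM => //; exact: loc_inv.
Qed.

(** Write c / t^N = a_N / b_N. If a_(n+1) is a combination of a_0, ..., a_n, then its quotient by d
    = c / t^n lies in O, because a_i / d = b_i t^(n-i). But this quotient is b_(n+1) / t with
    b_(n+1) a unit of O, so t would be invertible. *)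
Lemma krull_intersection (t c : F) : noetherian A -> O t -> t != 0 -> ~ O t^-1 ->
  (forall N : nat, O (c / t ^+ N)) -> c = 0.
Proof.
move=> hn ht t0 nt hc; apply: contrapT => /eqP c0.
have [O1 OB OM] := loc_subring.
have O0 : O 0 by rewrite -(subrr 1); exact: OB.
have OD x y : O x -> O y -> O (x + y).
  by move=> hx hy; rewrite -[y]opprK; apply: (OB) => //; rewrite -sub0r; exact: OB.
have OX k : O (t ^+ k) by elim: k => [//|k IH]; rewrite exprS; exact: OM.
have /choice[a ha] : forall N, exists a, exists2 b, [/\ A a, A b & ~ I b] & c / t ^+ N = a / b.
  by move=> N; have [a [b [h1 h2 h3 h4]]] := hc N; exists a, b.
have [|n hn'] := hn a; first by move=> n; have [b []] := ha n.
have [b [Aan Ab nb] e] := ha n.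
have aE : a n = c / t ^+ n * b by rewrite e divfK // prime_neq0.
case: n => [|n] in hn' b Aan Ab nb e aE *.
  have : a 0%N = 0.
    by apply: (hn' [set 0]) => [|_ [i] //]; split=> //= [x y -> ->|s x _ ->];
      rewrite ?addr0 ?mulr0.
  rewrite aE expr0 divr1 => /eqP; rewrite mulf_eq0 (negPf c0) => /eqP b0.
  by move/eqP: (prime_neq0 nb); rewrite b0.
apply: nt; pose d := c / t ^+ n.
have d0 : d != 0 by rewrite mulf_neq0 // invr_neq0 // expf_neq0.
have h : O (a n.+1 / d).
  apply: (hn' [set x | O (x / d)]) => [|_ [i lt ->] /=].
    split=> [|x y /= hx hy|s x hs hx] /=; first by rewrite mul0r.
      by rewrite mulrDl; exact: OD.
    by rewrite -mulrA; apply: OM => //; exact: loc_in.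
  have [bi [Ai Abi nbi] ei] := ha i.
  have -> : a i / d = bi * t ^+ (n - i).
    have -> : a i = c / t ^+ i * bi by rewrite ei divfK // prime_neq0.
    rewrite /d; have -> : t ^+ n = t ^+ i * t ^+ (n - i) by rewrite -exprD subnKC.
    by field; rewrite c0 !expf_neq0.
  by apply: OM => //; exact: loc_in.
have -> : t^-1 = a n.+1 / d * b^-1.
  by rewrite aE /d exprS; field; rewrite c0 t0 expf_neq0 // prime_neq0.
by apply: OM => //; exact: loc_inv.
Qed.

End Localisation.

Section PolyOver.
Variables (K : fieldType) (v : K -> int) (hv : discrete_valuation v) (n : nat).
Implicit Types (g h : {mpoly K[n]}).

Lemma poly_over_mge g : poly_over (vring v) g <-> mge v 0 (mps_of g).
Proof. by []. Qed.
Lemma poly_overD g h : poly_over (vring v) g -> poly_over (vring v) h -> poly_over (vring v) (g + h).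
Proof. by move=> hg hh k; rewrite mcoeffD; apply: vgeD => //; [exact: hg|exact: hh]. Qed.
Lemma poly_overN g : poly_over (vring v) g -> poly_over (vring v) (- g).
Proof. by move=> hg k; rewrite mcoeffN; apply: vgeN => //; exact: hg. Qed.
Lemma poly_overB g h : poly_over (vring v) g -> poly_over (vring v) h -> poly_over (vring v) (g - h).
Proof. by move=> hg hh; apply: poly_overD => //; exact: poly_overN. Qed.
Lemma poly_overM g h : poly_over (vring v) g -> poly_over (vring v) h -> poly_over (vring v) (g * h).
Proof.
move=> hg hh; apply/poly_over_mge; rewrite rmorphM; apply: mgeMl => //.
Qed.
Lemma poly_overC c : vring v c -> poly_over (vring v) (c%:MP : {mpoly K[n]}).
Proof. by move=> hc; apply/poly_over_mge; apply: mge_const. Qed.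
Lemma poly_overX i : poly_over (vring v) ('X_i : {mpoly K[n]}).
Proof. by apply/poly_over_mge; exact: mge_X. Qed.
Lemma poly_over0 : poly_over (vring v) (0 : {mpoly K[n]}).
Proof. by rewrite -mpolyC0; apply: poly_overC; left. Qed.
Lemma poly_over1 : poly_over (vring v) (1 : {mpoly K[n]}).
Proof. by rewrite -mpolyC1; apply: poly_overC; exact: vge1. Qed.
Lemma poly_over_sum I (r : seq I) (P : pred I) (G : I -> {mpoly K[n]}) :
  (forall i, P i -> poly_over (vring v) (G i)) ->
  poly_over (vring v) (\sum_(i <- r | P i) G i).
Proof. by move=> h; apply: big_ind => //; [exact: poly_over0|exact: poly_overD]. Qed.
Lemma poly_over_prod I (r : seq I) (P : pred I) (G : I -> {mpoly K[n]}) :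
  (forall i, P i -> poly_over (vring v) (G i)) ->
  poly_over (vring v) (\prod_(i <- r | P i) G i).
Proof. by move=> h; apply: big_ind => //; [exact: poly_over1|exact: poly_overM]. Qed.
Lemma poly_over_deriv i g : poly_over (vring v) g -> poly_over (vring v) (mderiv i g).
Proof.
move=> hg k; rewrite mcoeff_deriv -mulr_natr; apply: vgeMr => //; first exact: hg.
exact: vge_nat.
Qed.

End PolyOver.

Section Subrings.
Variables (F : fieldType) (S : set F) (hS : is_subring S).
Lemma sub1 : S 1. Proof. by case: hS. Qed.
Lemma subB a b : S a -> S b -> S (a - b). Proof. by case: hS => _ h _; exact: h. Qed.
Lemma subM a b : S a -> S b -> S (a * b). Proof. by case: hS => _ _ h; exact: h. Qed.
Lemma sub0 : S 0. Proof. by rewrite -(subrr 1); apply: subB; exact: sub1. Qed.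
Lemma subN a : S a -> S (- a). Proof. by move=> h; rewrite -sub0r; apply: subB => //; exact: sub0. Qed.
Lemma subD a b : S a -> S b -> S (a + b).
Proof. by move=> ha hb; rewrite -[b]opprK; apply: subB => //; exact: subN. Qed.
Lemma subX a k : S a -> S (a ^+ k).
Proof. by move=> ha; elim: k => [|k IH]; [exact: sub1|rewrite exprS; exact: subM]. Qed.
Lemma sub_sum (I : Type) (r : seq I) (P : pred I) (G : I -> F) :
  (forall i, P i -> S (G i)) -> S (\sum_(i <- r | P i) G i).
Proof. by move=> h; apply: big_ind => //; [exact: sub0|exact: subD]. Qed.
End Subrings.

Section BaseChange.
Variables (K : fieldType) (v : K -> int) (hv : discrete_valuation v).
Variables (F : fieldType) (io : {rmorphism K -> F}).
Variables (L : fieldExtType K) (w : L -> int) (hw : discrete_valuation w).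
Hypothesis hLK : forall c : K, c != 0 -> w c%:A = v c.
Variables (FL : fieldType) (iF : {rmorphism F -> FL}) (iL : {rmorphism L -> FL}).
Hypothesis hio : forall c : K, iF (io c) = iL c%:A.

Lemma evalxD n (x : 'I_n -> F) g h : evalx io x (g + h) = evalx io x g + evalx io x h.
Proof. exact: rmorphD. Qed.
Lemma evalxB n (x : 'I_n -> F) g h : evalx io x (g - h) = evalx io x g - evalx io x h.
Proof. exact: rmorphB. Qed.
Lemma evalxM n (x : 'I_n -> F) g h : evalx io x (g * h) = evalx io x g * evalx io x h.
Proof. exact: rmorphM. Qed.
Lemma evalx1 n (x : 'I_n -> F) : evalx io x 1 = 1.
Proof. exact: rmorph1. Qed.
Lemma evalx0 n (x : 'I_n -> F) : evalx io x 0 = 0.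
Proof. exact: rmorph0. Qed.
Lemma evalxC n (x : 'I_n -> F) c : evalx io x c%:MP = io c.
Proof. exact: mmapC. Qed.
Lemma evalxX n (x : 'I_n -> F) i : evalx io x 'X_i = x i.
Proof. by rewrite /evalx mmapX mmap1U. Qed.

Lemma alg_subring n (x : 'I_n -> F) : is_subring (alg v io x).
Proof.
split=> [|_ _ [g hg ->] [h hh ->]|_ _ [g hg ->] [h hh ->]].
- by exists 1; [exact: poly_over1|rewrite evalx1].
- by exists (g - h); [exact: poly_overB|rewrite evalxB].
- by exists (g * h); [exact: poly_overM|rewrite evalxM].
Qed.

Lemma alg_const n (x : 'I_n -> F) c : vring v c -> alg v io x (io c).
Proof. by move=> hc; exists c%:MP; [exact: poly_overC|rewrite evalxC]. Qed.

Lemma alg_gen n (x : 'I_n -> F) i : alg v io x (x i).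
Proof. by exists 'X_i; [exact: poly_overX|rewrite evalxX]. Qed.

Lemma vge_LK N (c : K) : vge v N c <-> vge w N c%:A.
Proof.
have [->|c0] := eqVneq c 0; first by rewrite scale0r; split; left.
by rewrite !vgeP ?hLK // scalar_neq0.
Qed.

Section Fixed.
Variable B : set F.
Hypothesis hB : is_subring B.
Notation BB := (base_change w iF iL B).

Lemma bc_gen a c : B a -> vring w c -> BB (iF a * iL c).
Proof.
by move=> ha hc; exists 1%N, (fun=> a), (fun=> c); split=> //; rewrite big_ord1.
Qed.

Lemma bcD x y : BB x -> BB y -> BB (x + y).
Proof.
move=> [r [a [c [ha hc ->]]]] [r' [a' [c' [ha' hc' ->]]]].
exists (r + r')%N, (fun i => match split i with inl j => a j | inr j => a' j end),
  (fun i => match split i with inl j => c j | inr j => c' j end); split=> [i|i|].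
- by case: (split i).
- by case: (split i).
rewrite big_split_ord /=; congr (_ + _); apply: eq_bigr => i _.
  by rewrite (unsplitK (inl i)).
by rewrite (unsplitK (inr i)).
Qed.

Lemma bc_ind (T : set FL) : T 0 -> (forall x y, T x -> T y -> T (x + y)) ->
  (forall a c, B a -> vring w c -> T (iF a * iL c)) -> BB `<=` T.
Proof.
move=> T0 TD Tg _ [r [a [c [ha hc ->]]]].
by apply: big_ind => // i _; exact: Tg.
Qed.

Lemma bc_subring : is_subring BB.
Proof.
have BB0 : BB 0 by exists 0%N, (fun=> 0), (fun=> 0); split=> [[]|[]|] //; rewrite big_ord0.
have BBM x y : BB x -> BB y -> BB (x * y).
  move=> hx hy; suff : [set x | forall y, BB y -> BB (x * y)] x by apply.
  move: {y hy} x hx; apply: bc_ind => [y _|x x' hx hx' y hy|a c ha hc y hy] /=.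
  - by rewrite mul0r.
  - by rewrite mulrDl; apply: bcD; [exact: hx|exact: hx'].
  move: y hy; apply: bc_ind => [|y y' hy hy'|a' c' ha' hc'] /=; first by rewrite mulr0.
    by rewrite mulrDr; exact: bcD.
  have -> : iF a * iL c * (iF a' * iL c') = iF (a * a') * iL (c * c').
    by rewrite !rmorphM; ring.
  by apply: bc_gen; [exact: (subM hB)|exact: vgeMl].
have BBN x : BB x -> BB (- x).
  move=> hx; rewrite -mulN1r; apply: BBM => //.
  have -> : -1 = iF 1 * iL (-1) by rewrite rmorph1 rmorphN1 mul1r.
  by apply: bc_gen; [exact: (sub1 hB)|apply: vgeN => //; exact: vge1].
split=> [|x y hx hy|//]; last by apply: bcD => //; exact: BBN.
have -> : 1 = iF 1 * iL 1 by rewrite !rmorph1 mul1r.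
by apply: bc_gen; [exact: (sub1 hB)|exact: vge1].
Qed.

Lemma bc_F a : B a -> BB (iF a).
Proof. by move=> ha; rewrite -[iF a]mulr1 -(rmorph1 iL); apply: bc_gen => //; exact: vge1. Qed.

Lemma bc_L c : vring w c -> BB (iL c).
Proof. by move=> hc; rewrite -[iL c]mul1r -(rmorph1 iF); apply: bc_gen => //; exact: (sub1 hB). Qed.

(* The point of Spec B below a point of the base change. *)
Section Contraction.
Variable I : set FL.
Hypothesis hI : is_prime_ideal BB I.
Let J : set F := [set a | B a /\ I (iF a)].

Lemma contraction_prime : is_prime_ideal B J.
Proof.
have [[IS I0 n1] [ID IM IP]] := hI; split.
  split=> [a [] //||[_]]; last by rewrite rmorph1.
  by split; [exact: (sub0 hB)|rewrite rmorph0].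
split=> [a b [ha Ia] [hb Ib]|a b ha [hb Ib]|a b ha hb [_]].
- by split; [exact: (subD hB)|rewrite rmorphD; exact: ID].
- by split; [exact: (subM hB)|rewrite rmorphM; apply: (IM) => //; exact: bc_F].
by rewrite rmorphM => /(IP _ _ (bc_F ha) (bc_F hb))[]; [left|right].
Qed.

Lemma contraction_map a : localisation B J a -> localisation BB I (iF a).
Proof.
move=> [b [c [hb hc nc ->]]]; exists (iF b), (iF c); rewrite fmorph_div.
by split=> //; [exact: bc_F|exact: bc_F|move=> h; exact: nc].
Qed.

End Contraction.
End Fixed.

(** The base change arises from the valuation ring of L by adjoining the finitely many elements
    [iF (x i)]; in the valuation ring itself, a term of least valuation generates. *)
Lemma base_change_noetherian n (x : 'I_n -> F) :
  noetherian (base_change w iF iL (alg v io x)).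
Proof.
set BB := base_change _ _ _ _; have hA := alg_subring x.
have hBB : is_subring BB by exact: bc_subring.
pose S0 : set FL := [set z | exists2 c, vring w c & z = iL c].
pose fix T (s : seq FL) : set FL := if s is y :: s' then adjoin (T s') y else S0.
have hS0 : is_subring S0.
  split=> [|_ _ [c hc ->] [c' hc' ->]|_ _ [c hc ->] [c' hc' ->]].
  - by exists 1; [exact: vge1|rewrite rmorph1].
  - by exists (c - c'); [exact: vgeB|rewrite rmorphB].
  - by exists (c * c'); [exact: vgeMl|rewrite rmorphM].
have noeth0 : noetherian S0.
  move=> a ha; have [[i ai]|na] := EM (exists i, a i != 0); last first.
    exists 0%N; have -> : a 0%N = 0.
      by apply: contrapT => /eqP h; apply: na; exists 0%N.
    by have [] := sspan_submod S0 [set x | exists2 i, (i < 0)%N & x = a i].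
  have /choice[c hc] : forall n, exists c, vring w c /\ a n = iL c.
    by move=> k; have [c] := ha k; exists c.
  have c0 k : (c k != 0) = (a k != 0) by rewrite (hc k).2 fmorph_eq0.
  pose Q k := `[< exists2 j, c j != 0 & w (c j) = Posz k >].
  have pos j : c j != 0 -> 0 <= w (c j) by move=> cj; case: (hc j) => /(vgeP _ _ cj).
  have exQ : exists k, Q k.
    exists `|w (c i)|%N; apply/asboolP; exists i; first by rewrite c0.
    by rewrite gez0_abs // pos // c0.
  case: (ex_minnP exQ) => k /asboolP[j cj wj] mink.
  exists j.+1; have [_ _ hM] := sspan_submod S0 [set x | exists2 i, (i < j.+1)%N & x = a i].
  have -> : a j.+1 = iL (c j.+1 / c j) * a j.
    by rewrite (hc j).2 -rmorphM divfK // (hc j.+1).2.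
  apply: hM; last by apply: sspan_gen; exists j.
  exists (c j.+1 / c j) => //; have [->|cj1] := eqVneq (c j.+1) 0.
    by rewrite mul0r; left.
  have Qj : Q `|w (c j.+1)|%N.
    by apply/asboolP; exists j.+1 => //; rewrite gez0_abs // pos.
  right; rewrite valM ?invr_neq0 // valV // wj; have := mink _ Qj; have := pos _ cj1.
  by move: (w _) => z; lia.
have hT s : is_subring (T s) /\ noetherian (T s).
  elim: s => [|y s [h1 h2]]; first by split.
  by split; [exact: adjoin_subring|exact: adjoin_noetherian].
have subT s : S0 `<=` T s.
  elim: s => [//|y s IH] z hz /=; apply: adjoin_sub; [exact: (hT s).1|exact: IH].
have genT s y : y \in s -> T s y.
  elim: s => // z s IH; rewrite inE => /orP[/eqP->|/IH h] /=.
    exact: (adjoin_gen (hT s).1).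
  by apply: adjoin_sub => //; exact: (hT s).1.
have TBB s : (forall y, y \in s -> BB y) -> T s `<=` BB.
  elim: s => [|y s IH] hs z /=; first by move=> [c hc ->]; exact: bc_L.
  move=> [p hp ->]; rewrite horner_coef; apply: (sub_sum hBB) => i _.
  apply: (subM hBB); last by apply: (subX hBB); apply: hs; rewrite mem_head.
  by apply: IH => // y' hy'; apply: hs; rewrite inE hy' orbT.
pose s := [seq iF (x i) | i <- enum 'I_n].
suff -> : BB = T s by exact: (hT s).2.
apply/seteqP; split; last first.
  apply: TBB => _ /mapP[i _ ->]; apply: bc_F; exact: alg_gen.
have [hs _] := hT s; apply: bc_ind.
- exact: (sub0 hs).
- exact: (subD hs).
move=> _ c [g hg ->] hc; apply: (subM hs); last by apply: subT; exists c.
move: g hg; apply: poly_over_ind => [||c' hc'|i|g h hg hh|g h hg hh].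
- by left.
- exact: vge1.
- by rewrite evalxC hio; apply: subT; exists c'%:A => //; exact/vge_LK.
- by rewrite evalxX; apply: genT; apply: map_f; rewrite mem_enum.
- by rewrite evalxD rmorphD; exact: (subD hs).
- by rewrite evalxM rmorphM; exact: (subM hs).
Qed.

End BaseChange.

(** * Completion along a section *)

Section Completion.
Variables (K : fieldType) (L : fieldExtType K) (w : L -> int).
Variables (hw : discrete_valuation w) (hwc : vcomplete w).
Variables (FL : fieldType) (iL : {rmorphism L -> FL}).
Variables (O : set FL) (hO : is_subring O) (O_L : forall c, vring w c -> O (iL c)).
Variables (rho : FL -> L) (hrho : is_section w iL O rho).
Variables (t : FL) (ht : is_section_equation O rho t).
Notation V := (CDVField hw hwc).
Implicit Types (e : lau V).

Let Ot : O t. Proof. by case: ht. Qed.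
Let t0 : t != 0. Proof. by case: ht. Qed.
Let rhoP a : O a -> (rho a = 0 <-> O (a / t)). Proof. by case: ht => _ _; exact. Qed.
Let rhoD a b : O a -> O b -> rho (a + b) = rho a + rho b. Proof. by case: hrho => h _ _ _ _; exact: h. Qed.
Let rhoM a b : O a -> O b -> rho (a * b) = rho a * rho b. Proof. by case: hrho => _ h _ _ _; exact: h. Qed.
Let rhoL c : vring w c -> rho (iL c) = c. Proof. by case: hrho => _ _ h _ _; exact: h. Qed.
Let rho_int a : O a -> vge w 0 (rho a). Proof. by case: hrho => _ _ _ h _; exact: h. Qed.
Let rhoB a b : O a -> O b -> rho (a - b) = rho a - rho b.
Proof.
move=> ha hb; have hN := subN hO hb; rewrite rhoD //; congr (_ + _).
apply: (addrI (rho b)); rewrite subrr -rhoD // subrr.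
by rewrite -(rmorph0 iL) rhoL //; left.
Qed.

Lemma rho_t : rho t = 0.
Proof. by apply/(rhoP Ot); rewrite divff //; exact: (sub1 hO). Qed.

Lemma t_nonunit : ~ O t^-1.
Proof.
move=> h; have := rhoM Ot h; rewrite rho_t mul0r divff // -(rmorph1 iL) rhoL; last exact: vge1.
by move/eqP; rewrite oner_eq0.
Qed.

Definition eval_t (p : {poly L}) : FL := (map_poly iL p).[t].

Lemma eval_tD p q : eval_t (p + q) = eval_t p + eval_t q. Proof. by rewrite /eval_t rmorphD hornerD. Qed.
Lemma eval_tB p q : eval_t (p - q) = eval_t p - eval_t q. Proof. by rewrite /eval_t rmorphB hornerD hornerN. Qed.
Lemma eval_tM p q : eval_t (p * q) = eval_t p * eval_t q. Proof. by rewrite /eval_t rmorphM hornerM. Qed.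
Lemma eval_t_poly (E : nat -> L) N : eval_t (\poly_(i < N) E i) = \sum_(i < N) iL (E i) * t ^+ i.
Proof.
rewrite /eval_t -(horner_poly N (fun i => iL (E i))); congr _.[_].
by apply/polyP => i; rewrite coef_map !coef_poly /=; case: ifP => _ //; exact: rmorph0.
Qed.
Lemma eval_t_O (p : {poly L}) : (forall i, vge w 0 p`_i) -> O (eval_t p).
Proof.
move=> h; rewrite /eval_t horner_coef; apply: (sub_sum hO) => i _.
by rewrite coef_map; apply: (subM hO); [exact: O_L (h i)|exact: (subX hO)].
Qed.

Definition head_poly e N : {poly L} := \poly_(i < N) (e i%:Z : L).

(* [e] is the expansion of [b] as a power series in [t]. *)
Definition compl b e := psr e /\ forall N, O ((b - eval_t (head_poly e N)) / t ^+ N).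

Lemma compl_image b e : compl b e -> is_completion_image w iL O t b e.
Proof.
move=> [he h]; split=> [i|i|N]; [exact: he|exact: (lau0 e)|].
by have := h N; rewrite eval_t_poly.
Qed.

(** The coefficients are the values under [rho] of the successive quotients (b - rho(b)) / t. *)
Lemma compl_exists b : O b -> exists e, compl b e.
Proof.
move=> hb; pose step b := (b - iL (rho b)) / t.
have Ostep c : O c -> O (step c).
  move=> hc; have h := O_L (rho_int hc).
  by apply/rhoP; [exact: (subB hO)|rewrite rhoB // rhoL ?subrr //; exact: rho_int].
pose bs n := iter n step b.
have Obs n : O (bs n) by elim: n => // n; exact: Ostep.
have [e he eE] := @psr_mk V (fun n => rho (bs n)) (fun n => rho_int (Obs n)).
exists e; split=> // N; suff -> : b - eval_t (head_poly e N) = t ^+ N * bs N.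
  by rewrite mulrAC divff ?mul1r // expf_neq0.
rewrite eval_t_poly; elim: N => [|N IH]; first by rewrite big_ord0 subr0 mul1r.
rewrite big_ord_recr /= opprD addrA IH eE exprSr -mulrA.
have -> : t * bs N.+1 = bs N - iL (rho (bs N)) by rewrite /= /step mulrC divfK.
by rewrite mulrBr [iL _ * _]mulrC.
Qed.

Lemma complB b b' e e' : compl b e -> compl b' e' -> compl (b - b') (e - e').
Proof.
move=> [he h] [he' h']; split; first exact: psrB.
move=> N; have -> : head_poly (e - e') N = head_poly e N - head_poly e' N.
  by apply/polyP => i; rewrite coefB !coef_poly; case: ifP => _; rewrite ?subr0.
have -> : b - b' - eval_t (head_poly e N - head_poly e' N) =
    b - eval_t (head_poly e N) - (b' - eval_t (head_poly e' N)) by rewrite eval_tB; ring.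
by rewrite mulrBl; apply: (subB hO).
Qed.

Lemma compl_in b e : compl b e -> O b.
Proof.
move=> [_ /(_ 0%N)]; rewrite expr0 divr1 eval_t_poly big_ord0 subr0.
exact.
Qed.

Lemma compl_zero e : compl 0 e -> e = 0.
Proof.
move=> [he h]; apply: psr_ext => //; first exact: psr0.
move=> n; rewrite lau0E; have [k] := ubnP n; elim: k n => // k IH n; rewrite ltnS => le.
have := h n.+1; rewrite eval_t_poly big_ord_recr big1 /= => [|i _]; last first.
  by rewrite IH ?rmorph0 ?mul0r //; apply: leq_trans le.
rewrite !add0r mulNr exprSr invfM mulrA mulfK ?expf_neq0 // => /(subN hO).
rewrite opprK => /rhoP; rewrite rhoL; last exact: (lau0 e).
by apply; exact: O_L (lau0 e _).
Qed.

Lemma compl_unique b e e' : compl b e -> compl b e' -> e = e'.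
Proof.
by move=> h h'; have := complB h h'; rewrite subrr => /compl_zero/eqP; rewrite subr_eq0 => /eqP.
Qed.

Lemma compl_L c : vge w 0 c -> compl (iL c) (cst (c : V)).
Proof.
move=> hc; split=> [|N]; first exact: psr_cst.
case: N => [|N]; first by rewrite expr0 divr1 eval_t_poly big_ord0 subr0; exact: O_L.
rewrite eval_t_poly big_ord_recl big1 => [|i _]; last by rewrite cstE ?rmorph0 ?mul0r.
by rewrite cstE // expr0 mulr1 addr0 subrr mul0r; exact: (sub0 hO).
Qed.

Lemma compl1 : compl 1 1.
Proof. by rewrite -(rmorph1 iL) -cst1; apply: compl_L; exact: vge1. Qed.

Lemma compl_t : compl t (mono (1 : V) 1).
Proof.
have h1 : vge w 0 1 by exact: vge1.
split=> [i hi|N]; first by rewrite monoE //; case: eqP => //; lia.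
case: N => [|[|N]].
- by rewrite expr0 divr1 eval_t_poly big_ord0 subr0.
- by rewrite eval_t_poly big_ord1 monoE // rmorph0 mul0r subr0 divff //; exact: (sub1 hO).
rewrite eval_t_poly !big_ord_recl big1 => [|i _]; last by rewrite monoE // rmorph0 mul0r.
rewrite !monoE //= rmorph0 rmorph1 mul0r mul1r add0r addr0 expr1 subrr mul0r.
exact: (sub0 hO).
Qed.

Lemma complM b b' e e' : compl b e -> compl b' e' -> compl (b * b') (e * e').
Proof.
move=> hb hb'; have [Ob Ob'] := (compl_in hb, compl_in hb').
have [he h] := hb; have [he' h'] := hb'; split; first exact: psrM.
move=> N; set p := head_poly e N; set p' := head_poly e' N.
have ip i : vge w 0 p`_i by rewrite coef_poly; case: ifP => _; [exact: (lau0 e)|left].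
have ip' i : vge w 0 p'`_i by rewrite coef_poly; case: ifP => _; [exact: (lau0 e')|left].
have -> : head_poly (e * e') N = take_poly N (p * p').
  apply/polyP => i; rewrite coef_take_poly coef_poly; case: ifP => // lt.
  rewrite psr_coefM // coefM; apply: eq_bigr => k _; rewrite !coef_poly.
  have lk : (k <= i)%N by rewrite -ltnS.
  by rewrite (leq_ltn_trans lk lt) (leq_ltn_trans (leq_subr _ _) lt).
have -> : eval_t (take_poly N (p * p')) = eval_t p * eval_t p' - eval_t (drop_poly N (p * p')) * t ^+ N.
  rewrite -eval_tM -[in eval_t (p * p')](poly_take_drop N (p * p')) eval_tD eval_tM.
  have -> : eval_t 'X^N = t ^+ N by rewrite /eval_t map_polyXn hornerXn.
  by rewrite addrK.
have := h N; have := h' N; rewrite -/p -/p'.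
set x := b - eval_t p; set x' := b' - eval_t p'; set T := t ^+ N => hx' hx.
have T0 : T != 0 by rewrite expf_neq0.
have -> : (b * b' - (eval_t p * eval_t p' - eval_t (drop_poly N (p * p')) * T)) / T =
   (x / T) * b' + eval_t p * (x' / T) + eval_t (drop_poly N (p * p')).
  by rewrite /x /x'; field.
apply: (subD hO); first apply: (subD hO).
- exact: (subM hO).
- by apply: (subM hO) => //; exact: eval_t_O.
apply: eval_t_O => i; rewrite coef_drop_poly coefM; apply: vge_sum => // k _.
exact: vgeMl.
Qed.

(** The completion map of O as a total function, with value 0 outside O. *)
Definition sO (b : FL) : lau V := xget 0 [set e | compl b e].

Lemma sOP b : O b -> compl b (sO b).
Proof. by move=> /compl_exists[e h]; apply: (xgetPex 0 (P := [set e | compl b e])); exists e. Qed.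
Lemma sO_unique b e : compl b e -> sO b = e.
Proof. by move=> h; exact: compl_unique (sOP (compl_in h)) h. Qed.
Lemma sOM b b' : O b -> O b' -> sO (b * b') = sO b * sO b'.
Proof. by move=> hb hb'; apply: sO_unique; apply: complM; exact: sOP. Qed.
Lemma sOB b b' : O b -> O b' -> sO (b - b') = sO b - sO b'.
Proof. by move=> hb hb'; apply: sO_unique; apply: complB; exact: sOP. Qed.
Lemma sO_L c : vge w 0 c -> sO (iL c) = cst (c : V).
Proof. by move=> hc; apply: sO_unique; exact: compl_L. Qed.
Lemma sO1 : sO 1 = 1. Proof. by apply: sO_unique; exact: compl1. Qed.
Lemma sO_t : sO t = mono (1 : V) 1. Proof. by apply: sO_unique; exact: compl_t. Qed.
Lemma sO_psr b : O b -> psr (sO b). Proof. by move=> /sOP[]. Qed.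
Lemma sO0 : sO 0 = 0.
Proof. by rewrite -(subrr 1) sOB ?subrr //; exact: (sub1 hO). Qed.
Lemma sOD b b' : O b -> O b' -> sO (b + b') = sO b + sO b'.
Proof.
move=> hb hb'; have hN := subN hO hb'; rewrite -[b']opprK sOB //; congr (_ + _).
by rewrite -sub0r sOB ?sO0 ?sub0r ?opprK //; exact: (sub0 hO).
Qed.
Lemma sO_coef0 b : O b -> sO b 0 = rho b.
Proof.
move=> hb; have h0 : vge w 0 (sO b 0) by exact: (lau0 (sO b)).
have hL := O_L h0; have hd := subB hO hb hL.
have [_ /(_ 1%N)] := sOP hb; rewrite eval_t_poly big_ord1 expr0 mulr1 expr1 => /(rhoP hd).2.
by rewrite rhoB // rhoL // => /eqP; rewrite subr_eq0 => /eqP.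
Qed.

Lemma sO_unit b : O b -> O b^-1 -> b != 0 -> ~ vge w 1 (sO b 0).
Proof.
move=> hb hb' b0 h; have := congr1 (fun e => lcoef e 0) (sOM hb hb').
rewrite divff // sO1 lau1E eqxx psr_coefM0; [|exact: sO_psr|exact: sO_psr].
move=> e1; apply: (n1_vge1 hw); rewrite (e1 : 1 = _).
by apply: vgeMr => //; exact: (lau0 (sO b^-1)).
Qed.

(** Prepares Krull's theorem: an element with zero expansion is divisible by all powers of [t]. *)
Lemma sO_div b (N : nat) : O b -> (forall i : nat, (i < N)%N -> sO b i%:Z = 0) -> O (b / t ^+ N).
Proof.
move=> hb h; have [_ /(_ N)] := sOP hb; rewrite eval_t_poly big1 ?subr0 // => i _.
by rewrite h // rmorph0 mul0r.
Qed.

Lemma sO_maxideal b : maxideal O b -> vge w 1 (sO b 0).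
Proof.
move=> hb; have Ob : O b by case: hb.
by rewrite sO_coef0 //; apply/(vmaxE w); case: hrho => _ _ _ _; apply.
Qed.

End Completion.

(** * Expansions and differentials *)

Section MaximalMinors.
Variables (R : comNzRingType) (m : nat) (J : 'M[R]_(m, m.+1)).

(* The signed maximal minors: a solution of the linear system with matrix J. *)
Definition minor_vec (i : 'I_m.+1) : R := (-1) ^+ i * \det (col' i J).

Let lshift_ord0 : (ord0 : 'I_(1 + m)) = lshift m (ord0 : 'I_1).
Proof. exact/val_inj. Qed.
Let lift_rshift (k : 'I_m) : lift (ord0 : 'I_(1 + m)) k = rshift 1 k.
Proof. exact/val_inj. Qed.

Let cofactorE (r : 'rV[R]_m.+1) i :
  cofactor (col_mx r J : 'M_(1 + m)) ord0 i = minor_vec i.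
Proof.
rewrite /cofactor add0n /minor_vec; congr (_ * \det _); apply/matrixP => k l.
by rewrite mxE mxE lift_rshift (col_mxEd r J) mxE.
Qed.

Let row0E (r : 'rV[R]_m.+1) i : (col_mx r J : 'M_(1 + m)) ord0 i = r ord0 i.
Proof. by rewrite lshift_ord0 (col_mxEu r J). Qed.

Lemma det_col_mx (r : 'rV[R]_m.+1) :
  \det (col_mx r J : 'M_(1 + m)) = \sum_i r ord0 i * minor_vec i.
Proof.
by rewrite (expand_det_row _ ord0); apply: eq_bigr => i _; rewrite row0E cofactorE.
Qed.

Let det_delta l : \det (col_mx (delta_mx ord0 l) J : 'M_(1 + m)) = minor_vec l.
Proof.
rewrite det_col_mx (bigD1 l) //= mxE !eqxx mul1r big1 ?addr0 // => k /negPf kl.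
by rewrite mxE kl andbF mul0r.
Qed.

Lemma minor_vec_kernel j : \sum_i J j i * minor_vec i = 0.
Proof.
have := det_col_mx (row j J).
rewrite (determinant_alternate (i1 := ord0) (i2 := rshift 1 j)) //.
  by move=> e; rewrite [RHS]e; apply: eq_bigr => i _; rewrite mxE.
by move=> i; rewrite row0E (col_mxEd (row j J) J) mxE.
Qed.

(** Border [J] by the unit row at [l] and apply the adjugate to the image of [u], of which only the
    first entry can be nonzero. *)
Lemma minor_vec_unique (u : 'I_m.+1 -> R) : (forall j, \sum_i J j i * u i = 0) ->
  forall i l, minor_vec l * u i = minor_vec i * u l.
Proof.
move=> hu i l; pose r : 'rV[R]_m.+1 := delta_mx ord0 l.
pose N : 'M[R]_(1 + m) := col_mx r J; pose U : 'cV[R]_(1 + m) := \col_i u i.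
have NU k : (N *m U) k ord0 = if k == ord0 then u l else 0.
  rewrite mxE; case: (split_ordP k) => [k0|k1] ->.
    rewrite (_ : lshift m k0 = ord0) ?eqxx; last by apply/val_inj; case: k0 => [[]].
    rewrite (bigD1 l) //= row0E !mxE !eqxx mul1r big1 ?addr0 // => k' /negPf kl.
    by rewrite row0E !mxE kl andbF mul0r.
  rewrite (_ : (rshift 1 k1 == ord0) = false) // -[RHS](hu k1).
  by apply: eq_bigr => k' _; rewrite (col_mxEd r J) mxE.
have e := congr1 (fun A : 'cV_(1 + m) => A i ord0) (mulmxA (\adj N) N U).
move: e; rewrite mul_adj_mx mul_scalar_mx det_delta !mxE => <-.
rewrite (bigD1 ord0) //= NU eqxx big1 ?addr0 => [|k /negPf k0]; last by rewrite NU k0 mulr0.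
by rewrite mxE cofactorE.
Qed.

(** A choice of m among m + 1 columns misses some column [l]. Bordering by the unit row at [l]
    exhibits the minor as the determinant of a product, so all maximal minors are multiples of the
    signed ones. *)
Lemma det_colsub_minor (s : 'I_m -> 'I_m.+1) : exists l (E : 'M[R]_m.+1),
  (forall i j, E i j = 0 \/ E i j = 1) /\ \det (colsub s J) = minor_vec l * \det E.
Proof.
have [l hl] : exists l, l \notin codom s.
  apply: contrapT => h; have : (m.+1 <= #|codom s|)%N.
    rewrite -[X in (X <= _)%N]card_ord; apply: subset_leq_card; apply/fintype.subsetP => l _.
    by apply: contrapT => hl; apply: h; exists l; apply/negP.
  by move/leq_trans/(_ (leq_image_card _ _)); rewrite card_ord ltnn.
pose r : 'rV[R]_m.+1 := delta_mx ord0 l.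
pose E1 : 'M[R]_(m.+1, 1) := delta_mx l ord0; pose E2 : 'M[R]_(m.+1, m) := colsub s 1%:M.
exists l, (row_mx E1 E2 : 'M_(1 + m)); split.
  move=> i j; case: (@split_ordP 1 m j) => k ->.
    by rewrite (row_mxEl E1 E2) mxE; case: (_ && _); [right|left].
  by rewrite (row_mxEr E1 E2) !mxE; case: (_ == _); [right|left].
rewrite -(det_delta l) -det_mulmx -/r (mul_col_row r J E1 E2).
have -> : r *m E1 = 1%:M.
  apply/matrixP => i j; rewrite !ord1 !mxE eqxx (bigD1 l) //= !mxE !eqxx mul1r.
  by rewrite big1 ?addr0 // => k /negPf kl; rewrite !mxE kl andbF mul0r.
have -> : r *m E2 = 0.
  apply/matrixP => i j; rewrite !ord1 [RHS]mxE mxE (bigD1 l) //= big1.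
    rewrite !mxE !eqxx addr0 mul1r; case: eqP => [e|_] //.
    by case/negP: hl; rewrite e codom_f.
  by move=> k /negPf kl; rewrite mxE kl andbF mul0r.
have -> : J *m E2 = colsub s J.
  apply/matrixP => i j; rewrite !mxE (bigD1 (s j)) //= !mxE eqxx mulr1.
  by rewrite big1 ?addr0 // => k /negPf kl; rewrite !mxE kl mulr0.
by rewrite det_lblock det1 mul1r.
Qed.

End MaximalMinors.

Section Expansions.
Variables (K : fieldType) (v : K -> int) (hv : discrete_valuation v).
Variables (F : fieldType) (io : {rmorphism K -> F}).
Variables (m : nat) (x : 'I_m.+1 -> F) (f : 'I_m -> {mpoly K[m.+1]}).
Hypothesis hpres : is_presentation v io x f.
Variable V : cdvField.
Notation w := (@cdv_val V).
Let hw := @cdv_valP V.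
Notation mpol := {mpoly K[m.+1]}.
Notation over := (poly_over (vring v)).
Notation ev g := (evalx io x g).
Implicit Types (g h : mpol) (th : mpol -> lau V).

(** The common properties of the plain expansion and of the expansion of the lift. The latter is
    only sigma-semilinear, so about constants only the vanishing of the derivative is asked. *)
Record is_expansion th : Prop := IsExpansion {
  expD : forall g h, over g -> over h -> th (g + h) = th g + th h;
  expM : forall g h, over g -> over h -> th (g * h) = th g * th h;
  exp1 : th 1 = 1;
  expf : forall j, th (f j) = 0;
  expC : forall c, vring v c -> der (th c%:MP) = 0 }.

Section Theory.
Variables (th : mpol -> lau V) (hth : is_expansion th).

Let over0 : over (0 : mpol). Proof. exact: poly_over0. Qed.
Let over1 : over (1 : mpol). Proof. exact: poly_over1. Qed.
Let overf j : over (f j). Proof. by case: hpres. Qed.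

Lemma exp0 : th 0 = 0.
Proof. by apply: (addrI (th 0)); rewrite -(expD hth) ?addr0. Qed.
Lemma expN g : over g -> th (- g) = - th g.
Proof.
move=> hg; have hN := poly_overN hv hg; apply: (addrI (th g)).
by rewrite -(expD hth) // !subrr exp0.
Qed.
Lemma expB g h : over g -> over h -> th (g - h) = th g - th h.
Proof. by move=> hg hh; have hN := poly_overN hv hh; rewrite (expD hth) // expN. Qed.
Lemma exp_sum (I : Type) (r : seq I) (P : pred I) (G : I -> mpol) :
  (forall i, P i -> over (G i)) ->
  th (\sum_(i <- r | P i) G i) = \sum_(i <- r | P i) th (G i).
Proof.
move=> hG; pose Q (g : mpol) (e : lau V) := over g /\ th g = e.
suff [] : Q (\sum_(i <- r | P i) G i) (\sum_(i <- r | P i) th (G i)) by [].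
apply: (big_ind2 Q) => [|g e h e' [hg <-] [hh <-]|i Pi].
- by split=> //; exact: exp0.
- by split; [exact: poly_overD|exact: (expD hth)].
- by split=> //; exact: hG.
Qed.
Lemma exp_prod (I : Type) (r : seq I) (P : pred I) (G : I -> mpol) :
  (forall i, P i -> over (G i)) ->
  th (\prod_(i <- r | P i) G i) = \prod_(i <- r | P i) th (G i).
Proof.
move=> hG; pose Q (g : mpol) (e : lau V) := over g /\ th g = e.
suff [] : Q (\prod_(i <- r | P i) G i) (\prod_(i <- r | P i) th (G i)) by [].
apply: (big_ind2 Q) => [|g e h e' [hg <-] [hh <-]|i Pi].
- by split=> //; exact: exp1.
- by split; [exact: poly_overM|exact: (expM hth)].
- by split=> //; exact: hG.
Qed.

Lemma exp_eq g h : over g -> over h -> ev g = ev h -> th g = th h.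
Proof.
move=> hg hh e; apply/eqP; rewrite -subr_eq0 -expB //; apply/eqP.
have hgh := poly_overB hv hg hh.
have [_ /(_ _ hgh) [H _]] := hpres.
have [|c hc ->] := H; first by rewrite evalxB e subrr.
rewrite exp_sum => [|j _]; last by apply: poly_overM.
by rewrite big1 // => j _; rewrite (expM hth) // (expf hth) mulr0.
Qed.

Lemma exp_chain g : over g -> der (th g) = \sum_k th (mderiv k g) * der (th 'X_k).
Proof.
move=> hg; suff [] : over g /\ der (th g) = \sum_k th (mderiv k g) * der (th 'X_k) by [].
move: g hg; apply: poly_over_ind => [||c hc|i|g h [hg eg] [hh eh]|g h [hg eg] [hh eh]].
- by left.
- exact: vge1.
- split; first exact: poly_overC.
  by rewrite (expC hth) // big1 // => k _; rewrite mderivC exp0 mul0r.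
- split; first exact: poly_overX.
  rewrite (bigD1 i) //= big1 ?addr0 => [|k ki].
    rewrite mderivX mnmE eqxx scale1r (_ : (U_(i) - U_(i))%MM = 0%MM).
      by rewrite mpolyX0 (exp1 hth) mul1r.
    by apply/mnmP => l; rewrite mnmBE subnn mnm0E.
  by rewrite mderivX mnmE eq_sym (negPf ki) scale0r exp0 mul0r.
- split; first exact: poly_overD.
  rewrite (expD hth) // derD eg eh -big_split; apply: eq_bigr => k _.
  by rewrite mderivD (expD hth) ?mulrDl //; exact: poly_over_deriv.
split; first exact: poly_overM.
rewrite (expM hth) // derM eg eh mulr_suml mulr_sumr -big_split; apply: eq_bigr => k _ /=.
have dg := poly_over_deriv hv k hg; have dh := poly_over_deriv hv k hh.
rewrite mderivM (expD hth) ?(expM hth) //; [ring|exact: poly_overM|exact: poly_overM].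
Qed.

End Theory.

Let over_sign k : over ((-1) ^+ k : mpol).
Proof.
apply/poly_over_mge; rewrite rmorphXn rmorphN1; apply: mge0X => //.
by apply: mgeN => //; exact: mge1.
Qed.

Let over_det n (M : 'M[mpol]_n) : (forall i j, over (M i j)) -> over (\det M).
Proof.
move=> h; apply: poly_over_sum => // s _; apply: poly_overM => //.
exact: poly_over_prod.
Qed.

(** The components of a vector field tangent to the curve f = 0 ([dpol_f]), given by Cramer's
    rule. *)
Definition Dpol (k : 'I_m.+1) : mpol := minor_vec (jacobian f) k.
Definition dpol g : mpol := \sum_k mderiv k g * Dpol k.

Lemma over_Dpol k : over (Dpol k).
Proof.
apply: poly_overM => //; apply: over_det => i j; rewrite !mxE.
by apply: poly_over_deriv => //; case: hpres.
Qed.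

Lemma over_dpol g : over g -> over (dpol g).
Proof.
move=> hg; apply: poly_over_sum => // k _; apply: poly_overM => //.
  exact: poly_over_deriv.
exact: over_Dpol.
Qed.

Lemma dpol_f j : dpol (f j) = 0.
Proof.
by rewrite -(minor_vec_kernel (jacobian f) j); apply: eq_bigr => k _; rewrite mxE.
Qed.

Lemma dpolD g h : dpol (g + h) = dpol g + dpol h.
Proof. by rewrite /dpol -big_split; apply: eq_bigr => k _; rewrite mderivD mulrDl. Qed.
Lemma dpolM g h : dpol (g * h) = g * dpol h + h * dpol g.
Proof.
by rewrite /dpol !mulr_sumr -big_split; apply: eq_bigr => k _; rewrite mderivM /=; ring.
Qed.
Lemma dpolC c : dpol c%:MP = 0.
Proof. by rewrite /dpol big1 // => k _; rewrite mderivC mul0r. Qed.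

(** As [th] kills the equations, the chain rule shows that the derivatives of the th(x_k) solve the
    linear system with matrix th(Jac f). They are therefore proportional to the signed minors. *)
Lemma exp_cramer th (hth : is_expansion th) l g : over g ->
  th (Dpol l) * der (th g) = th (dpol g) * der (th 'X_l).
Proof.
move=> hg; rewrite (exp_chain hth hg).
rewrite [in RHS]/dpol (exp_sum hth) => [|k _]; last first.
  by apply: poly_overM => //; [exact: poly_over_deriv|exact: over_Dpol].
rewrite mulr_sumr mulr_suml; apply: eq_bigr => k _.
rewrite [th (mderiv k g * _)](expM hth); [|exact: poly_over_deriv|exact: over_Dpol].
pose J := map_mx th (jacobian f).
have DJ i : th (Dpol i) = minor_vec J i.
  rewrite /Dpol /minor_vec (expM hth); [|exact: over_sign|]; last first.
    by apply: over_det => a b; rewrite !mxE; apply: poly_over_deriv => //; case: hpres.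
  have sign n : th ((-1) ^+ n) = (-1) ^+ n.
    elim: n => [|n IH]; first by rewrite !expr0 (exp1 hth).
    have oN1 : over (-1 : mpol) by rewrite -[-1]expr1; exact: over_sign.
    rewrite !exprS (expM hth) ?IH //.
    by rewrite (expN hth) ?(exp1 hth) //; exact: poly_over1.
  rewrite sign; congr (_ * _); rewrite /determinant (exp_sum hth) => [|s _].
    apply: eq_bigr => s _; have o1 := over_sign (perm.odd_perm s).
    have o2 : over (\prod_k (col' i (jacobian f)) k (perm.fun_of_perm s k)).
      by apply: poly_over_prod => // a _; rewrite !mxE; apply: poly_over_deriv => //; case: hpres.
    rewrite (expM hth o1 o2) sign.
    rewrite (exp_prod hth) => [|a _]; last first.
      by rewrite !mxE; apply: poly_over_deriv => //; case: hpres.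
    by congr (_ * _); apply: eq_bigr => a _; rewrite !mxE.
  apply: (poly_overM hv (over_sign (perm.odd_perm s))).
  apply: poly_over_prod => // a _; rewrite !mxE.
  by apply: poly_over_deriv => //; case: hpres.
have -> : forall A B C : lau V, A * (B * C) = B * (A * C) by move=> *; ring.
rewrite -mulrA; apply: (congr1 ( *%R _)).
have key : minor_vec J l * der (th 'X_k) = minor_vec J k * der (th 'X_l).
  apply: (minor_vec_unique (u := fun i => der (th 'X_i))) => j.
  have [hf _] := hpres; have := exp_chain hth (hf j).
  rewrite (expf hth) der0 => e; rewrite [RHS]e; apply: eq_bigr => i _.
  by rewrite !mxE.
rewrite -(DJ l) -(DJ k) in key; exact: key.
Qed.

(* The derivation of F which maps x_k to D_k. *)
Hypothesis hfrac : has_fraction_field (alg v io x).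

Lemma dpol_ev g h : over g -> over h -> ev g = ev h -> ev (dpol g) = ev (dpol h).
Proof.
move=> hg hh e; apply/eqP; rewrite -subr_eq0 -evalxB; apply/eqP.
have hgh := poly_overB hv hg hh.
have [_ /(_ _ hgh) [H _]] := hpres.
have [|c hc ec] := H; first by rewrite evalxB e subrr.
have fj0 j : ev (f j) = 0.
  have [hf /(_ _ (hf j)) [_ ->]] := hpres => //.
  exists (fun i => (i == j)%:R) => [i|]; first by case: (i == j); [exact: poly_over1|exact: poly_over0].
  by rewrite (bigD1 j) //= eqxx mul1r big1 ?addr0 // => i /negPf ->; rewrite mul0r.
have dN : dpol (g - h) = dpol g - dpol h.
  by apply: (addIr (dpol h)); rewrite -dpolD !subrK.
rewrite -dN ec; have -> : dpol (\sum_j c j * f j) = \sum_j f j * dpol (c j).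
  rewrite (big_morph dpol dpolD (_ : dpol 0 = 0)); last by rewrite -mpolyC0 dpolC.
  by apply: eq_bigr => j _; rewrite dpolM dpol_f mulr0 add0r.
rewrite (big_morph (fun g => ev g) (evalxD io x) (evalx0 io x)) big1 // => j _.
by rewrite evalxM fj0 mul0r.
Qed.

Definition dfrac g1 g2 : F := (ev g2 * ev (dpol g1) - ev g1 * ev (dpol g2)) / ev g2 ^+ 2.

(** Defined by the quotient rule on some presentation as a fraction; [deltaE] shows independence of
    the choice. The target is F as a module over itself, to which the universal property of [Om]
    applies. *)
Definition delta (z : F) : F^o := xget 0 [set y | exists g1 g2,
  [/\ over g1, over g2, ev g2 != 0, z = ev g1 / ev g2 & y = dfrac g1 g2]].

Lemma deltaE g1 g2 : over g1 -> over g2 -> ev g2 != 0 ->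
  delta (ev g1 / ev g2) = dfrac g1 g2.
Proof.
move=> h1 h2 n2; rewrite /delta.
have : exists y, [set y | exists g1' g2', [/\ over g1', over g2', ev g2' != 0,
    ev g1 / ev g2 = ev g1' / ev g2' & y = dfrac g1' g2']] y.
  by exists (dfrac g1 g2), g1, g2.
case/(xgetPex 0) => g1' [g2' [h1' h2' n2' e ->]].
have e' : ev (g1 * g2') = ev (g1' * g2).
  by rewrite !evalxM; apply/eqP; rewrite -eqr_div // e.
have := dpol_ev (poly_overM hv h1 h2') (poly_overM hv h1' h2) e'.
move: e'; rewrite !dpolM !evalxD !evalxM /dfrac => e1 e2.
apply/eqP; rewrite eqr_div ?expf_neq0 //; apply/eqP.
have -> : ev (dpol g1') = (ev g1 * ev (dpol g2') + ev g2' * ev (dpol g1)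
    - ev g1' * ev (dpol g2)) / ev g2 by rewrite e2; field.
have -> : ev g1' = ev g1 * ev g2' / ev g2 by rewrite e1; field.
by field.
Qed.

Lemma frac_exists (z : F) : exists g1 g2, [/\ over g1, over g2, ev g2 != 0 & z = ev g1 / ev g2].
Proof. by have [_ [_ [[g1 h1 ->] [g2 h2 ->] n2 ->]]] := hfrac z; exists g1, g2. Qed.

Lemma delta_derivation : (exists pi, uniformiser v pi) -> is_derivation io delta.
Proof.
move=> [pi [pi0 vpi]].
have dM a b : delta (a * b) = a *: delta b + b *: delta a.
  have [g1 [g2 [h1 h2 n2 ->]]] := frac_exists a; have [k1 [k2 [l1 l2 p2 ->]]] := frac_exists b.
  rewrite !deltaE // mulf_div -!evalxM deltaE ?evalxM ?mulf_neq0 //; [|exact: poly_overM|exact: poly_overM].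
  by rewrite /dfrac !dpolM !evalxD !evalxM /GRing.scale /=; field; rewrite n2 p2.
have dC c : vring v c -> delta (io c) = 0.
  move=> hc; have -> : io c = ev c%:MP / ev 1 by rewrite evalxC evalx1 divr1.
  rewrite deltaE ?evalx1 ?oner_neq0 //; [|exact: poly_overC|exact: poly_over1].
  by rewrite /dfrac -mpolyC1 !dpolC evalx0 !mulr0 subrr mul0r.
split=> // [a b|c].
  have [g1 [g2 [h1 h2 n2 ->]]] := frac_exists a; have [k1 [k2 [l1 l2 p2 ->]]] := frac_exists b.
  rewrite !deltaE // addf_div // -!evalxM -evalxD deltaE ?evalxM ?mulf_neq0 //; last 2 first.
  - by apply: poly_overD => //; exact: poly_overM.
  - exact: poly_overM.
  by rewrite /dfrac !dpolD !dpolM !evalxD !evalxM; field; rewrite n2 p2.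
(* A constant outside the valuation ring has its inverse inside, and the product rule for c c^-1 = 1
   concludes. *)
have [hc|hc] := EM (vring v c); first exact: dC.
have c0 : c != 0 by apply/eqP => e; apply: hc; rewrite e; left.
have hV : vring v c^-1.
  right; rewrite valV //; have : ~ (0 <= v c) by move=> h; apply: hc; right.
  by move/negP; rewrite -ltNge; move: (v c) => k; lia.
have ioc0 : io c != 0 by rewrite fmorph_eq0.
have := dM (io c) (io c)^-1; rewrite divff // -fmorphV (dC _ hV) -(rmorph1 io) dC; last exact: vge1.
rewrite scaler0 add0r => /esym/eqP; rewrite /GRing.scale /= mulf_eq0 fmorph_eq0 invr_eq0.
by rewrite (negPf c0) => /eqP.
Qed.

End Expansions.

Section Localised.
Variables (K : fieldType) (v : K -> int) (hv : discrete_valuation v).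
Variables (F : fieldType) (io : {rmorphism K -> F}).
Variables (m : nat) (x : 'I_m.+1 -> F) (f : 'I_m -> {mpoly K[m.+1]}).
Hypothesis hpres : is_presentation v io x f.
Variable V : cdvField.
Notation w := (@cdv_val V).
Let hw := @cdv_valP V.
Notation mpol := {mpoly K[m.+1]}.
Notation over := (poly_over (vring v)).
Notation ev g := (evalx io x g).
Variables (X : mpol -> lau V) (hX : is_expansion v f X).

Definition gfrac z g1 g2 := [/\ over g1, over g2, ~ ediv 1 (X g2) & z = ev g1 / ev g2].
(* The local ring of [R[x]] at the prime ideal where X vanishes modulo pi. *)
Definition gloc : set F := [set z | exists g1 g2, gfrac z g1 g2].

Lemma ev_neq0 g : over g -> ~ ediv 1 (X g) -> ev g != 0.
Proof.
move=> hg ng; apply/eqP => e; apply: ng.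
have h0 : over (0 : mpol) by exact: poly_over0.
rewrite (exp_eq hv hpres hX hg h0).
  by rewrite (exp0 hX); exact: ediv0.
by rewrite evalx0.
Qed.

Lemma exp_nonunitM g h : over g -> over h -> ~ ediv 1 (X g) -> ~ ediv 1 (X h) -> ~ ediv 1 (X (g * h)).
Proof. by move=> hg hh ng nh; rewrite (expM hX) // => /ediv1M[]. Qed.

Lemma gfracM z z' g1 g2 h1 h2 : gfrac z g1 g2 -> gfrac z' h1 h2 ->
  gfrac (z * z') (g1 * h1) (g2 * h2).
Proof.
move=> [a1 a2 a3 ->] [b1 b2 b3 ->]; split; [exact: poly_overM|exact: poly_overM| |].
  exact: exp_nonunitM.
by rewrite !evalxM mulf_div.
Qed.

Lemma gfracB z z' g1 g2 h1 h2 : gfrac z g1 g2 -> gfrac z' h1 h2 ->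
  gfrac (z - z') (g1 * h2 - h1 * g2) (g2 * h2).
Proof.
move=> [a1 a2 a3 ->] [b1 b2 b3 ->]; split; [|exact: poly_overM| |].
- by apply: poly_overB => //; exact: poly_overM.
- exact: exp_nonunitM.
by rewrite evalxB !evalxM -mulNr addf_div ?ev_neq0 // mulNr.
Qed.

Lemma gfrac_ev g : over g -> gfrac (ev g) g 1.
Proof.
move=> hg; split=> //; [exact: poly_over1| |by rewrite evalx1 divr1].
by rewrite (exp1 hX); apply: ediv1_unit (mulr1 1).
Qed.

Lemma gloc_subring : is_subring gloc.
Proof.
split=> [|z z' [g1 [g2 h]] [g1' [g2' h']]|z z' [g1 [g2 h]] [g1' [g2' h']]].
- by exists 1, 1; rewrite -(evalx1 io x); apply: gfrac_ev; exact: poly_over1.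
- by exists (g1 * g2' - g1' * g2), (g2 * g2'); exact: gfracB.
- by exists (g1 * g1'), (g2 * g2'); exact: gfracM.
Qed.

Lemma gloc_ev g : over g -> gloc (ev g).
Proof. by move=> hg; exists g, 1; exact: gfrac_ev. Qed.

Lemma gloc_delta z : gloc z -> gloc (delta v io x f z).
Proof.
move=> [g1 [g2 [h1 h2 n2 ->]]]; rewrite deltaE ?ev_neq0 //.
exists (g2 * dpol f g1 - g1 * dpol f g2), (g2 ^+ 2); split.
- by apply: poly_overB => //; apply: poly_overM => //; exact: (over_dpol hv hpres).
- by rewrite expr2; exact: poly_overM.
- by rewrite expr2; exact: exp_nonunitM.
by rewrite /dfrac evalxB expr2 !evalxM -expr2.
Qed.

Section Extend.
Variables (th : mpol -> lau V) (hth : is_expansion v f th).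
Hypothesis compat : forall g, over g -> ~ ediv 1 (X g) -> ~ ediv 1 (th g).

(** Extends [th] to [gloc]: the equation has a unique solution because [compat] makes [th g2] a
    unit. *)
Definition ext z : lau V := xget 0 [set e | exists g1 g2, gfrac z g1 g2 /\ th g2 * e = th g1].

Let th_neq0 g : over g -> ~ ediv 1 (X g) -> th g != 0.
Proof. by move=> hg /(compat hg) h; apply/eqP => e; apply: h; rewrite e; exact: ediv0. Qed.

Lemma extP z g1 g2 : gfrac z g1 g2 -> th g2 * ext z = th g1.
Proof.
move=> [h1 h2 n2 ez]; have u2 : th g2 \is a GRing.unit by apply/lau_unitE; exact: compat.
have : exists e, [set e | exists g1 g2, gfrac z g1 g2 /\ th g2 * e = th g1] e.
  by exists (th g1 / th g2), g1, g2; rewrite mulrCA divrr ?mulr1.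
case/(xgetPex 0); rewrite -/(ext z) => g1' [g2' [[h1' h2' n2' ez'] e']].
have : th (g1 * g2') = th (g1' * g2).
  apply: (exp_eq hv hpres hth); [exact: poly_overM|exact: poly_overM|].
  by rewrite !evalxM; apply/eqP; rewrite -eqr_div ?ev_neq0 // -ez -ez'.
rewrite !(expM hth) // => e; apply: (mulIf (th_neq0 h2' n2')); rewrite e -e'; ring.
Qed.

Lemma ext_ev g : over g -> ext (ev g) = th g.
Proof. by move=> hg; have := extP (gfrac_ev hg); rewrite (exp1 hth) mul1r. Qed.

Lemma ext_unique z g1 g2 e : gfrac z g1 g2 -> th g2 * e = th g1 -> ext z = e.
Proof.
move=> h e1; have [_ h2 n2 _] := h; apply: (mulfI (th_neq0 h2 n2)).
by rewrite (extP h).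
Qed.

Lemma extM z z' : gloc z -> gloc z' -> ext (z * z') = ext z * ext z'.
Proof.
move=> [g1 [g2 h]] [g1' [g2' h']]; apply: ext_unique (gfracM h h') _.
have [a1 a2 _ _] := h; have [b1 b2 _ _] := h'.
by rewrite !(expM hth) // -(extP h) -(extP h'); ring.
Qed.

Lemma extB z z' : gloc z -> gloc z' -> ext (z - z') = ext z - ext z'.
Proof.
move=> [g1 [g2 h]] [g1' [g2' h']]; apply: ext_unique (gfracB h h') _.
have [a1 a2 _ _] := h; have [b1 b2 _ _] := h'.
have o1 := poly_overM hv a1 b2; have o2 := poly_overM hv b1 a2.
by rewrite (expB hv hth) // !(expM hth) // -(extP h) -(extP h'); ring.
Qed.

Lemma ext1 : ext 1 = 1.
Proof. by rewrite -(evalx1 io x) ext_ev ?(exp1 hth) //; exact: poly_over1. Qed.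
Lemma ext0 : ext 0 = 0.
Proof. by rewrite -(subrr 1) extB ?subrr //; exact: (sub1 gloc_subring). Qed.
Lemma extD z z' : gloc z -> gloc z' -> ext (z + z') = ext z + ext z'.
Proof.
move=> h h'; have hN := subN gloc_subring h'.
have eN : ext (- z') = - ext z'.
  by rewrite -sub0r extB ?ext0 ?sub0r //; exact: (sub0 gloc_subring).
by rewrite -{1}[z']opprK extB // eN opprK.
Qed.
Lemma ext_sum (I : Type) (r : seq I) (G : I -> F) : (forall i, gloc (G i)) ->
  ext (\sum_(i <- r) G i) = \sum_(i <- r) ext (G i).
Proof.
move=> hG; elim: r => [|i r IH]; first by rewrite !big_nil ext0.
by rewrite !big_cons extD ?IH //; apply: (sub_sum gloc_subring).
Qed.

(** [exp_cramer] for numerator and denominator, combined by the quotient rule; the square of [th g2]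
    is cancelled. *)
Lemma ext_cramer l z : gloc z ->
  th (Dpol f l) * der (ext z) = ext (delta v io x f z) * der (th 'X_l).
Proof.
move=> hz; have [g1 [g2 h]] := hz; have [h1 h2 n2 ez] := h.
have [d1 d2] := (over_dpol hv hpres h1, over_dpol hv hpres h2).
have c1 := exp_cramer hv hpres hth l h1; have c2 := exp_cramer hv hpres hth l h2.
have hd : gfrac (delta v io x f z) (g2 * dpol f g1 - g1 * dpol f g2) (g2 ^+ 2).
  rewrite ez deltaE ?ev_neq0 //; split.
  - by apply: poly_overB => //; apply: poly_overM.
  - by rewrite expr2; exact: poly_overM.
  - by rewrite expr2; exact: exp_nonunitM.
  by rewrite /dfrac evalxB expr2 !evalxM -expr2.
have o1 := poly_overM hv h2 d1; have o2 := poly_overM hv h1 d2.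
have ed := extP hd; rewrite (expB hv hth o1 o2) expr2 (expM hth h2 h2) (expM hth h2 d1) (expM hth h1 d2) in ed.
have := congr1 (@der V) (extP h); rewrite derM => e2.
have t2 := th_neq0 h2 n2; apply: (mulfI t2); apply: (mulfI t2).
have key (A B dB D y c q1 q2 dA dC : lau V) : dA * B + A * dB = dC -> D * dC = q1 * c ->
    D * dA = q2 * c -> A * A * y = A * q1 - A * B * q2 ->
    A * (A * (D * dB)) = A * (A * (y * c)).
  move=> k1 k2 k3 k4; have -> : A * (A * (y * c)) = (A * A * y) * c by ring.
  have -> : A * (A * (D * dB)) = A * (D * (dA * B + A * dB)) - A * B * (D * dA) by ring.
  by rewrite k4 k1 k2 k3; ring.
rewrite -(extP h) in ed.
exact: (key _ _ _ _ _ _ _ _ _ _ e2 c1 c2 ed).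
Qed.

End Extend.

(** The maximal minors generate the unit ideal modulo pi and are multiples of the [Dpol l], so these
    cannot all vanish modulo pi. *)
Lemma ediv_minor (pi : K) : vring v pi -> ediv 1 (X pi%:MP) ->
  minors_unit v io x f [set z | exists2 y, alg v io x y & z = io pi * y] ->
  exists l, ~ ediv 1 (X (Dpol f l)).
Proof.
move=> hpi Xpi [c hc [_ [y hy ->]] e]; apply: contrapT => nl.
have hD l : ediv 1 (X (Dpol f l)).
  by apply: contrapT => h; apply: nl; exists l.
have oP := over_Dpol hv hpres.
have odet n (M : 'M[mpol]_n) : (forall i j, M i j = 0 \/ M i j = 1) -> over (\det M).
  move=> hM; apply: poly_over_sum => // s _; apply: poly_overM => //; last first.
    apply: poly_over_prod => // i _.
    by case: (hM i (perm.fun_of_perm s i)) => ->; [exact: poly_over0|exact: poly_over1].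
  case: (perm.odd_perm s); rewrite ?expr1 ?expr0; last exact: poly_over1.
  by apply: poly_overN => //; exact: poly_over1.
have hs s : over (c s * \det (colsub s (jacobian f))) /\
    ediv 1 (X (c s * \det (colsub s (jacobian f)))).
  have [l [E [hE ->]]] := det_colsub_minor (jacobian f) s.
  have o1 := odet _ E hE; have o2 := poly_overM hv (oP l) o1.
  split; first exact: poly_overM.
  rewrite (expM hX) // -/(Dpol f l) (expM hX) //.
  by apply: edivMl; exact: edivMr.
have o0 : over (\sum_s c s * \det (colsub s (jacobian f))).
  by apply: poly_over_sum => // s _; exact: (hs s).1.
have h1 : ediv 1 (X (\sum_s c s * \det (colsub s (jacobian f)))).
  by rewrite (exp_sum hv hX) => [|s _]; [apply: ediv_sum => s _; exact: (hs s).2|exact: (hs s).1].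
have o1 : over (1 : mpol) by exact: poly_over1.
have o2 : over (pi%:MP : mpol) by exact: poly_overC.
have o3 := poly_overM hv o2 hy.
have : X (\sum_s c s * \det (colsub s (jacobian f))) = X (1 + pi%:MP * y).
  apply: (exp_eq hv hpres hX) => //; first exact: poly_overD.
  by rewrite evalxD evalx1 evalxM evalxC -e addrC subrK.
rewrite (expD hX) // (expM hX) // (exp1 hX) => e1; rewrite e1 in h1.
apply: (ediv1_unit (mulr1 (1 : lau V))).
by have := edivB h1 (edivMr (X y) Xpi); rewrite addrK.
Qed.

Section Transfer.
Variables (th : mpol -> lau V) (hth : is_expansion v f th).
Hypothesis compat : forall g, over g -> ~ ediv 1 (X g) -> ~ ediv 1 (th g).
Variables (Om : lmodType F) (d : F -> Om) (hd : is_kaehler io d).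
Hypothesis hfrac : has_fraction_field (alg v io x).
Variables (l : 'I_m.+1) (hl : ~ ediv 1 (X (Dpol f l))).
Hypothesis hpi : exists pi, uniformiser v pi.

(* The universal property of [Om] turns the relation into one between values of
   the derivation [delta], which [th] maps to multiples of those of [der]. *)
Lemma ext_form (b : 'I_m.+1 -> mpol) u r (a a' : 'I_r -> F) :
  (forall k, over (b k)) -> gloc u -> (forall i, gloc (a i)) -> (forall i, gloc (a' i)) ->
  form_of io d x b = d u + \sum_i a i *: d (a' i) ->
  \sum_k th (b k) * der (th 'X_k) =
  der (ext th u) + \sum_i ext th (a i) * der (ext th (a' i)).
Proof.
move=> hb hu ha ha' e.
have [_ /(_ F^o _ (delta_derivation hv hpres hfrac hpi))[phi hphi _]] := hd.
have := congr1 phi e; rewrite linearD !linear_sum /= hphi.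
have D0 : th (Dpol f l) != 0.
  apply/eqP => h; apply: (compat (over_Dpol hv hpres l) hl); rewrite h; exact: ediv0.
have gx k : gloc (x k) by rewrite -(evalxX io x k); apply: gloc_ev; exact: poly_overX.
under eq_bigr do rewrite linearZ /= hphi.
under [in RHS]eq_bigr do rewrite linearZ /= hphi.
move=> /(congr1 (ext th)).
have gb k : gloc (ev (b k)) by exact: gloc_ev.
rewrite (ext_sum hth compat) => [|k]; last first.
  by apply: (subM gloc_subring) => //; exact: gloc_delta.
rewrite (extD hth compat); last 2 first.
- exact: gloc_delta.
- apply: (sub_sum gloc_subring) => i _; apply: (subM gloc_subring) => //; exact: gloc_delta.
rewrite (ext_sum hth compat) => [|i]; last first.
  by apply: (subM gloc_subring) => //; exact: gloc_delta.
move=> e2; apply: (mulfI D0); rewrite mulrDr !mulr_sumr.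
rewrite (ext_cramer hth compat) //.
have -> : \sum_i th (Dpol f l) * (ext th (a i) * der (ext th (a' i))) =
    (\sum_i ext th (a i *: (delta v io x f (a' i) : F^o))) * der (th 'X_l).
  rewrite mulr_suml; apply: eq_bigr => i _.
  rewrite (extM hth compat) //; last exact: gloc_delta.
  by rewrite mulrCA (ext_cramer hth compat) // mulrA.
rewrite -mulrDl -e2 mulr_suml; apply: eq_bigr => k _.
rewrite (extM hth compat) //; last exact: gloc_delta.
rewrite (ext_ev hth compat) // mulrCA -mulrA; congr (_ * _).
rewrite -(ext_cramer hth compat) //; congr (_ * der _).
by rewrite -(evalxX io x k) (ext_ev hth compat) //; exact: poly_overX.
Qed.

End Transfer.
End Localised.

(** * The local ring of an end *)

Section ValuationRings.
Variables (F : fieldType) (V : set F) (hV : is_valuation_ring V).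
Let VS : is_subring V. Proof. by case: hV. Qed.
Let Vtot a : a != 0 -> V a \/ V a^-1. Proof. by case: hV => _; exact. Qed.

Lemma valring_maxP a : V a -> a != 0 -> maxideal V a <-> ~ V a^-1.
Proof. by move=> ha /eqP a0; split=> [[_ []]//|h]; split=> //; right. Qed.

Variables (A : set F) (hA : is_subring A) (AV : A `<=` V).
Definition center_ideal : set F := [set a | A a /\ maxideal V a].

Lemma center_prime : is_prime_ideal A center_ideal.
Proof.
have max0 : maxideal V 0 by split; [exact: (sub0 VS)|left].
have max1 : ~ maxideal V 1.
  by move=> [_ []]; [move/eqP; rewrite oner_eq0|rewrite invr1; apply; exact: (sub1 VS)].
split; first by split=> [a []//||[]//]; split=> //; exact: (sub0 hA).
split=> [a b [ha ma] [hb mb]|a b ha [hb mb]|a b ha hb [_ mab]].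
- split; first exact: (subD hA).
  have Va := AV ha; have Vb := AV hb.
  have [->|a0] := eqVneq a 0; first by rewrite add0r.
  have [->|b0] := eqVneq b 0; first by rewrite addr0.
  split; first exact: (subD VS).
  have [->|ab0] := eqVneq (a + b) 0; [by left|right=> h].
  have na := (valring_maxP Va a0).1 ma; have nb := (valring_maxP Vb b0).1 mb.
  have q0 : a / b != 0 by rewrite mulf_neq0 // invr_neq0.
  case: (Vtot q0) => hq.
    apply: nb; have -> : b^-1 = (1 + a / b) * (a + b)^-1 by field; rewrite ?b0 ?ab0.
    by apply: (subM VS) => //; apply: (subD VS) => //; exact: (sub1 VS).
  apply: na; have -> : a^-1 = (1 + (a / b)^-1) * (a + b)^-1.
    by rewrite invf_div; field; rewrite ?a0 ?b0 ?ab0.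
  by apply: (subM VS) => //; apply: (subD VS) => //; exact: (sub1 VS).
- split; first exact: (subM hA).
  have [->|a0] := eqVneq a 0; first by rewrite mul0r.
  have [->|b0] := eqVneq b 0; first by rewrite mulr0.
  apply/valring_maxP; [exact: (subM VS (AV ha) (AV hb))|by rewrite mulf_neq0|move=> h].
  apply: ((valring_maxP (AV hb) b0).1 mb).
  have -> : b^-1 = a * (a * b)^-1 by field; rewrite a0 b0.
  by apply: (subM VS) => //; exact: AV.
have [->|a0] := eqVneq a 0; first by left; split=> //; exact: (sub0 hA).
have [->|b0] := eqVneq b 0; first by right; split=> //; exact: (sub0 hA).
apply: contrapT => /not_orP[na nb].
have ab0 : a * b != 0 by rewrite mulf_neq0.
apply: ((valring_maxP (subM VS (AV ha) (AV hb)) ab0).1 mab).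
rewrite invfM; apply: (subM VS); apply: contrapT => h.
  by apply: na; split=> //; apply/valring_maxP => //; exact: AV.
by apply: nb; split=> //; apply/valring_maxP => //; exact: AV.
Qed.

Lemma center_dominates : dominates V (localisation A center_ideal).
Proof.
have sub : localisation A center_ideal `<=` V.
  move=> _ [a [b [ha hb nb ->]]]; have b0 := prime_neq0 center_prime nb.
  apply: (subM VS); first exact: AV.
  apply: contrapT => h; apply: nb; split=> //.
  by apply/valring_maxP => //; exact: AV.
split=> // z mz; have [hz _] := mz.
have [a [b [[ha ma] hb nb ez]]] := (loc_maxP hA center_prime hz).1 mz.
have [z0|z0] := eqVneq z 0; first by rewrite z0; split; [exact: (sub0 VS)|left].
apply/valring_maxP => //; first exact: sub.
have b0 := prime_neq0 center_prime nb.
have a0 : a != 0 by apply/eqP => a0; move: z0; rewrite ez a0 mul0r eqxx.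
move=> h; apply: ((valring_maxP (AV ha) a0).1 ma).
have -> : a^-1 = z^-1 * b^-1 by rewrite ez; field; rewrite a0 b0.
apply: (subM VS) => //; apply: contrapT => h'; apply: nb; split=> //.
by apply/valring_maxP => //; exact: AV.
Qed.

End ValuationRings.

Section EndExpansion.
Variables (K : fieldType) (v : K -> int) (hv : discrete_valuation v).
Variables (pi : K) (hpi : uniformiser v pi).
Variables (F : fieldType) (io : {rmorphism K -> F}) (C : set (set F)).
Hypothesis hproper : is_proper v io C.
Variables (m : nat) (x : 'I_m.+1 -> F) (f : 'I_m -> {mpoly K[m.+1]}).
Hypothesis hA : is_affine_open v io C (alg v io x).
Hypothesis hpres : is_presentation v io x f.
Variables (L : fieldExtType K) (w : L -> int) (hw : discrete_valuation w) (hwc : vcomplete w).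
Hypothesis hLK : forall c : K, c != 0 -> w c%:A = v c.
Variables (FL : fieldType) (iF : {rmorphism F -> FL}) (iL : {rmorphism L -> FL}).
Hypothesis hio : forall c : K, iF (io c) = iL c%:A.
Variables (n : nat) (y : 'I_n -> F).
Notation B := (alg v io y).
Hypothesis hB : is_affine_open v io C B.
Notation BB := (base_change w iF iL B).
Variables (I : set FL) (hI : is_prime_ideal BB I).
Notation O := (localisation BB I).
Variables (rho : FL -> L) (hrho : is_section w iL O rho).
Variables (t : FL) (ht : is_section_equation O rho t).
Variables (xi : mps K m.+1 -> int -> L).
Hypothesis hxi : is_expansion_map v io w iF iL x f O t xi.
Notation V := (CDVField hw hwc).
Notation mpol := {mpoly K[m.+1]}.
Notation over := (poly_over (vring v)).
Notation ev g := (evalx io x g).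
Notation dag := (dagger v (n := m.+1)).

Let hBS : is_subring B. Proof. exact: alg_subring. Qed.
Let hBB : is_subring BB. Proof. exact: bc_subring. Qed.
Let hO : is_subring O. Proof. exact: loc_subring. Qed.
Let O_L c : vring w c -> O (iL c).
Proof. by move=> hc; apply: loc_in => //; exact: bc_L. Qed.
Notation sO := (sO hw hwc iL O t).

Definition point : set F := localisation B [set a | B a /\ I (iF a)].
Let hJ : is_prime_ideal B [set a | B a /\ I (iF a)].
Proof. exact: (contraction_prime hw hBS hI). Qed.

Lemma point_subring : is_subring point. Proof. exact: loc_subring. Qed.
Lemma point_curve : C point.
Proof. by have [_ _] := hB; apply; exists [set a | B a /\ I (iF a)]. Qed.
Lemma point_map b : point b -> O (iF b). Proof. exact: contraction_map. Qed.
Lemma point_alg b : B b -> point b. Proof. by move=> hb; exact: (loc_in hBS hJ). Qed.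
Lemma point_const c : vring v c -> point (io c).
Proof. by move=> hc; apply: point_alg; exact: alg_const. Qed.

(** Krull's intersection theorem for the noetherian base change; it makes the expansion maps
    injective. *)
Lemma sO_eq0 b : O b -> sO b = 0 -> b = 0.
Proof.
move=> hb e; have [Ot t0 _] := ht.
have hN := @base_change_noetherian _ _ hv _ _ _ _ hw hLK _ _ _ hio _ y.
have nt := t_nonunit hw hO hrho ht.
apply: (krull_intersection (c := b) hBB hI hN Ot t0 nt) => N.
by apply: (sO_div (hw := hw) (hwc := hwc) hO O_L hrho ht hb) => i _; rewrite e lau0E.
Qed.

Definition xiE (a : mps K m.+1) : lau V := xget 0 [set e : lau V | lcoef e = xi a].
Lemma xiP a : dag a -> lcoef (xiE a) = xi a.
Proof.
have [h _ _ _ _] := hxi; move=> /h ha.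
by apply: (xgetPex 0 (P := [set e : lau V | lcoef e = xi a])); exists (@Lau V (xi a) ha).
Qed.
Lemma xi_ext a (e : lau V) : dag a -> xi a = e -> xiE a = e.
Proof. by move=> ha h; apply: lau_ext => i; rewrite xiP // h. Qed.

Lemma xiD a b : dag a -> dag b -> xiE (a + b) = xiE a + xiE b.
Proof.
have [_ _ h _ _] := hxi; move=> ha hb; apply: xi_ext; first exact: daggerD.
by rewrite (h _ _ ha hb).1; apply/funext => i; rewrite lauD !xiP.
Qed.
Lemma xiM a b : dag a -> dag b -> xiE (a * b) = xiE a * xiE b.
Proof.
have [_ _ h _ _] := hxi; move=> ha hb; apply: xi_ext; first exact: daggerM.
by rewrite (h _ _ ha hb).2 lauM !xiP.
Qed.
Lemma xi1 : xiE 1 = 1.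
Proof.
have [_ h _ _ _] := hxi; apply: xi_ext; first exact: dagger1.
by rewrite h; apply/funext => i; rewrite lau1E.
Qed.
Lemma xi_sum (J : Type) (r : seq J) (P : pred J) (G : J -> mps K m.+1) :
  (forall i, P i -> dag (G i)) ->
  xiE (\sum_(i <- r | P i) G i) = \sum_(i <- r | P i) xiE (G i).
Proof.
move=> hG; pose Q (a : mps K m.+1) (e : lau V) := dag a /\ xiE a = e.
suff [] : Q (\sum_(i <- r | P i) G i) (\sum_(i <- r | P i) xiE (G i)) by [].
apply: (big_ind2 Q) => [|a e b e' [ha <-] [hb <-]|i Pi].
- split; first exact: dagger0.
  by apply: (addrI (xiE 0)); rewrite -xiD ?addr0 //; exact: dagger0.
- by split; [exact: daggerD|exact: xiD].
- by split=> //; exact: hG.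
Qed.
Lemma xiX a k : dag a -> xiE (a ^+ k) = xiE a ^+ k.
Proof.
by move=> ha; elim: k => [|k IH]; rewrite ?xi1 // !exprS xiM ?IH //; exact: daggerX.
Qed.

Definition poly_expansion (g : mpol) : lau V := xiE (mps_of g).
Notation X := poly_expansion.
Let dX g : over g -> dag (mps_of g). Proof. by move=> hg; exact: dagger_poly. Qed.

Lemma poly_expansion_rel g b c : over g -> O b -> O c -> c != 0 -> iF (ev g) = b / c -> X g * sO c = sO b.
Proof.
move=> hg hb hc c0 e; have [_ _ _ _ h] := hxi; apply: lau_ext => i.
have e1 := h g b c (sO b) (sO c) hg hb hc c0 (compl_image (sOP hw hwc hO O_L hrho ht hb))
  (compl_image (sOP hw hwc hO O_L hrho ht hc)) e.
by rewrite lauM xiP ?e1 //; exact: dX.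
Qed.

Lemma poly_expansion_const c : vring v c -> X c%:MP = cst (c%:A : V).
Proof.
move=> hc; have hc' : vring w c%:A by exact/(vge_LK hLK).
have O1 := sub1 hO.
have := @poly_expansion_rel c%:MP (iL c%:A) 1 (poly_overC hc) (O_L hc') O1 (oner_neq0 _).
rewrite evalxC hio divr1 => /(_ erefl).
by rewrite (sO1 hw hwc hO O_L hrho ht) mulr1 (sO_L hw hwc hO O_L hrho ht).
Qed.

Lemma poly_expansionP : is_expansion v f X.
Proof.
have [_ _ _ hf _] := hxi; have [overf _] := hpres.
split=> [g h hg hh|g h hg hh||j|c hc].
- by rewrite /poly_expansion rmorphD xiD //; exact: dX.
- by rewrite /poly_expansion rmorphM xiM //; exact: dX.
- by rewrite /poly_expansion rmorph1 xi1.
- apply: xi_ext; first exact: dX.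
  by rewrite hf; apply/funext => i; rewrite lau0E.
by rewrite poly_expansion_const // der_cst.
Qed.
Let hX := poly_expansionP.

Let fracB z : exists a b, [/\ B a, B b, b != 0 & z = a / b].
Proof. by have [_ h _] := hB; exact: h. Qed.
Let OB b : B b -> O (iF b). Proof. by move=> hb; apply: point_map; exact: point_alg. Qed.

Lemma poly_expansion_eq0 g : over g -> X g = 0 -> ev g = 0.
Proof.
move=> hg e; have [a [b [ha hb b0 ez]]] := fracB (ev g).
have ib0 : iF b != 0 by rewrite fmorph_eq0.
have := @poly_expansion_rel g (iF a) (iF b) hg (OB ha) (OB hb) ib0.
rewrite ez fmorph_div => /(_ erefl); rewrite e mul0r => /esym/(sO_eq0 (OB ha))/eqP.
by rewrite fmorph_eq0 => /eqP ->; rewrite mul0r.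
Qed.

(** The map [xi] is tied to O only through fractions over O. So numerator and denominator are
    written as fractions over B, whose denominators cancel by injectivity of [sO]. *)
Lemma poly_expansion_point g1 g2 z : over g1 -> over g2 -> ev g2 != 0 -> point z -> z = ev g1 / ev g2 ->
  X g2 * sO (iF z) = X g1.
Proof.
move=> h1 h2 n2 hz ez.
have [a1 [b1 [ha1 hb1 b10 e1]]] := fracB (ev g1).
have [a2 [b2 [ha2 hb2 b20 e2]]] := fracB (ev g2).
have ib1 : iF b1 != 0 by rewrite fmorph_eq0.
have ib2 : iF b2 != 0 by rewrite fmorph_eq0.
have r1 : X g1 * sO (iF b1) = sO (iF a1).
  by apply: poly_expansion_rel => //; [exact: OB|exact: OB|rewrite e1 fmorph_div].
have r2 : X g2 * sO (iF b2) = sO (iF a2).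
  by apply: poly_expansion_rel => //; [exact: OB|exact: OB|rewrite e2 fmorph_div].
have Oz := point_map hz.
have s0 b : B b -> b != 0 -> sO (iF b) != 0.
  by move=> hb /eqP b0; apply/eqP => /(sO_eq0 (OB hb))/eqP; rewrite fmorph_eq0 => /eqP.
have a20 : a2 != 0 by apply/eqP => a20; move: n2; rewrite e2 a20 mul0r eqxx.
have : iF z * iF a2 * iF b1 = iF a1 * iF b2.
  by rewrite -!rmorphM ez e1 e2; congr (iF _); field; rewrite a20 b20 b10.
move=> /(congr1 sO); have Oza : O (iF z * iF a2) by apply: (subM hO) => //; exact: OB.
have sM := sOM hw hwc hO O_L hrho ht.
rewrite (sM _ _ Oza (OB hb1)) (sM _ _ Oz (OB ha2)) (sM _ _ (OB ha1) (OB hb2)) -r1 -r2 => e.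
apply: (mulIf (s0 _ hb2 b20)); apply: (mulIf (s0 _ hb1 b10)).
have -> : X g2 * sO (iF z) * sO (iF b2) * sO (iF b1) =
  sO (iF z) * (X g2 * sO (iF b2)) * sO (iF b1) by ring.
by rewrite e; ring.
Qed.

(* The valuation ring of the Gauss valuation, pulled back by X. *)
Definition gauss : set F := [set z | exists g1 g2,
  [/\ over g1, over g2, ev g2 != 0, z = ev g1 / ev g2 & exists e, X g1 = e * X g2]].

Let Afrac : has_fraction_field (alg v io x). Proof. by case: hA. Qed.

Lemma gauss_valuation_ring : is_valuation_ring gauss.
Proof.
split; last first.
  move=> a a0; have [g1 [g2 [h1 h2 n2 ea]]] := frac_exists Afrac a.
  have n1 : ev g1 != 0 by apply/eqP => n1; move: a0; rewrite ea n1 mul0r eqxx.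
  case: (lau_div_total (X g1) (X g2)) => h; [left|right].
    by exists g1, g2.
  by exists g2, g1; split=> //; rewrite ea invf_div.
split=> [|z z' [g1 [g2 [h1 h2 n2 -> [e he]]]] [k1 [k2 [l1 l2 p2 -> [e' he']]]]
  |z z' [g1 [g2 [h1 h2 n2 -> [e he]]]] [k1 [k2 [l1 l2 p2 -> [e' he']]]]].
- have o1 : over (1 : mpol) by exact: poly_over1.
  by exists 1, 1; rewrite !evalx1 divr1 oner_neq0; split=> //; exists 1; rewrite mul1r.
- have o1 := poly_overM hv h1 l2; have o2 := poly_overM hv l1 h2.
  exists (g1 * k2 - k1 * g2), (g2 * k2); split.
  + exact: poly_overB.
  + exact: poly_overM.
  + by rewrite evalxM mulf_neq0.
  + by rewrite evalxB !evalxM -mulNr addf_div // mulNr.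
  by exists (e - e'); rewrite (expB hv hX) // !(expM hX) // he he'; ring.
exists (g1 * k1), (g2 * k2); split; [exact: poly_overM|exact: poly_overM| | |].
- by rewrite evalxM mulf_neq0.
- by rewrite !evalxM mulf_div.
by exists (e * e'); rewrite !(expM hX) // he he'; ring.
Qed.

Lemma gauss_ev g : over g -> gauss (ev g).
Proof.
move=> hg; exists g, 1; rewrite evalx1 oner_neq0 divr1; split=> //; first exact: poly_over1.
by exists (X g); rewrite (exp1 hX) mulr1.
Qed.

Lemma gauss_point z : point z -> gauss z.
Proof.
move=> hz; have [g1 [g2 [h1 h2 n2 ez]]] := frac_exists Afrac z.
exists g1, g2; split=> //; exists (sO (iF z)).
by rewrite -(poly_expansion_point h1 h2 n2 hz ez) mulrC.
Qed.

Lemma gauss_inv g : over g -> ev g != 0 -> gauss (ev g)^-1 -> ~ ediv 1 (X g).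
Proof.
move=> hg nz [g1 [g2 [h1 h2 n2 e [c hc]]]].
have X0 : X g2 != 0 by apply/eqP => /(poly_expansion_eq0 h2)/eqP; rewrite (negPf n2).
apply: (@ediv1_unit _ _ c); apply: (mulIf X0); rewrite mul1r -mulrA -hc -(expM hX) //.
apply: (exp_eq hv hpres hX) => //; first exact: poly_overM.
rewrite evalxM; have -> : ev g1 = ev g2 / ev g by rewrite e mulrC divfK.
by rewrite mulrC divfK.
Qed.

(** R[x] and B both lie in the Gauss valuation ring, and its centres on the two charts are points of
    C that it dominates. By uniqueness of the centre the two local rings coincide. P lies in the
    second one, because a unit of P is a unit of the Gauss valuation ring. *)
Lemma point_gloc z : point z -> gloc v io x X z.
Proof.
have hV := gauss_valuation_ring.
have hAS : is_subring (alg v io x) by exact: alg_subring.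
have AV : alg v io x `<=` gauss by move=> _ [g hg ->]; exact: gauss_ev.
have BV : B `<=` gauss by move=> b hb; apply: gauss_point; exact: point_alg.
have pA := center_prime hV hAS AV; have pB := center_prime hV hBS BV.
have CA : C (localisation (alg v io x) (center_ideal gauss (alg v io x))).
  by have [_ _] := hA; apply; exists (center_ideal gauss (alg v io x)).
have CB : C (localisation B (center_ideal gauss B)).
  by have [_ _] := hB; apply; exists (center_ideal gauss B).
have [|P0 _ uniq] := hproper hV.
  by move=> c hc; rewrite -(evalxC io x); apply: gauss_ev; exact: poly_overC.
have eA := uniq _ CA (center_dominates hV hAS AV).
have eB := uniq _ CB (center_dominates hV hBS BV).
have sub : localisation (alg v io x) (center_ideal gauss (alg v io x)) `<=` gloc v io x X.
  move=> _ [_ [_ [[g1 h1 ->] [g2 h2 ->] nb ->]]]; exists g1, g2; split=> //.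
  have n2 := prime_neq0 pA nb.
  apply: gauss_inv => //; apply: contrapT => h; apply: nb; split; first by exists g2.
  by apply/(valring_maxP _ n2) => //; exact: gauss_ev.
move=> hz; apply: sub; rewrite eA -eB; have [a [b [ha hb nb ->]]] := hz.
exists a, b; split=> // -[_ mb]; have b0 := prime_neq0 hJ nb.
apply: ((valring_maxP (BV _ hb) b0).1 mb); apply: gauss_point.
exact: (loc_inv hBS hb nb).
Qed.

Lemma point_ext z : point z -> ext v io x X X z = sO (iF z).
Proof.
move=> hz; have [g1 [g2 h]] := point_gloc hz; have [h1 h2 n2 ez] := h.
apply: (ext_unique hv hpres hX hX _ h) => //.
apply: poly_expansion_point => //; exact: (ev_neq0 hv hpres hX).
Qed.

End EndExpansion.

(** * Integral coordinates on the base change *)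

Section TensorCoordinates.
Variables (K : fieldType) (v : K -> int) (hv : discrete_valuation v) (hvc : vcomplete v).
Variables (F : fieldType) (io : {rmorphism K -> F}).
Variables (L : fieldExtType K) (w : L -> int) (hw : discrete_valuation w).
Hypothesis hLK : forall c : K, c != 0 -> w c%:A = v c.
Variables (FL : fieldType) (iF : {rmorphism F -> FL}) (iL : {rmorphism L -> FL}).
Hypothesis hFL : is_tensor_field io iF iL.

Let hvw (c : K) : c != 0 -> w c%:A = 1%N%:Z * v c.
Proof. by move=> /hLK ->; rewrite mul1r. Qed.

(** As L is unramified over K, lifts of a basis of the residue field extension span the integers of
    L by completeness. *)
Lemma integral_basis : exists n (T : n.-tuple L), [/\ basis_of fullv T,
  forall i, vge w 0 (tnth T i) & forall c, vge w 0 c -> forall i, vge v 0 (coord T i c)].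
Proof.
have [n [E [hE span]]] := residue_basis hv hw (ltn0Sn 0) hvw; have [E0 _] := hE.
have gen := generators_span hv hw (ltn0Sn 0) hvw E0 span hvc.
pose T := [tuple E i | i < n]; exists n, T.
have freeT : free T.
  apply/freeP => k hk i; apply: (@vge_all0 _ v) => N.
  apply: (residue_free_coord hv hw (ltn0Sn 0) hvw hE).
  have -> : \sum_i k i *: E i = 0; last by left.
  by rewrite -[RHS]hk; apply: eq_bigr => j _; rewrite (nth_mktuple E).
have inT c : vge w 0 c -> c \in <<T>>%VS.
  move=> /gen[k _ ->]; apply: memv_suml => i _; apply/memvZ/memv_span.
  by apply/mapP; exists i; rewrite ?mem_enum.
have [_ _ [pi pi0 vpi]] := hv.
split=> [|i|c hc i].
- rewrite basisEfree freeT subvf /= -(eqP freeT); apply/dimvS.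
  apply/subvP => z _; have [->|z0] := eqVneq z 0; first exact: mem0v.
  have -> : z = (pi ^+ `|w z|)^-1 *: (pi ^+ `|w z| *: z).
    by rewrite scalerA mulVf ?scale1r // expf_neq0.
  apply/memvZ/inT; right; have -> : pi ^+ `|w z| *: z = (pi ^+ `|w z|)%:A * z.
    by rewrite -scalerAl mul1r.
  rewrite valM ?scalar_neq0 ?expf_neq0 //.
  by rewrite hLK ?expf_neq0 // valX // vpi; lia.
- by rewrite tnth_mktuple.
move: i; apply: (residue_free_coord hv hw (ltn0Sn 0) hvw hE).
have /coord_span := inT c hc => e; rewrite mulr0.
have <- : c = \sum_i coord T i c *: E i; last by [].
by rewrite {1}e; apply: eq_bigr => i _; rewrite (nth_mktuple E).
Qed.

(** F-linear coordinate forms on FL that map the base change of B back to B; they descend relations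
    from O to P. *)
Lemma tensor_coordinates : exists n (E : 'I_n -> L) (lam : 'I_n -> FL -> F),
  [/\ forall i, vge w 0 (E i),
      forall i z z', lam i (z + z') = lam i z + lam i z',
      forall i a z, lam i (iF a * z) = a * lam i z,
      forall i c, vge w 0 c -> exists2 k, vge v 0 k & lam i (iL c) = io k
    & forall z, z = \sum_i iF (lam i z) * iL (E i)].
Proof.
have [n [T [bT T0 hT]]] := integral_basis.
have [hio htens] := hFL; set b := vbasis _ in htens.
have /choice[co hco] : forall z, exists c : {ffun 'I_(\dim {:L}) -> F},
    z = \sum_i iF (c i) * iL b`_i /\
    forall c' : {ffun 'I_(\dim {:L}) -> F}, z = \sum_i iF (c' i) * iL b`_i -> c = c'.
  by move=> z; have [c hc] := htens z; exists c.
have coE z (c : 'I_(\dim {:L}) -> F) : z = \sum_i iF (c i) * iL b`_i -> co z =1 c.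
  move=> h i; have [_ /(_ [ffun i => c i])] := hco z.
  rewrite h; have -> : \sum_i iF ([ffun i => c i] i) * iL b`_i = \sum_i iF (c i) * iL b`_i.
    by apply: eq_bigr => j _; rewrite ffunE.
  by move=> /(_ erefl) ->; rewrite ffunE.
have Lb c : iL c = \sum_j iF (io (coord b j c)) * iL b`_j.
  rewrite {1}(coord_vbasis (memvf c)) rmorph_sum; apply: eq_bigr => j _.
  by rewrite hio -rmorphM -scalerAl mul1r.
pose lam i z := \sum_j co z j * io (coord T i b`_j).
have lamD i z z' : lam i (z + z') = lam i z + lam i z'.
  rewrite -big_split; apply: eq_bigr => j _ /=; rewrite -mulrDl; congr (_ * _).
  apply: (coE _ (fun j => co z j + co z' j)); under eq_bigr do rewrite rmorphD mulrDl.
  by rewrite big_split -(hco z).1 -(hco z').1.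
have lamM i a z : lam i (iF a * z) = a * lam i z.
  rewrite mulr_sumr; apply: eq_bigr => j _ /=; rewrite mulrA; congr (_ * _).
  apply: (coE _ (fun j => a * co z j)); under eq_bigr do rewrite rmorphM -mulrA.
  by rewrite -mulr_sumr -(hco z).1.
have lamL i c : lam i (iL c) = io (coord T i c).
  rewrite [in RHS](coord_vbasis (memvf c)) !linear_sum rmorph_sum; apply: eq_bigr => j _.
  by rewrite linearZ rmorphM; congr (_ * _); apply: (coE _ (fun j => io (coord b j c))); exact: Lb.
exists n, (tnth T), lam; split=> // [i c hc|z].
  by exists (coord T i c); [exact: hT|exact: lamL].
have e j : b`_j = \sum_i coord T i b`_j *: tnth T i.
  rewrite {1}(coord_basis bT (memvf b`_j)); apply: eq_bigr => i _.
  by rewrite (tnth_nth 0).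
rewrite {1}(hco z).1; under eq_bigr do rewrite e rmorph_sum mulr_sumr.
rewrite exchange_big; apply: eq_bigr => i _ /=; rewrite rmorph_sum mulr_suml.
apply: eq_bigr => j _; rewrite rmorphM -mulrA; congr (_ * _).
by rewrite hio -rmorphM -scalerAl mul1r.
Qed.

End TensorCoordinates.

(** * Powers of a parameter *)

Section ParameterPowers.
Variable V : cdvField.
Notation w := (@cdv_val V).
Let hw := @cdv_valP V.
Variables (S : lau V) (pS : psr S) (S0 : vge w 1 (S 0)) (S1 : ~ vge w 1 (S 1)).

Lemma parameter_coef (k i : nat) :
  ((i < k)%N -> vge w 1 ((S ^+ k) i)) /\ vge w 1 ((S ^+ k) k - S 1 ^+ k).
Proof.
elim: k i => [|k IH] i; first by split=> //; rewrite !expr0 lau1E eqxx subrr; left.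
rewrite exprS; have pk := psrX k pS; split=> [le_ik|].
  rewrite psr_coefM //; apply: vge_sum => // -[l ll] _ /=.
  case: l ll => [|l] ll; first exact: vgeMr (lau0 _ _).
  apply: vgeMl => //; first exact: lau0.
  by apply: (IH _).1; lia.
rewrite psr_coefM // big_ord_recl big_ord_recl /= -addrA; apply: vgeD => //.
  exact: vgeMr (lau0 _ _).
rewrite addrAC exprS; apply: vgeD => //.
  rewrite subSS subn0.
  by rewrite -mulrBr; apply: vgeMl => //; [exact: lau0|exact: (IH 0%N).2].
apply: vge_sum => // -[l ll] _ /=; rewrite /bump /=.
by apply: vgeMl => //; [exact: lau0|apply: (IH _).1; lia].
Qed.

(** Modulo the maximal ideal, S^k starts with S_1^k t^k; look at degree k0 for the least k0 such
    that [d k0] is a unit. *)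
Lemma parameter_free n (d : 'I_n -> V) : (forall k, vge w 0 (d k)) ->
  ediv 1 (\sum_k cst (d k) * S ^+ k) -> forall k, vge w 1 (d k).
Proof.
move=> hd h k; apply: contrapT => nk.
have [k0 nk0 kmin] : exists2 k0, ~ vge w 1 (d k0) & forall k : 'I_n, (k < k0)%N -> vge w 1 (d k).
  have pk : `[< ~ vge w 1 (d k) >] by apply/asboolP.
  case: (@arg_minnP _ k (fun k => `[< ~ vge w 1 (d k) >]) val pk) => k0 /asboolP n0 hmin.
  exists k0 => // l lt; apply: contrapT => nl.
  by have /= := hmin l (asboolT nl); rewrite leqNgt lt.
have := h k0%:Z; rewrite lau_sum (bigD1 k0) // => h1.
suff : vge w 1 (d k0 * S 1 ^+ k0).
  have v0 : vge w 0 (S 1 ^+ k0) by apply: vge0X => //; exact: lau0.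
  move/(vge1M hw (hd k0) v0) => [//|h2].
  exact: S1 (vge1X hw (lau0 S 1) h2).
have h2 : vge w 1 (\sum_(i < n | i != k0) (cst (d i) * S ^+ i) k0).
  apply: vge_sum => // i ik; rewrite cstM //.
  have [lt|gt|e] := ltngtP i k0; last by case/eqP: ik; apply: val_inj.
    by apply: vgeMr => //; [exact: kmin|exact: lau0].
  by apply: vgeMl => //; exact: (parameter_coef i k0).1.
have := vgeB hw h1 h2; rewrite addrK cstM // => h3.
rewrite -[S 1 ^+ k0](subKr ((S ^+ k0) k0)) mulrBr; apply: vgeB => //.
by apply: vgeMl => //; exact: (parameter_coef k0 0).2.
Qed.

End ParameterPowers.

(** * The local ring P and its parameter *)

Section ClosedPoint.
Variables (K : fieldType) (v : K -> int) (hv : discrete_valuation v) (hvc : vcomplete v).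
Variables (pi : K) (hpi : uniformiser v pi).
Variables (F : fieldType) (io : {rmorphism K -> F}).
Variables (L : fieldExtType K) (w : L -> int) (hw : discrete_valuation w) (hwc : vcomplete w).
Hypothesis hLK : forall c : K, c != 0 -> w c%:A = v c.
Variables (FL : fieldType) (iF : {rmorphism F -> FL}) (iL : {rmorphism L -> FL}).
Hypothesis hFL : is_tensor_field io iF iL.
Variables (n : nat) (y : 'I_n -> F).
Notation B := (alg v io y).
Notation BB := (base_change w iF iL B).
Variables (I : set FL) (hI : is_prime_ideal BB I).
Notation O := (localisation BB I).
Variables (rho : FL -> L) (hrho : is_section w iL O rho).
Variables (t : FL) (ht : is_section_equation O rho t).
Notation V := (CDVField hw hwc).
Notation P := (point v io iF y I).
Notation sO := (sO hw hwc iL O t).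
Notation s z := (sO (iF z)).

Let hBS : is_subring B. Proof. exact: alg_subring. Qed.
Let hBB : is_subring BB. Proof. exact: bc_subring. Qed.
Let hO : is_subring O. Proof. exact: (loc_subring hBB hI). Qed.
Let O_L c : vring w c -> O (iL c).
Proof. by move=> hc; apply: (loc_in hBB hI); exact: bc_L. Qed.
Let hP : is_subring P. Proof. exact: (point_subring hv hw hI). Qed.
Let PO b : P b -> O (iF b). Proof. exact: (point_map hw iL). Qed.
Let hio c : iF (io c) = iL c%:A. Proof. by case: hFL => h _; exact: h. Qed.
Let PB b : B b -> P b. Proof. exact: (point_alg hv hw hI). Qed.
Let Pio c : vring v c -> P (io c). Proof. exact: (point_const hv hw hI). Qed.

Lemma point_expM a b : P a -> P b -> s (a * b) = s a * s b.
Proof. by move=> ha hb; rewrite rmorphM (sOM hw hwc hO O_L hrho ht) //; exact: PO. Qed.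
Lemma point_expB a b : P a -> P b -> s (a - b) = s a - s b.
Proof. by move=> ha hb; rewrite rmorphB (sOB hw hwc hO O_L hrho ht) //; exact: PO. Qed.
Lemma point_expD a b : P a -> P b -> s (a + b) = s a + s b.
Proof. by move=> ha hb; rewrite rmorphD (sOD hw hwc hO O_L hrho ht) //; exact: PO. Qed.
Lemma point_exp1 : s 1 = 1.
Proof. by rewrite rmorph1 (sO1 hw hwc hO O_L hrho ht). Qed.
Lemma point_exp0 : s 0 = 0.
Proof. by rewrite rmorph0 (sO0 hw hwc hO O_L hrho ht). Qed.
Lemma point_expX a k : P a -> s (a ^+ k) = s a ^+ k.
Proof.
by move=> ha; elim: k => [|k IH]; rewrite ?point_exp1 // !exprS point_expM ?IH //; exact: (subX hP).
Qed.
Lemma point_exp_sum (J : Type) (r : seq J) (G : J -> F) : (forall i, P (G i)) ->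
  s (\sum_(i <- r) G i) = \sum_(i <- r) s (G i).
Proof.
move=> hG; elim: r => [|i r IH]; first by rewrite !big_nil point_exp0.
by rewrite !big_cons point_expD ?IH //; exact: (sub_sum hP).
Qed.
Lemma point_exp_psr a : P a -> psr (s a).
Proof. by move=> /PO ha; exact: (sO_psr hw hwc hO O_L hrho ht). Qed.
Lemma point_exp_const c : vring v c -> s (io c) = cst (c%:A : V).
Proof.
move=> hc; rewrite hio (sO_L hw hwc hO O_L hrho ht) //; exact/(vge_LK hLK).
Qed.

Lemma point_exp_unit a : P a -> a != 0 -> P a^-1 -> ~ vge w 1 (s a 0).
Proof.
move=> ha a0 hV; apply: (sO_unit hO O_L hrho ht (PO ha)); last by rewrite fmorph_eq0.
by rewrite -fmorphV; exact: PO.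
Qed.

Section Generators.
Variables (tau : F) (Ptau : P tau) (tau0 : vge w 1 (s tau 0)) (tau1 : ~ vge w 1 (s tau 1)).

Let vge1_pi (c : L) : vge w 1 c -> exists2 c', vge w 0 c' & c = pi%:A * c'.
Proof.
move=> hc; have [pi0 vpi] := hpi; have piA : pi%:A != 0 :> L by exact: scalar_neq0.
exists (c / pi%:A); last by rewrite mulrC divfK.
have : vge w (-1) (pi%:A)^-1 by right; rewrite valV // hLK // vpi.
by move/(vgeM hw hc); rewrite addrN.
Qed.

Let split_t z : O z -> vge w 1 (sO z 0) -> exists c z',
  [/\ vge w 0 c, O z' & z = iL pi%:A * iL c + t * z'].
Proof.
move=> hz; rewrite (sO_coef0 hw hwc hO O_L hrho ht hz) => /vge1_pi[c hc e].
have [Ot t0 htO] := ht; have [rD rM rL rO _] := hrho.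
have hr : O (iL (rho z)) by apply: O_L; exact: rO.
exists c, ((z - iL (rho z)) / t); split=> //.
  apply/htO; first exact: (subB hO).
  apply: (addIr (rho (iL (rho z)))); rewrite -rD //; last exact: (subB hO).
  by rewrite subrK add0r rL //; exact: rO.
by rewrite -rmorphM -e mulrC divfK // addrC subrK.
Qed.

(* In O the parameter t is a combination of [tau] and [pi]; the coordinates with
   respect to a basis of R_L over R then bring the relation down to P. *)
Lemma vanishing_generators b : P b -> vge w 1 (s b 0) ->
  exists b1 b2, [/\ P b1, P b2 & b = io pi * b1 + tau * b2].
Proof.
suff main b' : B b' -> vge w 1 (s b' 0) ->
    exists b1 b2, [/\ P b1, P b2 & b' = io pi * b1 + tau * b2].
  move=> Pb; have [a [c [ha hc nc e]]] := Pb; rewrite e => h.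
  have hJ := contraction_prime hw hBS hI; have c0 := prime_neq0 hJ nc.
  have Pc : P c^-1 by exact: (loc_inv hBS hc nc).
  have [|a1 [a2 [h1 h2 ea]]] := main a ha.
    have -> : a = b * c by rewrite e divfK.
    have Pc' := PB hc; rewrite point_expM // psr_coefM0; [|exact: point_exp_psr|exact: point_exp_psr].
    by rewrite e; apply: vgeMr => //; exact: (@lau0 V).
  by exists (a1 / c), (a2 / c); split; [exact: (subM hP)|exact: (subM hP)|rewrite ea; ring].
move=> hb sb; have [Ot t0 _] := ht; have pio : vge v 0 pi by case: hpi => _ h; right; rewrite h.
have OpiA : O (iL pi%:A) by apply: O_L; exact/(vge_LK hLK).
have [c [u [hc Ou etau]]] := split_t (PO Ptau) tau0.
have su : ~ vge w 1 (sO u 0).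
  move=> h; apply: tau1; have pa : vge w 1 (pi%:A : L).
    by apply/(vge_LK hLK); case: hpi => _ e; right; rewrite e.
  have hc' : vge w 0 (pi%:A * c) by apply: vgeMr => //; exact: vge_le pa.
  rewrite etau -rmorphM (sOD hw hwc hO O_L hrho ht); [|exact: O_L|exact: (subM hO)].
  rewrite lauD (sO_L hw hwc hO O_L hrho ht) // cstE // add0r.
  rewrite (sOM hw hwc hO O_L hrho ht) // (sO_t hw hwc hO O_L hrho ht).
  by rewrite mono_mul ?mul1r //; exact: vge1.
have u0 : u != 0.
  apply/eqP => u0; apply: su; rewrite u0 (sO0 hw hwc hO O_L hrho ht) lau0E; left.
  by [].
have Ou' : O u^-1.
  by apply: contrapT => h; apply: su; apply: (sO_maxideal hw hwc hO O_L hrho ht); split=> //; right.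
have et : t = u^-1 * (iF tau - iL pi%:A * iL c).
  by rewrite etau addrC addKr mulrCA mulVf // mulr1.
have [c' [z [hc' Oz eb]]] := split_t (PO (PB hb)) sb.
have [z1 [z2 [Oz1 Oz2 eb']]] : exists z1 z2, [/\ O z1, O z2 &
    iF b' = iL pi%:A * z1 + iF tau * z2].
  exists (iL c' - u^-1 * iL c * z), (u^-1 * z); split.
  - by apply: (subB hO); [exact: O_L|apply: (subM hO) => //; apply: (subM hO) => //; exact: O_L].
  - exact: (subM hO).
  by rewrite eb {1}et; ring.
have [a1 [d1 [ha1 hd1 n1 e1]]] := Oz1; have [a2 [d2 [ha2 hd2 n2 e2]]] := Oz2.
have [d10 d20] := (prime_neq0 hI n1, prime_neq0 hI n2).
have [_ [ID IM IP]] := hI.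
have key : d1 * d2 * iF b' = iL pi%:A * (a1 * d2) + iF tau * (a2 * d1).
  by rewrite eb' e1 e2; field; rewrite d10 d20.
have [k [E [lam [hE lamD lamM lamL lamS]]]] := tensor_coordinates hv hvc hw hLK hFL.
have lamB z' i : BB z' -> B (lam i z').
  move: z'; apply: bc_ind => [|z' z'' h h'|a c'' ha hc''].
  - have -> : lam i 0 = 0 by apply: (addrI (lam i 0)); rewrite -lamD !addr0.
    exact: (sub0 hBS).
  - by rewrite lamD; exact: (subD hBS).
  rewrite lamM; have [k' hk' ->] := lamL i _ hc''.
  by apply: (subM hBS) => //; exact: alg_const.
have nd : ~ I (d1 * d2) by move/(IP _ _ hd1 hd2) => [].
(* The product d1 d2 is a combination of its coordinates and is not in I, so some coordinate avoids
   I and is invertible in P. *)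
have [i ni] : exists i, ~ I (iF (lam i (d1 * d2))).
  apply: contrapT => /forallNP h; apply: nd; rewrite [d1 * d2]lamS.
  have I0 : I 0 by case: hI => -[_ I0 _] _.
  apply: (big_ind I) => [//|a1' a2' h1 h2|i _]; first exact: ID.
  rewrite mulrC; apply: IM; first by apply: bc_L => //; exact: hE.
  exact: contrapT (h i).
set D := lam i (d1 * d2) in ni *.
have BD : B D by apply: lamB; exact: (subM hBB).
have hJ := contraction_prime hw hBS hI.
have nJ : ~ [set a | B a /\ I (iF a)] D by case.
have D0 := prime_neq0 hJ nJ.
have PD : P D^-1 by exact: (loc_inv hBS BD nJ).
have eD : b' * D = io pi * lam i (a1 * d2) + tau * lam i (a2 * d1).
  by rewrite /D -!lamM -lamD hio -key mulrC.
have Pl z' : BB z' -> P (lam i z') by move=> h; apply: PB; exact: lamB.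
exists (lam i (a1 * d2) / D), (lam i (a2 * d1) / D); split.
- by apply: (subM hP) => //; apply: Pl; exact: (subM hBB).
- by apply: (subM hP) => //; apply: Pl; exact: (subM hBB).
by apply: (mulIf D0); rewrite eD; field.
Qed.

End Generators.

Variables (Q : nat) (hQp : vge w 1 Q%:R).
Hypothesis hQ : forall x, vge w 0 x -> vge w 1 (x ^+ Q - x).

(** Since [t] is a fraction over the base change, some b in B has a unit as linear coefficient. Its
    constant term has its residue in the residue field of L, so it need not be removable by a
    constant of K. Passing to b^Q - b removes it modulo the maximal ideal and only changes the sign
    of the linear coefficient there, since Q vanishes modulo the maximal ideal. *)
Lemma local_parameter : exists2 tau, P tau & vge w 1 (s tau 0) /\ ~ vge w 1 (s tau 1).
Proof.
have [Ot t0 _] := ht; have [a [d [ha hd nd e]]] := Ot.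
have d0 := prime_neq0 hI nd; have Od := loc_in hBB hI hd.
have : ~ vge w 1 (sO a 1).
  have -> : a = t * d by rewrite e divfK.
  rewrite (sOM hw hwc hO O_L hrho ht) // (sO_t hw hwc hO O_L hrho ht).
  rewrite mono_mul ?mul1r //; last exact: vge1.
  exact: (sO_unit hO O_L hrho ht Od (loc_inv hBB hd nd) d0).
have [k [b [c [hb hc ->]]]] := ha.
have sumE r (b' : 'I_r -> F) (c' : 'I_r -> L) : (forall i, B (b' i)) -> (forall i, vring w (c' i)) ->
    sO (\sum_i iF (b' i) * iL (c' i)) = \sum_i s (b' i) * cst (c' i : V).
  elim: r b' c' => [|r IH] b' c' hb' hc'; first by rewrite !big_ord0 (sO0 hw hwc hO O_L hrho ht).
  have Oi i : O (iF (b' i) * iL (c' i)).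
    by apply: (subM hO); [exact/PO/PB|exact: O_L].
  rewrite !big_ord_recl (sOD hw hwc hO O_L hrho ht) //; last exact: (sub_sum hO).
  rewrite IH //; congr (_ + _); rewrite (sOM hw hwc hO O_L hrho ht) //.
  - by rewrite (sO_L hw hwc hO O_L hrho ht) //; exact: hc'.
  - exact/PO/PB.
  exact: O_L.
rewrite sumE // lau_sum => h.
have [i ni] : exists i, ~ vge w 1 (s (b i) 1).
  apply: contrapT => /forallNP hn; apply: h; apply: vge_sum => // i _.
  rewrite mulrC cstM; last exact: hc.
  by apply: vgeMl => //; [exact: hc|exact: contrapT (hn i)].
have Pb := PB (hb i); have ps := point_exp_psr Pb; have pQ := psrX Q ps.
have r0 : vge w 0 (s (b i) 0) by exact: (@lau0 V).
have eq : s (b i ^+ Q - b i) = s (b i) ^+ Q - s (b i).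
  by rewrite point_expB ?point_expX //; exact: (subX hP).
exists (b i ^+ Q - b i); first by apply: (subB hP) => //; exact: (subX hP).
rewrite eq !lauB psr_coefX0 // psr_coefX1 //; split; first exact: hQ.
move=> h1; apply: ni; rewrite -[X in vge _ _ X](subKr (Q%:R * s (b i) 0 ^+ Q.-1 * s (b i) 1)).
apply: vgeB => //; apply: vgeMr => //; last exact: (@lau0 V).
by apply: vgeMr => //; exact: vge0X.
Qed.

Variables (tau : F) (Ptau : P tau) (tau0 : vge w 1 (s tau 0)) (tau1 : ~ vge w 1 (s tau 1)).

Lemma frobenius_expand b : P b ->
  exists b1 b2, [/\ P b1, P b2 & b = b ^+ Q + io pi * b1 + tau * b2].
Proof.
move=> Pb; have PQ := subX hP Q Pb.
have [||b1 [b2 [h1 h2 e]]] := @vanishing_generators tau Ptau tau0 tau1 (b - b ^+ Q).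
- exact: (subB hP).
- rewrite point_expB // point_expX // lauB psr_coefX0; last exact: point_exp_psr.
  by apply: vgeBC => //; apply: hQ; exact: (@lau0 V).
by exists b1, b2; split=> //; rewrite -addrA -e addrC subrK.
Qed.

(** If D P expanded to 0 modulo the maximal ideal, P would lie in the support, hence on the affine
    open where D is finite, with r generators. Then r + 1 powers of an element whose expansion is a
    parameter satisfy an integral relation modulo D P, and this relation would contradict
    [parameter_free]. *)
Lemma divisor_nonzero (C : set (set F)) D : C P -> is_effective_divisor v io C D ->
  is_finite_divisor v io C D -> ~ ediv 1 (s (D P)).
Proof.
move=> CP [hD _] [B' [[[n' [y' eB']] _ _] supp [r [b [hb span]]]]] h1.
have [PD D0] := hD P CP.
have : in_support C D P.
  split=> //; split=> //; right=> hV; exact: (point_exp_unit PD D0 hV) (h1 0).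
move/supp => specP; have [I' hI' eP] := specP.
have hB'S : is_subring B' by rewrite eB'; exact: alg_subring.
have B'P a : B' a -> P a by rewrite eP; exact: (loc_in hB'S hI').
have [a [Ba [a0 a1]]] : exists a, B' a /\ vge w 1 (s a 0) /\ ~ vge w 1 (s a 1).
  have := Ptau; rewrite {1}eP => -[a [c [ha hc nc e]]].
  have c0 := prime_neq0 hI' nc; have [Pc Pa] := (B'P _ hc, B'P _ ha).
  have PcV : P c^-1 by rewrite eP; exact: (loc_inv hB'S hc nc).
  exists a; split=> //; have -> : a = tau * c by rewrite e divfK.
  have [p1 p2] := (point_exp_psr Ptau, point_exp_psr Pc).
  rewrite point_expM // psr_coefM0 // psr_coefM1 //; split; first by apply: vgeMr => //; exact: (@lau0 V).
  have h : ~ vge w 1 (s tau 1 * s c 0).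
    apply: nvge1M => //; [exact: (@lau0 V)|exact: (@lau0 V)|].
    exact: point_exp_unit.
  rewrite addrC; apply: nvge1D => //; apply: vgeMr => //; exact: (@lau0 V).
have /choice[c hc] : forall k, exists c : 'I_r -> K, (forall i, vring v (c i)) /\
    P ((a ^+ k - \sum_i io (c i) * b i) / D P).
  by move=> k; have [c hc h] := span _ (subX hB'S k Ba); exists c; split=> //; exact: h.
pose M : 'M[K]_(r.+1, r) := \matrix_(k, i) c k i.
have : kermx M != 0.
  by rewrite kermx_eq0 /row_free neq_ltn ltnS rank_leq_col.
case/rowV0Pn => u /sub_kermxP uM u0.
have [k0 hk0] : exists k, u 0 k != 0.
  by apply/existsP; rewrite -negb_forall; apply: contra u0 => /forallP h; apply/eqP/rowP => k; rewrite mxE; apply/eqP.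
(* Dividing by the entry of least valuation makes the relation integral, with one coefficient equal
   to 1. *)
case: (arg_minP (P := fun k => u 0 k != 0) (v \o u 0) hk0) => k1 hk1 kmin.
pose d k := u 0 k / u 0 k1.
have hd k : vge v 0 (d k).
  rewrite /d; have [->|uk] := eqVneq (u 0 k) 0; first by rewrite mul0r; left.
  have := kmin k uk; rewrite /= => le; right.
  by rewrite valM ?invr_neq0 // valV //; lia.
have dM i : \sum_k d k * c k i = 0.
  have /rowP/(_ i) := uM; rewrite !mxE => e.
  transitivity ((\sum_k u 0 k * M k i) / u 0 k1); last by rewrite e mul0r.
  by rewrite mulr_suml; apply: eq_bigr => k _; rewrite mxE mulrAC.
have dA k : vge w 0 ((d k)%:A : L) by exact/(vge_LK hLK).
have Pa := B'P _ Ba.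
have Psum : P (\sum_k io (d k) * ((a ^+ k - \sum_i io (c k i) * b i) / D P)).
  by apply: (sub_sum hP) => k _; apply: (subM hP); [apply: Pio; exact: hd|exact: (hc k).2].
have e : \sum_k io (d k) * a ^+ k =
    D P * \sum_k io (d k) * ((a ^+ k - \sum_i io (c k i) * b i) / D P).
  have z : \sum_(k < r.+1) io (d k) * \sum_i io (c k i) * b i = 0.
    under eq_bigr do rewrite mulr_sumr.
    rewrite exchange_big big1 // => i _; under eq_bigr do rewrite mulrA -rmorphM.
    by rewrite -mulr_suml -rmorph_sum dM rmorph0 mul0r.
  rewrite mulr_sumr; transitivity (\sum_(k < r.+1) io (d k) * a ^+ k -
      \sum_(k < r.+1) io (d k) * \sum_i io (c k i) * b i); first by rewrite z subr0.
  rewrite -sumrB; apply: eq_bigr => k _.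
  by rewrite -mulrBr; field.
have Pd k : P (io (d k)) by apply: Pio; exact: hd.
have hs : \sum_(k < r.+1) cst ((d k)%:A : V) * s a ^+ k = s (\sum_k io (d k) * a ^+ k).
  rewrite point_exp_sum => [|k]; last by apply: (subM hP) => //; exact: (subX hP).
  apply: eq_bigr => k _; rewrite point_expM //; last exact: (subX hP).
  by rewrite point_exp_const ?point_expX //; exact: hd.
have := parameter_free (point_exp_psr Pa) a0 a1 dA.
rewrite hs e point_expM // => h; have /h/(_ k1) : ediv 1 (s (D P) * s (\sum_k io (d k) *
    ((a ^+ k - \sum_i io (c k i) * b i) / D P))) by exact: edivMr.
by move/(vge_LK hLK); rewrite /d divff //; exact: (n1_vge1 hv).
Qed.

End ClosedPoint.

(** * The expansion of the lift at an end *)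

Section EndLift.
Variables (K : fieldType) (v : K -> int) (hv : discrete_valuation v) (hvc : vcomplete v).
Variables (pi : K) (hpi : uniformiser v pi).
Variables (p : nat) (hp : prime p) (hvp : vge v 1 p%:R) (e' : nat).
Notation q := (p ^ e')%N.
Variable sigma : {rmorphism K -> K}.
Hypothesis hsigma : forall c, vring v c -> vmax v (sigma c - c ^+ q).
Variables (F : fieldType) (io : {rmorphism K -> F}) (C : set (set F)).
Hypothesis hproper : is_proper v io C.
Variables (m : nat) (x : 'I_m.+1 -> F) (f : 'I_m -> {mpoly K[m.+1]}).
Hypothesis hA : is_affine_open v io C (alg v io x).
Hypothesis hpres : is_presentation v io x f.
Variables (J : 'M[{mpoly K[m.+1]}]_(m.+1, m)) (Delta : 'I_m -> 'M[{mpoly K[m.+1]}]_m).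
Hypothesis hJ : is_jacobian_inverse v f J Delta.
Variable S : 'cV[mps K m.+1]_m.
Hypothesis hS : is_lift_solution v sigma q f J Delta S.
Variables (L : fieldExtType K) (w : L -> int) (hw : discrete_valuation w) (hwc : vcomplete w).
Hypothesis hLK : forall c : K, c != 0 -> w c%:A = v c.
Variables (FL : fieldType) (iF : {rmorphism F -> FL}) (iL : {rmorphism L -> FL}).
Hypothesis hFL : is_tensor_field io iF iL.
Variables (n : nat) (y : 'I_n -> F).
Notation B := (alg v io y).
Hypothesis hB : is_affine_open v io C B.
Notation BB := (base_change w iF iL B).
Variables (I : set FL) (hI : is_prime_ideal BB I).
Notation O := (localisation BB I).
Variables (rho : FL -> L) (hrho : is_section w iL O rho).
Variables (t : FL) (ht : is_section_equation O rho t).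
Variables (xi : mps K m.+1 -> int -> L).
Hypothesis hxi : is_expansion_map v io w iF iL x f O t xi.
Notation V := (CDVField hw hwc).
Notation mpol := {mpoly K[m.+1]}.
Notation over := (poly_over (vring v)).
Notation ev g := (evalx io x g).
Notation P := (point v io iF y I).
Notation s z := (sO hw hwc iL O t (iF z)).
Notation X := (poly_expansion hw hwc xi).
Notation ph := (phi sigma q J S).

Let hio c : iF (io c) = iL c%:A. Proof. by case: hFL => h _; exact: h. Qed.
Let hf j : over (f j). Proof. by case: hpres => h _; exact: h. Qed.
Let hX : is_expansion v f X := poly_expansionP hv hpres hw hwc hLK hio hI hrho ht hxi.
Let hP : is_subring P := point_subring hv hw hI.
Let Pg z : P z -> gloc v io x X z :=
  @point_gloc _ _ hv _ _ _ hproper _ _ _ hA hpres _ _ hw hwc hLK _ _ _ hio _ _ hB _ hI _ hrho _ ht _ hxi z.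
Let Pext z : P z -> ext v io x X X z = s z :=
  @point_ext _ _ hv _ _ _ hproper _ _ _ hA hpres _ _ hw hwc hLK _ _ _ hio _ _ hB _ hI _ hrho _ ht _ hxi z.
Let ph_dag g : over g -> dagger v (ph g).
Proof. exact: (phi_dagger hv hp hvp hsigma hf hJ hS). Qed.

Definition lift_expansion (g : mpol) : lau V := xiE hw hwc xi (ph g).
Notation Xi := lift_expansion.

Lemma lift_expansion_const c : vring v c -> Xi c%:MP = cst ((sigma c)%:A : V).
Proof.
move=> hc; rewrite /lift_expansion /phi substC.
by apply: (poly_expansion_const hv hw hwc hLK hio hI hrho ht hxi); exact: (sigma_ge0 hv hsigma).
Qed.

Lemma lift_expansionP : is_expansion v f Xi.
Proof.
split=> [g h hg hh|g h hg hh||j|c hc].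
- by rewrite /lift_expansion /phi substD (xiD hv hw hwc hxi) //; exact: ph_dag.
- by rewrite /lift_expansion /phi substM (xiM hv hw hwc hxi) //; exact: ph_dag.
- by rewrite /lift_expansion /phi subst1 (xi1 hv hw hwc hxi).
- rewrite /lift_expansion (phi_equation hp hS) (xi_sum hv hw hwc hxi) => [|l _]; last first.
    apply: daggerM => //; first exact: (dagger_poly (hf l)).
    exact: (equation_dagger hv hp hvp hsigma hf hJ hS).
  rewrite big1 // => l _; rewrite (xiM hv hw hwc hxi); last 2 first.
  - exact: (dagger_poly (hf l)).
  - exact: (equation_dagger hv hp hvp hsigma hf hJ hS).
  by have := expf hX l; rewrite /poly_expansion => ->; rewrite mul0r.
by rewrite lift_expansion_const // der_cst.
Qed.
Let hXi := lift_expansionP.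

Let vwp : vge w 1 p%:R.
Proof. by have /(vge_LK hLK) := hvp; rewrite scaler_nat. Qed.

(** By induction on [g] this reduces to constants, where it is the hypothesis on sigma, and to
    variables, where it is [lift_point_close]; sums use additivity of the q-th power modulo the
    maximal ideal. *)
Lemma lift_expansion_frobenius g : over g -> ediv 1 (Xi g - X g ^+ q).
Proof.
move=> hg; suff [] : over g /\ ediv 1 (Xi g - X g ^+ q) by [].
move: g hg; apply: poly_over_ind => [||c hc|i|g h [hg eg] [hh eh]|g h [hg eg] [hh eh]].
- by left.
- exact: vge1.
- split; first exact: poly_overC.
  rewrite lift_expansion_const // (poly_expansion_const hv hw hwc hLK hio hI hrho ht hxi) //.
  have hcA : vge w 0 (c%:A : V) by exact/(vge_LK hLK).
  have hsA : vge w 0 ((sigma c)%:A : V) by apply/(vge_LK hLK); exact: (sigma_ge0 hv hsigma).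
  have cX k : cst (c%:A : V) ^+ k = cst ((c ^+ k)%:A : V).
    elim: k => [|k IH]; first by rewrite !expr0 scale1r.
    rewrite !exprS IH -cst_mul //; last by apply/(vge_LK hLK); exact: vge0X.
    by rewrite -scalerAl mul1r scalerA.
  have hqA : vge w 0 ((c ^+ q)%:A : V) by apply/(vge_LK hLK); exact: vge0X.
  have cB : cst ((sigma c)%:A : V) - cst ((c ^+ q)%:A : V) = cst ((sigma c - c ^+ q)%:A : V).
    apply/eqP; rewrite subr_eq -cstD //; last first.
      by apply/(vge_LK hLK); apply: vgeB => //; [exact: (sigma_ge0 hv hsigma)|exact: vge0X].
    by rewrite -scalerDl subrK.
  by rewrite cX cB; apply/ediv_cst/(vge_LK hLK)/(vmaxE v); exact: hsigma.
- split; first exact: poly_overX.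
  have [pi0 vpi] := hpi.
  have [b hb eb] := lift_point_close hv hp hvp hsigma hf hJ hS i vpi pi0.
  have dX : dagger v (mps_of ('X_i : mpol)) by apply: dagger_poly => //; exact: poly_overX.
  have dpi : dagger v (mps_of (pi%:MP : mpol)).
    by apply: dagger_poly => //; apply: poly_overC; right; rewrite vpi.
  rewrite /lift_expansion /phi substX eb (xiD hv hw hwc hxi); last 2 first.
  - exact: daggerX.
  - exact: daggerM.
  rewrite (xiX hv hw hwc hxi) // (xiM hv hw hwc hxi) // addrAC subrr add0r.
  apply: edivMr; have := poly_expansion_const hv hw hwc hLK hio hI hrho ht hxi (c := pi).
  rewrite /poly_expansion => ->; last by right; rewrite vpi.
  by apply/ediv_cst/(vge_LK hLK); right; rewrite vpi.
- split; first exact: poly_overD.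
  rewrite (expD hX) // (expD hXi) //.
  apply: (@ediv_trans _ _ (X g ^+ q + X h ^+ q)).
    by rewrite opprD addrACA; exact: edivD.
  by apply: edivBC; exact: (ediv_exprD_p (V := V) hp vwp).
split; first exact: poly_overM.
by rewrite (expM hX) // (expM hXi) // exprMn; exact: edivBM.
Qed.

(** The condition [compat] for the lift, so that both expansions extend to the same fractions. *)
Lemma lift_expansion_unit g : over g -> ~ ediv 1 (X g) -> ~ ediv 1 (Xi g).
Proof.
move=> hg ng h; apply: ng; have := edivB h (lift_expansion_frobenius hg); rewrite subKr.
elim: {1}q => [|k IH]; last by rewrite exprS => /ediv1M[].
by rewrite expr0 => h1; have := ediv1_unit (mulr1 (1 : lau V)) h1.
Qed.

Notation fi := (ext v io x X Xi).

Lemma lift_ext_frobenius z : P z -> ediv 1 (fi z - s z ^+ q).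
Proof.
move=> hz; have [g1 [g2 h]] := Pg hz; have [h1 h2 n2 _] := h.
have e1 := extP hv hpres hX hXi lift_expansion_unit h.
have e2 := extP hv hpres hX hX (fun g _ => id) h; rewrite (Pext hz) in e2.
have : ediv 1 (Xi g2 * (fi z - s z ^+ q)).
  have -> : Xi g2 * (fi z - s z ^+ q) = (Xi g1 - X g1 ^+ q) -
      (Xi g2 - X g2 ^+ q) * s z ^+ q.
    by rewrite mulrBr e1 -e2 exprMn; ring.
  by apply: edivB; [exact: lift_expansion_frobenius|apply: edivMr; exact: lift_expansion_frobenius].
by case/ediv1M => // /(lift_expansion_unit h2 n2).
Qed.

Lemma lift_extM a b : P a -> P b -> fi (a * b) = fi a * fi b.
Proof. by move=> /Pg ha /Pg hb; exact: (extM hv hpres hX hXi lift_expansion_unit). Qed.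
Lemma lift_extD a b : P a -> P b -> fi (a + b) = fi a + fi b.
Proof. by move=> /Pg ha /Pg hb; exact: (extD hv hpres hX hXi lift_expansion_unit). Qed.
Lemma lift_ext1 : fi 1 = 1. Proof. exact: (ext1 hv hpres hX hXi lift_expansion_unit). Qed.
Lemma lift_ext_const c : vring v c -> fi (io c) = cst ((sigma c)%:A : V).
Proof.
move=> hc; rewrite -(evalxC io x) (ext_ev hv hpres hX hXi lift_expansion_unit) ?lift_expansion_const //.
exact: poly_overC.
Qed.

(* P arises from a ring of finite type by inverting units, so that it suffices to
   control the expansions of finitely many generators. *)
Lemma lift_ext_weight (N : nat) : exists M0 : nat, forall M, (M0 <= M)%N ->
  forall b, P b -> wt M N 0 (fi b).
Proof.
have Py i : P (y i) by apply: (point_alg hv hw hI); exact: alg_gen.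
have /choice[Mi hMi] : forall i, exists M : nat, cut N (fi (y i) - s (y i) ^+ q) M.
  by move=> i; exact: lau_cut.
exists (\sum_i Mi i).+1 => M leM b Pb.
have M_gt0 : (0 < M)%N by apply: leq_trans leM.
have psq z : P z -> psr (s z ^+ q).
  by move=> hz; apply: psrX; exact: (point_exp_psr hv hw hwc hI hrho ht hz).
have wty i : wt M N 0 (fi (y i)).
  rewrite -(subrK (s (y i) ^+ q) (fi (y i))); apply: wtD; last exact/psr_wt/psq.
  have h1 : wt M N 1 (fi (y i) - s (y i) ^+ q); last by apply: wt_le h1.
  apply: (ediv1_wt M_gt0 (hMi i)).
    by apply: leq_trans leM; rewrite ltnS (bigD1 i) //= leq_addr.
  exact: lift_ext_frobenius.
have PB g : over g -> P (evalx io y g).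
  by move=> hg; apply: (point_alg hv hw hI); exists g.
have wtB z : B z -> wt M N 0 (fi z).
  move=> [g hg ->]; suff [] : over g /\ wt M N 0 (fi (evalx io y g)) by [].
  move: g hg; apply: poly_over_ind => [||c hc|i|g h [hg eg] [hh eh]|g h [hg eg] [hh eh]].
  - by left.
  - exact: vge1.
  - split; first exact: poly_overC.
    by rewrite evalxC lift_ext_const //; exact/psr_wt/psr_cst.
  - by split; [exact: poly_overX|rewrite evalxX].
  - split; first exact: poly_overD.
    by rewrite evalxD lift_extD; [exact: wtD|exact: PB|exact: PB].
  split; first exact: poly_overM.
  rewrite evalxM lift_extM; [|exact: PB|exact: PB].
  by rewrite -[0]addr0; exact: wtM.
have hBS : is_subring B by exact: alg_subring.
have hJ' := contraction_prime hw hBS hI.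
have [b1 [b2 [h1 h2 n2 eb]]] := Pb; have b20 := prime_neq0 hJ' n2.
have P2 := point_alg hv hw hI h2.
have P2V : P b2^-1 by exact: (loc_inv hBS h2 n2).
have u2 : ~ vge w 1 (s b2 0) by exact: (point_exp_unit hv (hw := hw) (hwc := hwc) hI hrho ht P2 b20 P2V).
have u2q : ~ vge w 1 ((s b2 ^+ q) 0).
  rewrite psr_coefX0; last exact: (point_exp_psr hv hw hwc hI hrho ht P2).
  by move=> h; apply: u2; apply: (vge1X hw _ h); exact: (@lau0 V).
have wt2 := wt_inv M_gt0 (psq _ P2) u2q (lift_ext_frobenius P2) (wtB _ h2).
have -> : fi b = fi b1 * (fi b2)^-1.
  have uf : fi b2 \is a GRing.unit.
    apply/lau_unitE => h; apply: u2q.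
    by have := edivB h (lift_ext_frobenius P2); rewrite subKr; exact.
  apply: (mulIr uf); rewrite mulrVK // -lift_extM //.
  by rewrite eb divfK.
by rewrite -[0]addr0; apply: wtM => //; exact: wtB.
Qed.

End EndLift.

(** * Contributions of the ends *)

Section ResidueTerms.
Variable V : cdvField.
Notation w := (@cdv_val V).
Let hw := @cdv_valP V.
Hypothesis char0 : forall n : nat, (0 < n)%N -> n%:R != 0 :> V.

Lemma null_bisum_ge (c : int -> V) k : null c -> (forall i, vge w k (c i)) -> vge w k (bisum w c).
Proof.
move=> hc hk; have [M hM] := null_bisum hc `|k|%N.
have /(vcloseE w) h := hM M M (leqnn _) (leqnn _).
rewrite -[bisum w c](subKr (bisum_part c M M)); apply: vgeB => //.
  by apply: vgeD => //; apply: vge_sum.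
by apply: vge_le h; lia.
Qed.

Variables (A B U W A0 R : lau V) (h : nat).
Hypothesis eA : A = der U + A0.
Hypothesis psrA0 : psr A0.
Hypothesis eB : B = der W + R.
Hypothesis hR : forall m : nat, (0 < m)%N -> vge w (- h%:Z) (R (-1 - m%:Z) / m%:R).
Hypothesis hR0 : forall N : nat, exists m0 : nat, forall m : nat, (0 < m)%N -> (m0 <= m)%N ->
  vge w N%:Z (R (-1 - m%:Z) / m%:R).

(** As [A0] has no poles, the primitive of [A] is in negative degrees that of [der U], namely the
    integral series [U]. *)
Let pos_term (k : nat) : res_terms A B k%:Z = B k%:Z * U (- k.+1%:Z).
Proof.
rewrite /res_terms /lser_int; congr (_ * _).
have -> : -1 - k%:Z = - k.+1%:Z by lia.
rewrite eA lauD psrA0 ?addr0; last by lia.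
rewrite derE; have -> : - k.+1%:Z - 1 + 1 = - k.+1%:Z by lia.
rewrite mulrAC divff ?mul1r // mulrNz oppr_eq0; exact: char0.
Qed.

(** The denominator [m] of the primitive of [A] is attached to [B]: on [der W] it cancels, and on
    [R] it gives the quotient bounded by hypothesis. *)
Let neg_term (m : nat) : (0 < m)%N -> res_terms A B (-1 - m%:Z) =
  A (m%:Z - 1) * (R (-1 - m%:Z) / m%:R - W (- m%:Z)).
Proof.
move=> m_gt0; rewrite /res_terms /lser_int.
have -> : (-1 - (-1 - m%:Z) : int) = m%:Z by lia.
rewrite mulrCA; congr (_ * _); rewrite eB lauD derE.
have -> : (-1 - m%:Z + 1 : int) = - m%:Z by lia.
rewrite mulrDl mulrNz mulNr mulNr mulrAC divff ?mul1r ?char0 //.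
by rewrite addrC.
Qed.

Lemma res_terms_ge i : vge w (- h%:Z) (res_terms A B i).
Proof.
have [i0|i0] := leP 0 i.
  case: i i0 => // k _; rewrite pos_term; apply: (@vge_le _ w 0); first by lia.
  by apply: vgeMl => //; exact: lau0.
(* This term involves degree 0 of the primitive, which is 0 by the convention on division by 0. *)
have [->|i1] := eqVneq i (-1).
  by rewrite /res_terms /lser_int subrr invr0 !mulr0; left.
pose m := `|(-1 - i)%R|%N; have ei : i = -1 - m%:Z by rewrite /m; lia.
have m_gt0 : (0 < m)%N by rewrite /m; lia.
rewrite ei neg_term //; apply: vgeMl => //; first exact: lau0.
by apply: vgeB => //; [exact: hR|apply: (@vge_le _ w 0); [lia|exact: lau0]].
Qed.

Lemma res_terms_null : null (res_terms A B).
Proof.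
move=> N; have [M hM] := lau_cut U N%:Z; have [M' hM'] := lau_cut W N%:Z.
have [m0 hm0] := hR0 N; exists (M + M' + m0 + 2)%N => i hi.
have [i0|i0] := leP 0 i.
  case: i i0 hi => // k _ hi; rewrite pos_term.
  by apply: vgeMl => //; [exact: lau0|apply: hM; lia].
pose m := `|(-1 - i)%R|%N; have ei : i = -1 - m%:Z by rewrite /m; lia.
have m_gt0 : (0 < m)%N by rewrite /m; lia.
rewrite ei neg_term //; apply: vgeMl => //; first exact: lau0.
apply: vgeB => //; first by apply: hm0 => //; rewrite /m; lia.
by apply: hM'; rewrite /m; lia.
Qed.

End ResidueTerms.

Section PowerBounds.
Variable V : cdvField.
Notation w := (@cdv_val V).
Let hw := @cdv_valP V.
Hypothesis char0 : forall n : nat, (0 < n)%N -> n%:R != 0 :> V.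
Hypothesis hlim : forall N : nat, exists i0 : nat, forall i : nat, (i0 <= i)%N -> (0 < i)%N ->
  N%:Z <= i%:Z - w i%:R.
Variables (y : lau V) (hy : ediv 1 y).

Let pow_ge (i m : nat) : (0 < i)%N -> vge w (i%:Z - w i%:R) ((y ^+ i) (- m%:Z) / i%:R).
Proof.
move=> i_gt0; apply: vgeM => //; first by have := edivX i hy; rewrite mul1r; exact.
by right; rewrite valV //; exact: char0.
Qed.

Lemma power_ge (h : nat) : (forall i : nat, (0 < i)%N -> w i%:R <= i%:Z + h%:Z) ->
  forall i m : nat, (0 < i)%N -> vge w (- h%:Z) ((y ^+ i) (- m%:Z) / i%:R).
Proof.
move=> hh i m i_gt0; apply: vge_le (pow_ge m i_gt0).
by have := hh i i_gt0; move: (w i%:R) => z; lia.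
Qed.

(** For large [i] the divisibility of y^i suffices in every degree; the finitely many other powers
    have bounded pole order at the given precision. *)
Lemma power_null (N : nat) : exists m0 : nat, forall i m : nat, (0 < i)%N -> (m0 <= m)%N ->
  vge w N%:Z ((y ^+ i) (- m%:Z) / i%:R).
Proof.
have [i0 hi0] := hlim N.
have /choice[M hM] : forall i : nat, exists M : nat, cut (N%:Z + w i%:R) (y ^+ i) M.
  by move=> i; exact: lau_cut.
exists (\sum_(i < i0) M i).+1 => i m i_gt0 le_m.
have [le|lt] := leqP i0 i; first by apply: vge_le (hi0 i le i_gt0) (pow_ge m i_gt0).
have le_M : (M i < m)%N.
  by apply: leq_trans le_m; rewrite ltnS (bigD1 (Ordinal lt)) //= leq_addr.
rewrite -[N%:Z](addrK (w i%:R)); apply: vgeM => //; first by apply: hM; lia.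
by right; rewrite valV //; exact: char0.
Qed.

End PowerBounds.

(** * The numerical bound *)

Section PadicField.
Variables (p : nat) (Qp : fieldType) (vp : Qp -> int) (hQp : is_padic_field p vp).
Let hp : prime p. Proof. by case: hQp. Qed.
Let hvp : discrete_valuation vp. Proof. by case: hQp. Qed.

Lemma padic_val (r : rat) : r != 0 ->
  vp (ratr r) = (logn p `|numq r|%N)%:Z - (logn p `|denq r|%N)%:Z.
Proof. by case: hQp => _ _ h _ _; exact: h. Qed.

Lemma padic_val_nat (n : nat) : (0 < n)%N -> vp n%:R = (logn p n)%:Z.
Proof.
move=> n_gt0; have n0 : (n%:R : rat) != 0 by rewrite pnatr_eq0; lia.
have := padic_val n0; rewrite -[n%:R]/(n%:~R) ratr_int numq_int denq_int.
by rewrite logn1 subr0.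
Qed.

Lemma padic_char0 (n : nat) : (0 < n)%N -> n%:R != 0 :> Qp.
Proof.
move=> n_gt0; apply/eqP => e0; have := padic_val_nat n_gt0.
have np_gt0 : (0 < n * p)%N by rewrite muln_gt0 n_gt0 prime_gt0.
have := padic_val_nat np_gt0; rewrite natrM e0 mul0r => ->.
by rewrite (lognM p n_gt0 (prime_gt0 hp)) (logn_prime p hp) eqxx; lia.
Qed.

Lemma padic_vge_p : vge vp 1 p%:R.
Proof. by right; rewrite padic_val_nat ?prime_gt0 // logn_prime // eqxx. Qed.

Let vge_dvd (z : int) : (p%:Z %| z)%Z -> vge vp 1 z%:~R.
Proof.
by case/dvdzP => k ->; rewrite intrM; apply: vgeMl => //; [exact: vge_int|exact: padic_vge_p].
Qed.

(** By density every integral element is congruent to a rational number with denominator prime to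
    [p]; inverting the denominator modulo [p] leads to a representative among 0, ..., p - 1. *)
Lemma padic_finite_residue : finite_residue vp.
Proof.
have [_ _ _ dense _] := hQp.
exists [seq i%:R | i <- iota 0 p] => x hx; have [r /(vcloseE vp) hr] := dense x 1%N.
have vr : vge vp 0 (ratr r).
  by rewrite -(subKr x (ratr r)); apply: vgeB => //; apply: vge_le hr.
have mem (z : int) : 0 <= z -> z < p%:Z -> z%:~R \in [seq (i%:R : Qp) | i <- iota 0 p].
  by case: z => // k _ lt; apply/mapP; exists k => //; rewrite mem_iota /=; lia.
have pz : (0 : int) < p%:Z by have := prime_gt0 hp; lia.
have [r0|r0] := eqVneq r 0.
  exists 0; first by have := mem 0; apply.
  by split; [left|move: hr; rewrite r0 /ratr mul0r].
have rr0 : ratr r != 0 :> Qp.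
  rewrite /ratr mulf_neq0 ?invr_eq0 //.
    have := padic_char0 (n := `|numq r|%N); rewrite absz_gt0 numq_eq0 => /(_ r0).
    by case: (numq r) => k //; rewrite NegzE mulrNz oppr_eq0.
  have := padic_char0 (n := `|denq r|%N); rewrite absz_gt0 denq_eq0 => /(_ isT).
  by case: (denq r) => k //; rewrite NegzE mulrNz oppr_eq0.
have cop : coprime p `|denq r|.
  rewrite prime_coprime //; apply/negP => pd.
  move/(vgeP _ _ rr0): vr; rewrite padic_val //.
  have : ~~ (p %| `|numq r|)%N.
    apply/negP => pn; have := coprime_num_den r.
    rewrite /coprime => /eqP g1; have : (p %| 1)%N by rewrite -g1 dvdn_gcd pn pd.
    by rewrite dvdn1 => /eqP p1; move: hp; rewrite p1.
  move=> npn; have -> : logn p `|numq r| = 0%N.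
    by rewrite lognE; case: ifP => // /and3P[_ _ h]; rewrite h in npn.
  have : (0 < logn p `|denq r|)%N by rewrite logn_gt0 mem_primes hp pd absz_gt0 denq_eq0.
  by lia.
pose d := denq r; pose a := numq r.
have [c hc] : exists c : int, (p%:Z %| c * d - 1)%Z.
  have /coprimezP[[u1 u2] /= hu] : coprimez p%:Z d by exact: cop.
  by exists u2; apply/dvdzP; exists (- u1); rewrite -hu; ring.
pose z := ((a * c) %% p%:Z)%Z.
have z0 : 0 <= z by rewrite modz_ge0 //; lia.
have zp : z < p%:Z by rewrite ltz_pmod.
exists z%:~R; first exact: mem.
split; first exact: vge_int.
apply: (vge_trans hvp hr); have d0 : (d%:~R : Qp) != 0.
  by move: rr0; rewrite /ratr mulf_eq0 invr_eq0 negb_or => /andP[].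
have -> : ratr r - z%:~R = (a - z * d)%:~R * (d%:~R)^-1 :> Qp.
  by rewrite /ratr intrB intrM mulrBl mulfK.
apply: vgeMr => //.
  apply: vge_dvd; have -> : a - z * d = (a * c - z) * d - a * (c * d - 1) by ring.
  apply: rpredB; last exact: dvdz_mull.
  apply: dvdz_mulr; rewrite {1}(divz_eq (a * c) p%:Z) -/z addrK; exact: dvdz_mull.
have nd : ~ (p %| `|d|)%N.
  by move=> h; move: cop; rewrite prime_coprime // h.
have vd : vp d%:~R = 0.
  have dn : (0 < `|d|)%N by rewrite absz_gt0 denq_eq0.
  have := padic_val_nat dn; rewrite lognE; case: ifP => [/and3P[_ _ h] //|_].
  by rewrite -[_%:R]/((`|d|%N : int)%:~R) gtz0_abs // denq_gt0.
by right; rewrite valV // vd.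
Qed.

End PadicField.

Section Exponent.
Variables (p e h : nat) (hp : prime p) (j : int).
Hypothesis hj : is_ceil_log p (e%:R / (p%:R - 1)) j.
Hypothesis hh : h%:R = Num.max 0 (e%:R * j%:~R - p%:R ^ j) :> rat.

Let p1_gt0 : 0 < p%:R - 1 :> rat.
Proof. by rewrite subr_gt0 ltr1n prime_gt1. Qed.

Lemma ramification_gt0 : (0 < e)%N.
Proof.
have /andP[h1 _] := hj; rewrite -(ltr0n rat) -(pmulr_lgt0 _ (x := (p%:R - 1)^-1)) ?invr_gt0 //.
by apply: lt_trans h1; apply: exprz_gt0; rewrite ltr0n prime_gt0.
Qed.

(** From e >= 1 one gets e / (p - 1) > 1 / p, which excludes negative [j]. *)
Lemma ceil_log_ge0 : 0 <= j.
Proof.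
have /andP[_ h2] := hj; have e_gt0 := ramification_gt0.
case: (j) h2 => // k h2; exfalso.
have pk : (p <= p ^ k.+1)%N by rewrite expnS leq_pmulr // expn_gt0 prime_gt0.
have p_gt0 : 0 < p%:R :> rat by rewrite ltr0n prime_gt0.
have h3 : e%:R / (p%:R - 1) <= (p%:R)^-1 :> rat.
  apply: le_trans h2 _; rewrite NegzE -exprnN lef_pV2 ?posrE ?exprn_gt0 //.
  by rewrite -natrX ler_nat.
move: h3; rewrite ler_pdivrMr // mulrC ler_pdivlMr ?ltr0n ?prime_gt0 //.
apply/negP; rewrite -ltNge; apply: (@lt_le_trans _ _ p%:R); first by rewrite gtrBl.
by rewrite -natrM ler_nat leq_pmull.
Qed.

(** The increment of e s - p^s at s is e - p^s (p - 1). As [j] is the rounded logarithm of e / (p -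
    1), it is nonnegative for s < j and nonpositive from s = j on. *)
Lemma logn_exponent (i : nat) : (0 < i)%N -> (e * logn p i <= i + h)%N.
Proof.
move=> i_gt0; have := ceil_log_ge0; case ej : (j) => [J|//] _.
have /andP[] := hj; rewrite ej ltr_pdivlMr // ler_pdivrMr // => h1 h2.
have p1E : p.-1%:R = p%:R - 1 :> rat.
  by rewrite -[in RHS](prednK (prime_gt0 hp)) -natr1 addrK.
have eJ : (e <= p ^ J * p.-1)%N.
  by rewrite -(ler_nat rat) natrM natrX p1E.
have lt_e s : (s < J)%N -> (p ^ s * p.-1 <= e)%N.
  move=> lt; apply: (@leq_trans (p ^ J.-1 * p.-1)).
    by rewrite leq_mul2r leq_exp2l ?prime_gt1 //; apply/orP; right; lia.
  apply: ltnW; rewrite -(ltr_nat rat) natrM natrX p1E.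
  have -> : p%:R ^+ J.-1 = p%:~R ^ (J%:Z - 1) :> rat; last exact: h1.
  have -> : J%:Z - 1 = J.-1 by lia.
  by [].
have pS s : (p ^ s.+1 = p ^ s + p ^ s * p.-1)%N.
  by rewrite -[X in (X + _)%N]muln1 -mulnDr add1n prednK ?prime_gt0 // expnSr.
have up d : (e * (J + d) + p ^ J <= e * J + p ^ (J + d))%N.
  elim: d => [|d IH]; first by rewrite addn0.
  rewrite addnS pS mulnS.
  have : (p ^ J * p.-1 <= p ^ (J + d) * p.-1)%N by rewrite leq_mul2r leq_exp2l ?prime_gt1 // leq_addr orbT.
  by lia.
have down d s : (s + d = J)%N -> (e * s + p ^ J <= e * J + p ^ s)%N.
  elim: d s => [|d IH] s es; first by rewrite -es addn0.
  have := IH s.+1; rewrite addSnnS es => /(_ erefl); rewrite pS mulnS.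
  have h3 : (p ^ s * p.-1 <= e)%N by apply: lt_e; lia.
  by move=> h4; lia.
set s := logn p i.
have main : (e * s + p ^ J <= e * J + p ^ s)%N.
  have [le|lt] := leqP J s; first by have := up (s - J)%N; rewrite subnKC.
  by apply: (down (J - s)%N); lia.
have hJ : (e * J <= h + p ^ J)%N.
  rewrite -(ler_nat rat) natrD !natrM natrX hh ej -lerBlDr.
  by rewrite le_max lexx orbT.
have ps : (p ^ s <= i)%N by apply: dvdn_leq => //; exact: pfactor_dvdnn.
by lia.
Qed.

(** With s the exponent of [p] in [i], either s is at most s0 or i >= p^s exceeds (k+1)^2 for k half
    of s, which outgrows N + e s. *)
Lemma logn_limit (N : nat) : exists i0 : nat, forall i : nat, (i0 <= i)%N -> (0 < i)%N ->
  (N + e * logn p i <= i)%N.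
Proof.
pose s0 := (2 * (N + 2 * e)).+1; exists (N + e * s0)%N => i hi i_gt0.
set s := logn p i; have [le|lt] := leqP s s0; first by nia.
have ps : (p ^ s <= i)%N by apply: dvdn_leq => //; exact: pfactor_dvdnn.
pose k := s./2; have lek : (N + 2 * e <= k)%N by rewrite /k; lia.
have s_le : (s <= 2 * k + 1)%N by rewrite /k; lia.
have le_s : (2 * k <= s)%N by rewrite /k; lia.
have k2 : (k < 2 ^ k)%N by exact: ltn_expl.
have : (2 ^ (2 * k) <= p ^ s)%N.
  apply: (@leq_trans (p ^ (2 * k))); first by rewrite leq_exp2r ?prime_gt1 //; lia.
  by rewrite leq_exp2l ?prime_gt1.
rewrite mulnC expnM => h1.
have : (k.+1 ^ 2 <= (2 ^ k) ^ 2)%N by rewrite leq_exp2r.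
rewrite !expnS !expn0 !muln1 in h1 * => h2; nia.
Qed.

End Exponent.

(** * The contribution of one end *)

Section EndContribution.
Variables (K : fieldType) (v : K -> int) (hv : discrete_valuation v) (hvc : vcomplete v).
Variables (pi : K) (hpi : uniformiser v pi).
Variables (p : nat) (hp : prime p) (hvp : vge v 1 p%:R) (e' : nat).
Notation q := (p ^ e')%N.
Variable sigma : {rmorphism K -> K}.
Hypothesis hsigma : forall c, vring v c -> vmax v (sigma c - c ^+ q).
Variables (F : fieldType) (io : {rmorphism K -> F}) (C : set (set F)).
Hypothesis hproper : is_proper v io C.
Variables (m : nat) (x : 'I_m.+1 -> F) (f : 'I_m -> {mpoly K[m.+1]}).
Hypothesis hA : is_affine_open v io C (alg v io x).
Hypothesis hpres : is_presentation v io x f.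
Variables (J : 'M[{mpoly K[m.+1]}]_(m.+1, m)) (Delta : 'I_m -> 'M[{mpoly K[m.+1]}]_m).
Hypothesis hJ : is_jacobian_inverse v f J Delta.
Variable S : 'cV[mps K m.+1]_m.
Hypothesis hS : is_lift_solution v sigma q f J Delta S.
Variables (L : fieldExtType K) (w : L -> int) (hw : discrete_valuation w) (hwc : vcomplete w).
Hypothesis hLK : forall c : K, c != 0 -> w c%:A = v c.
Variables (FL : fieldType) (iF : {rmorphism F -> FL}) (iL : {rmorphism L -> FL}).
Hypothesis hFL : is_tensor_field io iF iL.
Variables (n : nat) (y : 'I_n -> F).
Notation B := (alg v io y).
Hypothesis hB : is_affine_open v io C B.
Notation BB := (base_change w iF iL B).
Variables (I : set FL) (hI : is_prime_ideal BB I).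
Notation O := (localisation BB I).
Variables (rho : FL -> L) (hrho : is_section w iL O rho).
Variables (t : FL) (ht : is_section_equation O rho t).
Variables (xi : mps K m.+1 -> int -> L).
Hypothesis hxi : is_expansion_map v io w iF iL x f O t xi.
Notation V := (CDVField hw hwc).
Notation mpol := {mpoly K[m.+1]}.
Notation over := (poly_over (vring v)).
Notation ev g := (evalx io x g).
Notation P := (point v io iF y I).
Notation s z := (sO hw hwc iL O t (iF z)).
Notation X := (poly_expansion hw hwc xi).
Notation ph := (phi sigma q J S).

Let hio c : iF (io c) = iL c%:A. Proof. by case: hFL => h _; exact: h. Qed.
Let hf j : over (f j). Proof. by case: hpres => h _; exact: h. Qed.
Let hX : is_expansion v f X := poly_expansionP hv hpres hw hwc hLK hio hI hrho ht hxi.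
Let hP : is_subring P := point_subring hv hw hI.
Let Pg z : P z -> gloc v io x X z :=
  @point_gloc _ _ hv _ _ _ hproper _ _ _ hA hpres _ _ hw hwc hLK _ _ _ hio _ _ hB _ hI _ hrho _ ht _ hxi z.
Let Pext z : P z -> ext v io x X X z = s z :=
  @point_ext _ _ hv _ _ _ hproper _ _ _ hA hpres _ _ hw hwc hLK _ _ _ hio _ _ hB _ hI _ hrho _ ht _ hxi z.

Notation Xi := (lift_expansion p e' sigma J S hw hwc xi).
Notation fi := (ext v io x X Xi).
Let hXi : is_expansion v f Xi :=
  lift_expansionP hv hp hvp hsigma hpres hJ hS hw hwc hLK hFL hI hrho ht hxi.
Let lift_expansion_unit := lift_expansion_unit hv hpi hp hvp hsigma hpres hJ hS (hw := hw) (hwc := hwc) hLK hFL hI hrho ht hxi.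

Hypothesis hA_smooth : minors_unit v io x f [set z | exists2 y, alg v io x y & z = io pi * y].
Variables (Om : lmodType F) (d : F -> Om) (hd : is_kaehler io d).
Variables (D D' : set F -> F).
Hypothesis hD : is_effective_divisor v io C D.
Hypothesis hD_fin : is_finite_divisor v io C D.
Hypothesis char0 : forall n : nat, (0 < n)%N -> n%:R != 0 :> V.
Variables (s0 : nat) (s0_gt0 : (0 < s0)%N).
Hypothesis hQ : forall x, vge w 0 x -> vge w 1 (x ^+ (p ^ s0)%N - x).
Variable h : nat.
Hypothesis hh : forall i : nat, (0 < i)%N -> w i%:R <= i%:Z + h%:Z.
Hypothesis hlim : forall N : nat, exists i0 : nat, forall i : nat, (i0 <= i)%N -> (0 < i)%N ->
  N%:Z <= i%:Z - w i%:R.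

Let vwp : vge w 1 p%:R.
Proof. by have /(vge_LK hLK) := hvp; rewrite scaler_nat. Qed.
Let vpi0 : vring v pi. Proof. by right; case: hpi => _ ->. Qed.

Let hl : exists l, ~ ediv 1 (X (Dpol f l)).
Proof.
apply: (ediv_minor hv hpres hX vpi0 _ hA_smooth).
rewrite (poly_expansion_const hv hw hwc hLK hio hI hrho ht hxi) //.
by apply/ediv_cst/(vge_LK hLK); right; case: hpi => _ ->.
Qed.

Let param : exists2 tau, P tau & vge w 1 (s tau 0) /\ ~ vge w 1 (s tau 1).
Proof.
apply: (local_parameter hv hw hwc hI hrho ht _ hQ).
by rewrite natrX -(prednK s0_gt0) exprS; apply: vgeMr => //; rewrite -natrX; exact: vge_nat.
Qed.

(** The local equation of D is invertible in [gloc], because by [divisor_nonzero] its expansion does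
    not vanish modulo the maximal ideal. *)
Lemma O_stalk_gloc u : O_stalk D P u -> gloc v io x X u.
Proof.
move=> hu; have [tau Ptau [tau0 tau1]] := param.
have CP : C P by exact: (point_curve hv hw hB hI).
have nD := divisor_nonzero hv hLK hFL hI hrho ht Ptau tau0 tau1 CP hD hD_fin.
have [PD D0] := hD.1 P CP.
have [g1 [g2 hg]] := Pg PD; have [h1 h2 n2 eD] := hg.
have e := extP hv hpres hX hX (fun g _ => id) hg; rewrite (Pext PD) in e.
have -> : u = D P * u * (D P)^-1 by rewrite mulrC mulKf.
apply: (subM (gloc_subring hv hpres hX)); first exact: Pg.
exists g2, g1; split=> //; last by rewrite eD invf_div.
by rewrite -e => /ediv1M[].
Qed.

Let stalk_expand om c : H0_I d C D D' om -> (forall k, over (c k)) ->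
  om = form_of io d x c -> exists u r (a a' : 'I_r -> F),
  [/\ gloc v io x X u, forall i, P (a i), forall i, P (a' i)
    & form_of io d x c = d u + \sum_i a i *: d (a' i)].
Proof.
move=> hom hc e; have CP : C P by exact: (point_curve hv hw hB hI).
have [_ [u hu [r [a [a' [ha ha' ed]]]]]] := hom P CP.
exists u, r, a, a'; split=> //; first exact: O_stalk_gloc.
by rewrite -ed -e addrC subrK.
Qed.

Let hpi' : exists pi, uniformiser v pi. Proof. by exists pi. Qed.
Let Afrac : has_fraction_field (alg v io x). Proof. by case: hA. Qed.

Let coefs (gp xp : 'I_m.+1 -> mps K m.+1) : (forall k, dagger v (gp k)) ->
  (forall k, dagger v (xp k)) ->
  expand_form w xi gp xp = \sum_k xiE hw hwc xi (gp k) * der (xiE hw hwc xi (xp k)) :> (int -> L).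
Proof.
move=> hg hx; apply/funext => i; rewrite lau_sum; apply: eq_bigr => k _.
by rewrite lauM /= (xiP hw hwc hxi) // (xiP hw hwc hxi).
Qed.

Theorem end_contribution om eta c b : H0_I d C D D' om -> H0_I d C D D' eta ->
  (forall k, over (c k)) -> om = form_of io d x c ->
  (forall k, over (b k)) -> eta = form_of io d x b ->
  null (V := V) (contribution_terms w ph xi c b) /\
  forall i, vge w (- h%:Z) (contribution_terms w ph xi c b i).
Proof.
move=> hom heta hc eom hb eeta.
have [u1 [r1 [a1 [a1' [gu1 ha1 ha1' e1]]]]] := stalk_expand hom hc eom.
have [u2 [r2 [a2 [a2' [gu2 ha2 ha2' e2]]]]] := stalk_expand heta hb eeta.
have [l nl] := hl; have [tau Ptau [tau0 tau1]] := param.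
(* The decompositions at P are carried to Laurent series, for [om] by the plain expansion and for
   [eta] by the expansion of the lift. *)
have f1 := ext_form hv hpres hX hX (fun g _ => id) hd Afrac nl hpi' hc gu1
  (fun i => Pg (ha1 i)) (fun i => Pg (ha1' i)) e1.
have f2 := ext_form hv hpres hX hXi lift_expansion_unit hd Afrac nl hpi' hb gu2
  (fun i => Pg (ha2 i)) (fun i => Pg (ha2' i)) e2.
have oX k : over ('X_k : mpol) by exact: poly_overX.
have dX g : over g -> dagger v (mps_of g) by move=> hg; exact: (dagger_poly hg).
have dph g : over g -> dagger v (ph g).
  exact: (phi_dagger hv hp hvp hsigma hf hJ hS).
pose R := \sum_i fi (a2 i) * der (fi (a2' i)).
have psrA0 : psr (\sum_i ext v io x X X (a1 i) * der (ext v io x X X (a1' i))).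
  apply: psr_sum => i _; rewrite !Pext //; apply: psrM.
    exact: (point_exp_psr hv hw hwc hI hrho ht (ha1 i)).
  by apply: psr_der; exact: (point_exp_psr hv hw hwc hI hrho ht (ha1' i)).
have vspi : vge w 1 ((sigma pi)%:A : V).
  apply/(vge_LK hLK); apply: (sigma_ge1 hv hp hsigma).
  by right; case: hpi => _ ->.
have Ppi : P (io pi) by exact: (point_const hv hw hI).
have q_gt0 : (0 < q)%N by rewrite expn_gt0 prime_gt0.
have est (c0 : int) (m0 : nat) := @form_estimate V char0 p hp vwp F P hP fi (fun z => s z) q q_gt0
  (lift_extD hv hpi hp hvp hsigma hproper hA hpres hJ hS hw hwc hLK hFL hB hI hrho ht hxi)
  (lift_extM hv hpi hp hvp hsigma hproper hA hpres hJ hS hw hwc hLK hFL hB hI hrho ht hxi)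
  (lift_ext1 hv hpi hp hvp hsigma hpres hJ hS hw hwc hLK hFL hI hrho ht hxi)
  (fun z hz => point_exp_psr hv hw hwc hI hrho ht hz)
  (lift_ext_frobenius hv hpi hp hvp hsigma hproper hA hpres hJ hS hw hwc hLK hFL hB hI hrho ht hxi)
  (io pi) tau Ppi Ptau _ vspi
  (lift_ext_const hv hpi hp hvp hsigma hpres hJ hS hw hwc hLK hFL hI hrho ht hxi vpi0)
  tau0 s0 s0_gt0
  (frobenius_expand hv hvc hpi hLK hFL hI hrho ht hQ Ptau tau0 tau1)
  (lift_ext_weight hv hpi hp hvp hsigma hproper hA hpres hJ hS hw hwc hLK hFL hB hI hrho ht hxi) c0 m0.
have ediv_y := lift_ext_frobenius hv hpi hp hvp hsigma hproper hA hpres hJ hS hw hwc hLK hFL hB hI hrho ht hxi Ptau.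
have Rsum (c0 : int) (m0 : nat) : (forall i k : nat, (0 < i)%N -> (m0 <= k)%N ->
      vge w c0 (((fi tau - s tau ^+ q) ^+ i) (- k%:Z) / i%:R)) ->
    forall k : nat, (0 < k)%N -> (m0 <= k)%N -> vge w c0 (R (-1 - k%:Z) / k%:R).
  move=> hy k k_gt0 le_k; rewrite lau_sum mulr_suml; apply: vge_sum => // i _.
  exact: (est c0 m0 hy).
have hR k : (0 < k)%N -> vge w (- h%:Z) (R (-1 - k%:Z) / k%:R).
  by move=> k_gt0; apply: (Rsum _ 0%N) => // i j i_gt0 _; exact: (power_ge char0 ediv_y hh).
have hR0 (N : nat) : exists m0 : nat, forall k : nat, (0 < k)%N -> (m0 <= k)%N ->
    vge w N%:Z (R (-1 - k%:Z) / k%:R).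
  have [m0 hm0] := power_null char0 hlim ediv_y N.
  by exists m0 => k k_gt0 le_k; apply: (Rsum _ m0).
rewrite /contribution_terms !coefs; try (by move=> k; auto).
split; first exact: (res_terms_null char0 f1 psrA0 f2 hR0).
exact: (res_terms_ge char0 f1 psrA0 f2 hR).
Qed.

End EndContribution.

Theorem corollary10p11
  (* K is a finite extension of Q_p with ramification index e *)
  (p : nat) (Qp : fieldType) (vp : Qp -> int) (hQp : is_padic_field p vp)
  (K : fieldExtType Qp) (v : K -> int) (hv : discrete_valuation v)
  (e : nat) (he : forall c : Qp, c != 0 -> v c%:A = e%:Z * vp c)
  (pi : K) (hpi : uniformiser v pi)
  (* sigma induces the power map of exponent p' on the residue field *)
  (p' : nat) (hp' : exists a : nat, p' = (p ^ a)%N)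
  (sigma : {rmorphism K -> K}) (hsigma_bij : bijective sigma)
  (hsigma : forall c, vring v c -> vmax v (sigma c - c ^+ p'))
  (* C is a curve of genus g over R, with function field F *)
  (F : fieldType) (io : {rmorphism K -> F})
  (Om : lmodType F) (d : F -> Om) (hd : is_kaehler io d)
  (C : set (set F)) (g : nat) (hC : is_curve v pi io d C g)
  (* Spec A with A = R[x] is an open affine containing the generic point of C_k *)
  (m : nat) (x : 'I_m.+1 -> F) (f : 'I_m -> {mpoly K[m.+1]})
  (hA : is_affine_open v io C (alg v io x))
  (hA_generic : forall P0, is_special_generic_point pi io C P0 ->
     spec (alg v io x) P0)
  (hA_pres : is_presentation v io x f)
  (hA_smooth : minors_unit v io x f
     [set z | exists2 y, alg v io x y & z = io pi * y])
  (* the data which define the lift phi *)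
  (P : 'M[{mpoly K[m.+1]}]_(m.+1, m)) (Delta : 'I_m -> 'M[{mpoly K[m.+1]}]_m)
  (hP : is_jacobian_inverse v f P Delta)
  (S : 'cV[mps K m.+1]_m) (hS : is_lift_solution v sigma p' f P Delta S)
  (* the divisors D and D' *)
  (D D' : set F -> F)
  (hD : is_effective_divisor v io C D) (hD_fin : is_finite_divisor v io C D)
  (hD' : is_effective_divisor v io C D') (hD'_fin : is_finite_divisor v io C D')
  (degD : nat) (hdegD : has_special_degree v pi io C D degD)
  (hdegD_ge : 2 * g%:Z - 1 <= degD%:Z)
  (hDD' : forall Q, C Q -> forall u, O_stalk D Q u -> diff_stalk d D' Q (d u))
  (hDA : forall Q, spec (alg v io x) Q -> ~ in_support C D Q)
  (* the finite unramified extension L of K and the base change of C to R_L *)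
  (L : fieldExtType K) (w : L -> int) (hw : discrete_valuation w)
  (hLK : forall c : K, c != 0 -> w c%:A = v c)
  (FL : fieldType) (iF : {rmorphism F -> FL}) (iL : {rmorphism L -> FL})
  (hFL : is_tensor_field io iF iL)
  (* the ends, with their parameters and expansion maps *)
  (r : nat) (q : 'I_r -> set FL) (hq_inj : injective q)
  (hq : forall O, is_end v pi io C w iF iL x O <-> exists i, q i = O)
  (hq_rat : forall i, is_rational_point w iL (q i))
  (rho : 'I_r -> FL -> L) (hrho : forall i, is_section w iL (q i) (rho i))
  (t : 'I_r -> FL) (ht : forall i, is_section_equation (q i) (rho i) (t i))
  (xi : 'I_r -> mps K m.+1 -> int -> L)
  (hxi : forall i, is_expansion_map v io w iF iL x f (q i) (t i) (xi i))
  (* the exponent h *)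
  (j : int) (hj : is_ceil_log p (e%:R / (p%:R - 1)) j)
  (h : nat) (hh : h%:R = Num.max 0 (e%:R * j%:~R - p%:R ^ j) :> rat) :
  let ph := phi sigma p' P S in
  let form := form_of io d x in
  (* the contributions of the ends *)
  (forall (om eta : Om) (c b : 'I_m.+1 -> {mpoly K[m.+1]}),
     H0_I d C D D' om -> H0_I d C D D' eta ->
     (forall k, poly_over (vring v) (c k)) -> om = form c ->
     (forall k, poly_over (vring v) (b k)) -> eta = form b ->
     forall i,
       bisummable w (contribution_terms w ph (xi i) c b) /\
       vring w (pi%:A ^+ h * contribution w ph (xi i) c b)) /\
  (* the matrix M_2 *)
  (forall (om : 'I_(2 * g) -> Om) (c : 'I_(2 * g) -> 'I_m.+1 -> {mpoly K[m.+1]})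
     (M2 : 'M[K]_(2 * g)),
     (forall k, H0_I d C D D' (om k)) ->
     classes_form_dR_basis v io d C D om ->
     (forall k l, poly_over (vring v) (c k l)) ->
     (forall k, om k = form (c k)) ->
     (forall k l, (M2 k l)%:A =
        \sum_i contribution w ph (xi i) (c k) (c l) :> L) ->
     forall k l, vring v (pi ^+ h * M2 k l)).
Proof.
move=> ph form.
have hp : prime p by case: hQp.
have [a ep'] := hp'; subst p'.
have e_gt0 := ramification_gt0 hp hj.
have hvp : discrete_valuation vp by case: hQp.
have hvc : vcomplete v by apply: (extension_complete hvp hv e_gt0 he); case: hQp.
(* L is unramified over K, which is the case of index 1 of the results on extensions. *)
have hLK1 (c : K) : c != 0 -> w c%:A = 1%N%:Z * v c by move=> c0; rewrite mul1r hLK.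
have hwc : vcomplete w by exact: (extension_complete hv hw (ltn0Sn 0) hLK1 hvc).
have natA (T : fieldType) (T' : fieldExtType T) (n : nat) : n%:R = (n%:R : T)%:A :> T'.
  by rewrite scaler_nat.
have char0K (n : nat) : (0 < n)%N -> n%:R != 0 :> K.
  by move=> n0; rewrite (natA Qp); apply: scalar_neq0; exact: (padic_char0 hQp).
have char0 (n : nat) : (0 < n)%N -> n%:R != 0 :> L.
  by move=> n0; rewrite (natA K); apply: scalar_neq0; exact: char0K.
have wn (n : nat) : (0 < n)%N -> w n%:R = (e * logn p n)%N.
  move=> n0; rewrite (natA K) hLK ?char0K // (natA Qp) he ?(padic_char0 hQp) //.
  by rewrite (padic_val_nat hQp).
have hvpK : vge v 1 p%:R.
  have := vge_scalar e_gt0 he (padic_vge_p hQp); rewrite -natA mulr1; apply: vge_le.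
  by move: e_gt0; lia.
have vwp : vge w 1 p%:R by have /(vge_LK hLK) := hvpK; rewrite -natA.
have frw : finite_residue w.
  apply: (finite_residue_ext hv hw (ltn0Sn 0) hLK1).
  by apply: (finite_residue_ext hvp hv e_gt0 he); exact: padic_finite_residue hQp.
have [s0 [s0_gt0 hQ]] := residue_power hw hp vwp frw.
have hnum (i : nat) : (0 < i)%N -> w i%:R <= i%:Z + h%:Z.
  by move=> i0; rewrite wn // -PoszD lez_nat; exact: (logn_exponent hp hj hh).
have hlim (N : nat) : exists i0 : nat, forall i : nat, (i0 <= i)%N -> (0 < i)%N ->
    N%:Z <= i%:Z - w i%:R.
  have [i0 hi0] := logn_limit e hp N; exists i0 => i le i_gt0.
  by rewrite wn // lerBrDr -PoszD lez_nat; exact: hi0.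
have [pi0 vpi] := hpi.
have main om eta c b : H0_I d C D D' om -> H0_I d C D D' eta ->
    (forall k, poly_over (vring v) (c k)) -> om = form c ->
    (forall k, poly_over (vring v) (b k)) -> eta = form b ->
    forall i, bisummable w (contribution_terms w ph (xi i) c b) /\
      vring w (pi%:A ^+ h * contribution w ph (xi i) c b).
  move=> hom heta hc eom hb eeta i.
  have [[B hB [I hI eq]] _ _] := (hq (q i)).2 (ex_intro _ i erefl).
  have [[n [y eB]] _ _] := hB; subst B.
  have hr := hrho i; have hti := ht i; have hx := hxi i; rewrite eq in hr hti hx.
  have [hnull hge] := end_contribution hv hvc hpi hp hvpK hsigma (curve_proper hC) hA hA_pres
    hP hS (hw := hw) (hwc := hwc) hLK hFL hB hI hr hti hx hA_smooth hd hD hD_fin char0 s0_gt0 hQ hnum hlim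
    hom heta hc eom hb eeta.
  split; first by exists (bisum w (contribution_terms w ph (xi i) c b)); exact: (null_bisum hnull).
  have hX : vge w h%:Z (pi%:A ^+ h : L).
    right; rewrite valX ?scalar_neq0 // hLK // vpi; lia.
  by have := vgeM hw hX (null_bisum_ge hnull hge); rewrite subrr.
split=> // om c M2 hom _ hc eom hM2 k l.
apply/(vge_LK hLK).
have -> : (pi ^+ h * M2 k l)%:A = \sum_i pi%:A ^+ h * contribution w ph (xi i) (c k) (c l) :> L.
  by rewrite -mulr_sumr -hM2 -[RHS]/(in_alg L pi ^+ h * in_alg L (M2 k l)) -rmorphXn -rmorphM.
by apply: vge_sum => // i _; have [] := main _ _ _ _ (hom k) (hom l) (hc k) (eom k) (hc l) (eom l) i.
Qed.
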